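(* Let $\lambda>1>a>0$, consider the iris system with parameters $(\lambda,a)$, and define $\rho(u)=u^{\lambda}-u+a$. (1) If $\rho$ has two isolated (distinct) positive real roots, then the iris system has a stable limit cycle. Let $u$ denote the smallest positive real root of $\rho$ and let $s=u^{\lambda}$. The limit cycle trajectory enters each square at local coordinates $(1,u)$ and exits each square at local coordinates $(s,1)$. The period of the limit cycle is $T=4\log(1/u)$. (2) Suppose, as in (1), that $\rho$ has two isolated (distinct) positive real roots, with $u$ the smallest one and $s=u^\lambda$. Let $\theta\in[0,4)$ be the phase of an instantaneous perturbation in the direction $\eta$, where $\eta\in\mathbb{R}^2$ is a unit vector in the $L_1$ norm, and write $\theta=k+\varphi$ with $k\in\{0,1,2,3\}$ and $\varphi\in[0,1)$. If $k=0$, the infinitesimal phase response of the limit cycle is $$Z(\eta,\varphi,a)=\frac{\eta\cdot\beta(\varphi)}{\log(1/u)\,(u-\lambda s)},\qquad \beta(\varphi)=\left(s^{1-\varphi},\,u^{\varphi}\right),\qquad \eta=(\eta_s,\eta_u).$$ If $k\in\{1,2,3\}$, the infinitesimal phase response is $Z(\eta',\varphi,a)$, where $Z$ denotes the same expression, $\eta'=\mathcal{R}^k\eta$ and $\mathcal{R}=\begin{pmatrix}0&-1\\1&0\end{pmatrix}$. The magnitudes of the phase responses to perturbations parallel to the stable and to the unstable eigenvector directions are greatest at phases corresponding to boundaries between the piecewise linear regions; that is, as functions of $\varphi\in[0,1]$ given by the formula $Z(\eta,\varphi,a)=\frac{\eta\cdot(s^{1-\varphi},\,u^{\varphi})}{\log(1/u)\,(u-\lambda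 s)}$ (extended to $\varphi=1$ by continuity), $|Z((1,0),\varphi,a)|$ and $|Z((0,1),\varphi,a)|$ each attain their maximum at an endpoint of $[0,1]$. (3) As $a\to0^+$ with $\lambda$ fixed: the entry coordinate satisfies $u=a+o(a)$; the infinitesimal phase response to perturbations parallel to the unstable eigendirection of a given square diverges, i.e. $|Z((0,1),\varphi,a)|\to\infty$ for every $\varphi\in[0,1)$; and the infinitesimal phase response to perturbations parallel to the stable eigendirection satisfies $|Z((1,0),\varphi,a)|\to\infty$ if $\varphi\in(1-1/\lambda,1)$, and $Z((1,0),\varphi,a)\to0$ if $\varphi\in[0,1-1/\lambda]$.
   Context: Iris system (nondimensionalized, half side length $1$). Let $\lambda>0$ and $0\le a<1$. Identify $\mathbb{R}^2$ with $\mathbb{C}$. For $k\in\{1,2,3,4\}$ (indices mod 4) let $z_k=x_k+iy_k=\sqrt2\,(-i)^k\left(e^{-i\pi/4}+\tfrac a2 e^{i\pi/4}\right)$ and $S_k=\{(x,y):|x-x_k|\le1,\ |y-y_k|\le1\}$. In the interior of $S_1$ the flow is $\dot x=-\lambda(x-x_1)$, $\dot y=y-y_1$; in $S_2,S_3,S_4$ it is defined by requiring the vector field to be equivariant under the rotation $z\mapsto -iz$ (which maps $S_k$ to $S_{k+1}$). Local coordinates $(s,u)\in[-1,1]^2$: in $S_1$, $s=x-x_1$, $u=y-y_1$; in $S_{k+1}$ the local coordinates of $-iz$ equal the local coordinates of $z$ in $S_k$. Thus in each square $\dot s=-\lambda s$, $\dot u=u$; the $s$-direction is the stable eigendirection and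 the $u$-direction the unstable one. At the shared boundary of $S_k$ and $S_{k+1}$ trajectories pass from $S_k$ into $S_{k+1}$ (the vector field there is taken to be that of $S_{k+1}$): the exit point with local coordinates $(s,1)$ in $S_k$, $s\le 1-a$, is the point with local coordinates $(1,s+a)$ in $S_{k+1}$. Points where a trajectory leaves a large square into one of the small gap squares of side $a$ (in particular the one centered at the origin) are absorbing (flow set to zero). The configuration may be continued periodically (on a torus), but limit cycles considered are isolated periodic orbits that pass cyclically through $S_1,S_2,S_3,S_4$, entering each square through its edge $\{(1,u):0<u<1\}$ in local coordinates. ''Stable'' means the periodic orbit attracts all nearby trajectories. Phase. Let $\gamma$ be the stable limit cycle with period $T$, parametrized so that $\gamma(0)$ is the point at which it enters $S_1$. The point $\gamma(t)$ has phase $\theta=4t/T\in[0,4)$. For $\xi_0$ in the basin of attraction, the asymptotic phase $\phi(\xi_0)\in[0,4)$ is defined by $\|\xi(t)-\gamma(t+\phi(\xi_0)T/4)\|\to0$ as $t\to\infty$, where $\xi$ is the trajectory with $\xi(0)=\xi_0$ and $\|(x,y)\|=|x|+|y|$. The infinitesimal phase response at phase $\theta$ to a perturbation in direction $\eta$ ($\eta$ given in global $(x,y)$ coordinates, which in $S_1$ coincide in direction with $(s,u)$, so there $\eta=(\eta_s,\eta_u)$) is $$\lim_{\epsilon\to0}\frac{\phi(\gamma(\theta T/4)+\epsilon\eta)-\theta}{\epsilon},$$ the numerator being taken mod 4 with representative near $0$. At the four integer phases, where $\gamma$ lies on a boundary between squares, the phase response is understood as the limit of its values at phases tending to that integer from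 above. *)

(* Defs.v *)
From HB Require Import structures.
From mathcomp Require Import all_boot all_order all_algebra.
From mathcomp Require Import all_classical all_reals all_analysis.
Set Implicit Arguments.
Unset Strict Implicit.
Unset Printing Implicit Defensive.
Import Order.TTheory GRing.Theory Num.Theory.
Import numFieldNormedType.Exports.
Local Open Scope classical_set_scope.
Local Open Scope ring_scope.

(* MathComp-Analysis is used throughout.  The plane is [R * R], identified with
   the complex numbers by (x, y) |-> x + i y. *)

(* multiplication by - i *)
Definition rotcw (R : realType) (p : R * R) : R * R := (p.2, - p.1).

(* multiplication by i, i.e. the matrix with rows (0, -1) and (1, 0) *)
Definition rotccw (R : realType) (p : R * R) : R * R := (- p.2, p.1).

Definition norm1 (R : realType) (p : R * R) : R := `|p.1| + `|p.2|.

(* z_k = sqrt 2 * (- i)^k * (e^(- i pi / 4) + a / 2 * e^(i pi / 4)).  Square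
   indices are naturals, read modulo 4: both rotations have order 4. *)
Definition square_center (R : realType) (a : R) (k : nat) : R * R :=
  iter k (@rotcw R)
    (Num.sqrt 2 * (cos (- (pi / 4)) + a / 2 * cos (pi / 4)),
     Num.sqrt 2 * (sin (- (pi / 4)) + a / 2 * sin (pi / 4))).

Definition square (R : realType) (a : R) (k : nat) : set (R * R) :=
  [set p | `|p.1 - (square_center a k).1| <= 1 /\
           `|p.2 - (square_center a k).2| <= 1].

(* The local coordinates in S_k are i^(k - 1) (z - z_k); the exponent is written
   k + 3 so that it is meaningful, modulo 4, for every natural k. *)
Definition local_coord (R : realType) (a : R) (k : nat) (p : R * R) : R * R :=
  iter (k + 3) (@rotccw R) (p - square_center a k).

(* S_k without its two exit edges u = 1 and u = -1.  An edge shared by S_k and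
   S_(k+1) is part of the exit edge u = 1 of S_k and of the entry edge s = 1 of
   S_(k+1), hence belongs to the region of S_(k+1) only. *)
Definition region (R : realType) (a : R) (k : nat) (p : R * R) : bool :=
  (`|(local_coord a k p).1| <= 1) && (`|(local_coord a k p).2| < 1).

(* For 0 < a < 1 the four regions (square 0 being square 4) are disjoint.  The
   field vanishes outside them, in particular in the gap squares and where a
   square is left into a gap. *)
Definition iris_field (R : realType) (lambda a : R) (p : R * R) : R * R :=
  if [pick k : 'I_4 | region a k p] is Some k then
    iter (k + 3) (@rotcw R)
      (- lambda * (local_coord a k p).1, (local_coord a k p).2)
  else (0, 0).

(* The field is discontinuous across the edges, so a trajectory is a continuous
   curve on [0, +oo[ with right derivative given by the field at every time;
   inside a square this amounts to the usual differential equation.  Values at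
   negative times are irrelevant. *)
Definition is_trajectory (R : realType) (lambda a : R) (xi : R -> R * R) : Prop :=
  {within `[0, +oo[, continuous xi} /\
  forall t : R, 0 <= t ->
    ((xi (t + h)).1 - (xi t).1) / h @[h --> 0^'+]
      --> (iris_field lambda a (xi t)).1 /\
    ((xi (t + h)).2 - (xi t).2) / h @[h --> 0^'+]
      --> (iris_field lambda a (xi t)).2.

Definition is_period (R : realType) (gamma : R -> R * R) (T : R) : Prop :=
  0 < T /\ forall t : R, 0 <= t -> gamma (t + T) = gamma t.

Definition near_orbit (R : realType) (gamma : R -> R * R) (d : R) (p : R * R) :
    Prop :=
  exists2 t : R, 0 <= t & norm1 (p - gamma t) < d.

(* [tau n] is the time of entry into S_(n+1), and of exit from S_n if n > 0.  No
   assumption is made on how many turns a periodic orbit takes to close up. *)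
Definition is_itinerary (R : realType) (a : R) (gamma : R -> R * R)
    (tau : nat -> R) : Prop :=
  [/\ tau 0%N = 0,
      (forall n : nat, tau n < tau n.+1),
      tau n @[n --> \oo] --> +oo,
      (forall n : nat, exists2 v : R, 0 < v < 1 &
         local_coord a n.+1 (gamma (tau n)) = (1, v)) &
      (forall (n : nat) (t : R), tau n <= t <= tau n.+1 ->
         square a n.+1 (gamma t))].

Definition is_isolated (R : realType) (lambda a : R) (gamma : R -> R * R) :
    Prop :=
  exists2 d : R, 0 < d &
    forall (xi : R -> R * R) (T' : R),
      is_trajectory lambda a xi -> is_period xi T' ->
      (forall t : R, 0 <= t -> near_orbit gamma d (xi t)) ->
      forall t : R, 0 <= t -> exists2 t' : R, 0 <= t' & xi t = gamma t'.

(* [T] is the least period, and time 0 is an entry into S_1. *)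
Definition is_limit_cycle (R : realType) (lambda a : R) (gamma : R -> R * R)
    (T : R) : Prop :=
  [/\ is_trajectory lambda a gamma,
      is_period gamma T,
      (forall T' : R, is_period gamma T' -> T <= T'),
      (exists tau : nat -> R, is_itinerary a gamma tau) &
      is_isolated lambda a gamma].

Definition is_stable (R : realType) (lambda a : R) (gamma : R -> R * R) : Prop :=
  exists2 d : R, 0 < d &
    forall xi : R -> R * R, is_trajectory lambda a xi ->
      near_orbit gamma d (xi 0) ->
      forall e : R, 0 < e -> \forall t \near +oo, near_orbit gamma e (xi t).

Definition is_stable_limit_cycle (R : realType) (lambda a : R)
    (gamma : R -> R * R) (T : R) : Prop :=
  is_limit_cycle lambda a gamma T /\ is_stable lambda a gamma.

Definition is_asymptotic_phase (R : realType) (lambda a : R)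
    (gamma : R -> R * R) (T : R) (p : R * R) (phi : R) : Prop :=
  0 <= phi < 4 /\
  exists xi : R -> R * R,
    [/\ is_trajectory lambda a xi, xi 0 = p &
        norm1 (xi t - gamma (t + phi * T / 4)) @[t --> +oo] --> (0 : R)].

Definition asymptotic_phase (R : realType) (lambda a : R)
    (gamma : R -> R * R) (T : R) (p : R * R) : R :=
  xget 0 [set phi | is_asymptotic_phase lambda a gamma T p phi].

(* representative in [-2, 2[ of x modulo 4 *)
Definition wrap4 (R : realType) (x : R) : R :=
  x - 4 * (Num.floor ((x + 2) / 4))%:~R.

Definition perturbed (R : realType) (gamma : R -> R * R) (T theta : R)
    (eta : R * R) (e : R) : R * R :=
  gamma (theta * T / 4) + (e * eta.1, e * eta.2).

Definition response_limit (R : realType) (lambda a : R)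
    (gamma : R -> R * R) (T theta : R) (eta : R * R) (z : R) : Prop :=
  (\forall e \near (0 : R)^', exists phi : R,
     is_asymptotic_phase lambda a gamma T (perturbed gamma T theta eta e) phi) /\
  wrap4 (asymptotic_phase lambda a gamma T (perturbed gamma T theta eta e)
         - theta) / e @[e --> (0 : R)^'] --> z.

Definition is_phase_response (R : realType) (lambda a : R)
    (gamma : R -> R * R) (T theta : R) (eta : R * R) (z : R) : Prop :=
  if theta \is a Num.int then
    exists2 f : R -> R,
      \forall t \near theta^'+, response_limit lambda a gamma T t eta (f t) &
      f t @[t --> theta^'+] --> z
  else response_limit lambda a gamma T theta eta z.

Definition rho (R : realType) (lambda a u : R) : R := u `^ lambda - u + a.

Definition is_smallest_root (R : realType) (lambda a u : R) : Prop :=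
  [/\ 0 < u, rho lambda a u = 0 &
      forall v : R, 0 < v -> rho lambda a v = 0 -> u <= v].

(* the smallest positive root, when there is one *)
Definition entry_coord (R : realType) (lambda a : R) : R :=
  xget 0 [set u | is_smallest_root lambda a u].

(* Z as a function of the root u of rho, with s = u^lambda; the dependence on a
   is through u. *)
Definition Zresp (R : realType) (lambda u : R) (eta : R * R) (phi : R) : R :=
  let s := u `^ lambda in
  (eta.1 * s `^ (1 - phi) + eta.2 * u `^ phi) / (ln (1 / u) * (u - lambda * s)).

(* Main.v *)
(** In the local coordinates of the square it has entered at [(1, v)], an orbit is
    [(e^(- lambda t), v e^t)]; it leaves at time [- ln v] and enters the next
    square at [(1, v^lambda + a)].  Forward uniqueness, despite the discontinuous
    field, thus reduces the flow to the increasing return map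
    [v |-> v^lambda + a], whose fixed points are the roots of [rho].  By Rolle's
    theorem this map is a contraction near the smallest root [u] and pushes away
    from the other root, so the cycle through [u] is the only stable one.

    Relative to the cycle, an orbit entering at [(1, v)] gains the total time
    [Phi v = sum_n (ln v_n - ln u)], where [v_n] are its successive entry
    coordinates.  From [Phi v = ln v - ln u + Phi (v^lambda + a)] one reads off
    [Phi' u = 1 / (u - lambda s)].  A perturbed point [(x, y)] of a square has
    phase shift [(ln y - ln u + Phi (x y^lambda + a)) / ln (1 / u)], and
    differentiating it gives [Z]. *)

Require Import Defs.
From HB Require Import structures.
From mathcomp Require Import all_boot all_order all_algebra ring lra.
From mathcomp Require Import all_classical all_reals all_analysis.
Import Order.TTheory GRing.Theory Num.Theory.
Import numFieldNormedType.Exports.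
Local Open Scope classical_set_scope.
Local Open Scope ring_scope.

(** * Local coordinates *)

(** A right derivative is enough to determine a trajectory because a continuous function on [[0,
    +oo[] whose right derivative vanishes is constant; applied to a local coordinate times an
    integrating factor, this yields the explicit flow. The formula holds only while the trajectory
    stays in the region, and that it stays there is known only from the formula: continuous
    induction on time breaks the circle. The regions are cut for this purpose, each containing its
    entry edge, where the field points inwards, and omitting its exit edges.

    An itinerary only confines an orbit to closed squares. Resting on an exit edge, where the field
    may vanish, has to be excluded before the return map applies to an arbitrary limit cycle.

    [Phi] is a limit of sums, but its derivative is needed at the fixed point only, so no termwise
    differentiation takes place. Attraction has to be shown near the whole orbit: a point close to
    an edge may lie in the neighbouring square and is then read in the coordinates of that square.
    The phase response is computed at interior phases, where this cannot happen; integer phases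
    follow by continuity of the formula. *)

Lemma iter4 (T : Type) (f : T -> T) k n x :
  (forall y, iter 4 f y = y) -> iter (k + n * 4) f x = iter k f x.
Proof.
move=> f4; elim: n => [|n IHn]; first by rewrite mul0n addn0.
by rewrite mulSn addnCA addnC iterD f4.
Qed.

Lemma rotcw4 {R : realType} (p : R * R) : iter 4 (@rotcw R) p = p.
Proof. by case: p => x y; rewrite /= /rotcw /= !opprK. Qed.

Lemma rotccw4 {R : realType} (p : R * R) : iter 4 (@rotccw R) p = p.
Proof. by case: p => x y; rewrite /= /rotccw /= !opprK. Qed.

Lemma rotcwK {R : realType} : cancel (@rotcw R) (@rotccw R).
Proof. by case=> x y; rewrite /rotcw /rotccw /= opprK. Qed.

Lemma rotccwK {R : realType} : cancel (@rotccw R) (@rotcw R).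
Proof. by case=> x y; rewrite /rotcw /rotccw /= opprK. Qed.

Lemma iter_rotcwK {R : realType} k :
  cancel (iter k (@rotcw R)) (iter k (@rotccw R)).
Proof.
elim: k => [|k IHk] p //.
by rewrite iterSr iterS rotcwK IHk.
Qed.

Lemma iter_rotccwK {R : realType} k :
  cancel (iter k (@rotccw R)) (iter k (@rotcw R)).
Proof.
elim: k => [|k IHk] p //.
by rewrite iterSr iterS rotccwK IHk.
Qed.

Lemma iter_rotccwD {R : realType} k (p q : R * R) :
  iter k (@rotccw R) (p + q) = iter k (@rotccw R) p + iter k (@rotccw R) q.
Proof.
elim: k => [|k IHk] //; rewrite !iterS IHk /rotccw /=.
by congr pair; rewrite /= ?opprD.
Qed.

Lemma norm1_rotccw {R : realType} k (p : R * R) :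
  norm1 (iter k (@rotccw R) p) = norm1 p.
Proof. by elim: k => // k <-; rewrite iterS /norm1 /= normrN addrC. Qed.

Lemma cos_piquarter {R : realType} : Num.sqrt 2 * cos (pi / 4) = 1 :> R.
Proof.
have pi0 := pi_gt0 R.
have c0 : 0 < cos (pi / 4 : R) by apply: cos_gt0_pihalf; lra.
have : cos (pi / 4 + pi / 4 : R) = 0.
  by rewrite (_ : pi / 4 + pi / 4 = pi / 2) ?cos_pihalf //; field.
rewrite cosD => c2; have cs := cos2Dsin2 (pi / 4 : R).
have : (Num.sqrt 2 * cos (pi / 4 : R)) ^+ 2 = 1.
  by rewrite exprMn sqr_sqrtr //; move: c2 cs; rewrite -!expr2; lra.
move=> /eqP; rewrite sqrf_eq1 => /orP[/eqP//|/eqP h].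
by have := mulr_ge0 (sqrtr_ge0 2) (ltW c0); lra.
Qed.

Lemma sin_piquarter {R : realType} : Num.sqrt 2 * sin (pi / 4) = 1 :> R.
Proof.
have e : (pi / 4 : R) = pi / 2 - pi / 4 by field.
by rewrite e sinB sin_pihalf cos_pihalf mul1r mul0r subr0 cos_piquarter.
Qed.

Lemma square_center0 {R : realType} (a : R) :
  square_center a 0 = (1 + a / 2, -1 + a / 2).
Proof.
have c := @cos_piquarter R; have s := @sin_piquarter R.
rewrite /square_center /= sinN cosN; congr pair.
  transitivity ((1 + a / 2) * (Num.sqrt 2 * cos (pi / 4))); first by ring.
  by rewrite c mulr1.
transitivity ((-1 + a / 2) * (Num.sqrt 2 * sin (pi / 4))); first by ring.
by rewrite s mulr1.
Qed.

Lemma local_coord0 {R : realType} (a : R) p :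
  local_coord a 0 p = (p.2 - (-1 + a / 2), - (p.1 - (1 + a / 2))).
Proof.
by rewrite /local_coord square_center0 /= /rotccw /=; congr pair; ring.
Qed.

(** All the geometry of the configuration is in this affine quarter turn: it identifies the exit
    edge [u = 1] with the entry edge [s = 1] of the next square and shifts the coordinate along the
    edge by [a]. Consecutive centres differ by [(a, -2)] in the rotated frame. *)
Lemma local_coordS {R : realType} (a : R) k p :
  local_coord a k.+1 p =
  (2 - (local_coord a k p).2, (local_coord a k p).1 + a).
Proof.
have step : square_center a k - square_center a k.+1
            = iter (k + 3) (@rotcw R) (a, -2).
  elim: k => [|k IHk].
    rewrite /square_center -/(square_center a 0) iterS.
    rewrite -/(square_center a 0) square_center0 /rotcw /=.
    by congr pair; rewrite /=; field.
  rewrite addSn iterS -IHk /square_center !iterS /rotcw.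
  by congr pair; rewrite /= ?opprB ?opprK; ring.
rewrite /local_coord addSn.
rewrite (_ : p - square_center a k.+1 =
  (p - square_center a k) + iter (k + 3) (@rotcw R) (a, -2)); last first.
  by rewrite -step addrA subrK.
rewrite iterS iter_rotccwD iter_rotcwK /rotccw /=.
by rewrite opprB.
Qed.

Lemma local_coord4 {R : realType} (a : R) k p :
  local_coord a k.+4 p = local_coord a k p.
Proof.
rewrite !local_coordS /=; case: (local_coord a k p) => x y /=.
by congr pair; ring.
Qed.

Lemma local_coordM4 {R : realType} (a : R) k n p :
  local_coord a (k + n * 4) p = local_coord a k p.
Proof.
elim: n => [|n IHn]; first by rewrite mul0n addn0.
by rewrite mulSn addnCA add4n local_coord4.
Qed.

Lemma local_coord_mod4 {R : realType} (a : R) k p :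
  local_coord a (k %% 4) p = local_coord a k p.
Proof. by rewrite {2}(divn_eq k 4) addnC local_coordM4. Qed.

Definition of_local {R : realType} (a : R) k (q : R * R) : R * R :=
  iter (k + 3) (@rotcw R) q + square_center a k.

Lemma of_localK {R : realType} (a : R) k :
  cancel (of_local a k) (local_coord a k).
Proof. by move=> q; rewrite /local_coord /of_local addrK iter_rotcwK. Qed.

Lemma local_coordK {R : realType} (a : R) k :
  cancel (local_coord a k) (of_local a k).
Proof. by move=> q; rewrite /local_coord /of_local iter_rotccwK subrK. Qed.

Lemma local_coordD {R : realType} (a : R) k p q :
  local_coord a k (p + q) = local_coord a k p + iter (k + 3) (@rotccw R) q.
Proof. by rewrite /local_coord (addrAC p q) (iter_rotccwD _ (p - _)). Qed.

Lemma local_coordB {R : realType} (a : R) k p q :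
  local_coord a k p - local_coord a k q = iter (k + 3) (@rotccw R) (p - q).
Proof. by rewrite -{1}(subrKC q p) local_coordD addrC addKr. Qed.

Lemma norm1_local {R : realType} (a : R) k p q :
  norm1 (local_coord a k p - local_coord a k q) = norm1 (p - q).
Proof. by rewrite local_coordB norm1_rotccw. Qed.

Lemma squareE {R : realType} (a : R) k p :
  square a k p <->
  `|(local_coord a k p).1| <= 1 /\ `|(local_coord a k p).2| <= 1.
Proof.
rewrite /square /local_coord /=.
rewrite -[p.1 - _]/((p - square_center a k).1).
rewrite -[p.2 - _]/((p - square_center a k).2).
elim: (k + 3)%N (p - _) => [|m IHm] q //.
rewrite iterSr -IHm /rotccw /= normrN.
by split=> -[].
Qed.

Lemma region_mod4 {R : realType} (a : R) k p :
  region a (k %% 4) p = region a k p.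
Proof. by rewrite /region local_coord_mod4. Qed.

(** If [p] has coordinates [(s, u)] in one square, the following three see it at [(2 - u, s + a)],
    [(2 - s - a, 2 - u + a)] and [(u - a, 2 - s)]. Each pair violates a bound; on shared edges the
    strict bound on the unstable coordinate decides. *)
Lemma region_succ {R : realType} (a : R) k p : 0 < a -> region a k p ->
  [/\ ~~ region a k.+1 p, ~~ region a k.+2 p & ~~ region a k.+3 p].
Proof.
move=> a0; rewrite /region !local_coordS /=.
case: (local_coord a k p) => s u /= /andP[].
rewrite !ler_norml !ltr_norml => /andP[s1 s2] /andP[u1 u2].
by split; apply/negP; lra.
Qed.

Lemma region_inj {R : realType} (a : R) i j p : 0 < a ->
  region a i p -> region a j p -> i = j %[mod 4].
Proof.
move=> a0; wlog ij : i j / (i %% 4 <= j %% 4)%N => [hw ri rj|].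
  by case/orP: (leq_total (i %% 4) (j %% 4)) => ij; [|symmetry]; apply: hw.
rewrite -[region a i p]region_mod4 -[region a j p]region_mod4.
move: ij (ltn_pmod i (isT : 0 < 4)%N) (ltn_pmod j (isT : 0 < 4)%N).
move: (i %% 4)%N (j %% 4)%N => {}i {}j ij i4 j4 ri rj.
have [h1 h2 h3] := region_succ a i p a0 ri.
have [d jd] : {d | j = (d + i)%N} by exists (j - i)%N; rewrite subnK.
subst j; move: d ij j4 rj => [|[|[|[|d]]]] // _ + rj.
- by rewrite add1n in rj; rewrite rj in h1.
- by rewrite add2n in rj; rewrite rj in h2.
- by rewrite add3n in rj; rewrite rj in h3.
Qed.

(** Disjointness makes the choice of [pick] immaterial, so any natural number in the right class
    modulo 4 may serve as index. *)
Lemma iris_field_region {R : realType} (lambda a : R) k p : 0 < a ->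
  region a k p -> iris_field lambda a p =
  iter (k + 3) (@rotcw R)
    (- lambda * (local_coord a k p).1, (local_coord a k p).2).
Proof.
move=> a0 rk; rewrite /iris_field; case: pickP => [j rj|/(_ (inord (k %% 4)))].
  have /eqP := region_inj a _ _ p a0 rk rj.
  rewrite (modn_small (ltn_ord j)) => /eqP kj.
  rewrite -kj local_coord_mod4.
  have -> : (k + 3 = k %% 4 + 3 + k %/ 4 * 4)%N.
    by rewrite addnAC [(k %% 4 + _)%N]addnC -divn_eq.
  by rewrite iter4 //; exact: rotcw4.
by rewrite /= inordK ?ltn_pmod // region_mod4 rk.
Qed.

Lemma iris_field_out {R : realType} (lambda a : R) p :
  (forall k, ~~ region a k p) -> iris_field lambda a p = (0, 0).
Proof.
move=> nr; rewrite /iris_field; case: pickP => // j.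
by rewrite (negbTE (nr j)).
Qed.

(** * Right derivatives *)

(** Continuity relative to [[0, +oo[], hence one-sided at 0, in a form that linear arithmetic can
    use directly. *)
Definition continuous_ge0 {R : realType} (f : R -> R) : Prop :=
  forall t, 0 <= t -> forall e, 0 < e -> exists2 d, 0 < d &
    forall t', 0 <= t' -> `|t' - t| < d -> `|f t' - f t| < e.

Definition has_rderiv {R : realType} (f : R -> R) (t l : R) : Prop :=
  (f (t + h) - f t) / h @[h --> 0^'+] --> l.

(** Let [c] be the supremum of the points up to which [P] holds. The closing hypothesis gives [P] at
    [c], and the opening one would carry [P] beyond [c] if [c < b]. *)
Lemma real_induction {R : realType} (a b : R) (P : R -> Prop) :
  P a ->
  (forall x, a <= x < b -> (forall y, a <= y <= x -> P y) ->
     exists2 d, 0 < d & forall y, x < y < x + d -> y <= b -> P y) ->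
  (forall x, a < x <= b -> (forall y, a <= y < x -> P y) -> P x) ->
  forall x, a <= x <= b -> P x.
Proof.
move=> Pa Pr Pl x /andP[ax xb].
pose A := [set z | a <= z <= b /\ forall y, a <= y <= z -> P y].
have Aa : A a.
  split; first by rewrite lexx (le_trans ax xb).
  by move=> y ya; rewrite (_ : y = a) //; apply/eqP; rewrite eq_le andbC.
have hA : has_sup A by split; [exists a|exists b => z [/andP[]]].
set c := sup A.
have ac : a <= c by apply: ub_le_sup => //; case: hA.
have cb : c <= b by apply: ge_sup; [exists a|move=> z [/andP[]]].
have below y : a <= y < c -> P y.
  move=> /andP[ay yc].
  have [z [_ Az] yz] := sup_adherent (eps := c - y) ltac:(by rewrite subr_gt0) hA.
  by apply: Az; rewrite ay ltW //; move: yz; rewrite -/c; lra.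
have Pc : P c.
  have [ca|] := eqVneq c a; first by rewrite ca.
  move=> ca; apply: Pl => //.
  by rewrite cb lt_neqAle eq_sym ca ac.
have leqP y : a <= y <= c -> P y.
  move=> /andP[ay]; rewrite le_eqVlt => /orP[/eqP->//|yc].
  by apply: below; rewrite ay.
have [xc|cx] := leP x c; first by apply: leqP; rewrite ax xc.
have [|d d0 Pd] := Pr c _ leqP; first by rewrite ac (lt_le_trans cx xb).
pose z := Order.min b (c + d / 2).
have cz : c < z by rewrite lt_min (lt_le_trans cx xb) /=; lra.
suff Az : A z by have := ub_le_sup (proj2 hA) Az; rewrite -/c leNgt cz.
split=> [|y /andP[ay yz]]; first by rewrite (le_trans ac (ltW cz)) ge_min lexx.
have [yc|cy] := leP y c; first by apply: leqP; rewrite ay.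
move: yz; rewrite le_min => /andP[yb yd].
by apply: Pd => //; rewrite cy /=; lra.
Qed.

Lemma cvg_right0P {R : realType} (f : R -> R) (l : R) :
  f h @[h --> 0^'+] --> l <->
  forall e, 0 < e -> exists2 d, 0 < d &
    forall h, 0 < h < d -> `|f h - l| <= e.
Proof.
split=> [/cvgrPdist_le H e e0|H].
  have /nbhs_right0P := H e e0.
  rewrite near_withinE => /nbhs_ballP[d /= d0 Hd].
  exists d => // h /andP[h0 hd]; rewrite distrC.
  have := Hd h; rewrite /ball /= sub0r normrN gtr0_norm // add0r; exact.
apply/cvgrPdist_le => e e0; have [d d0 Hd] := H e e0.
near=> h; rewrite distrC; apply: Hd; apply/andP; split; near: h.
  exact: nbhs_right_gt.
exact: nbhs_right_lt.
Unshelve. all: by end_near. Qed.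

Lemma slope_dist {R : realType} (x l h e : R) : 0 < h ->
  (`|x / h - l| <= e) = (`|x - l * h| <= e * h).
Proof.
move=> h0; rewrite -(ler_pM2r h0) -[X in _ * X <= _](gtr0_norm h0) -normrM.
by rewrite mulrBl divfK // gt_eqF.
Qed.

Lemma has_rderivP {R : realType} (f : R -> R) (t l : R) :
  has_rderiv f t l <-> forall e, 0 < e -> exists2 d, 0 < d &
    forall h, 0 < h < d -> `|f (t + h) - f t - l * h| <= e * h.
Proof.
split=> [/cvg_right0P H e e0|H].
  have [d d0 Hd] := H e e0; exists d => // h hd; have /andP[h0 _] := hd.
  by rewrite -slope_dist //; exact: Hd.
apply/cvg_right0P => e e0; have [d d0 Hd] := H e e0.
exists d => // h hd; have /andP[h0 _] := hd.
by rewrite slope_dist //; exact: Hd.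
Qed.

Lemma has_rderivN {R : realType} (f : R -> R) t l :
  has_rderiv f t l -> has_rderiv (fun x => - f x) t (- l).
Proof.
move=> /has_rderivP H; apply/has_rderivP => e /H[d d0 Hd].
exists d => // h /Hd; rewrite -normrN; congr (`|_| <= _); ring.
Qed.

Lemma has_rderivDr {R : realType} (f : R -> R) t l c :
  has_rderiv f t l -> has_rderiv (fun x => f x + c) t l.
Proof.
move=> /has_rderivP H; apply/has_rderivP => e /H[d d0 Hd].
exists d => // h /Hd; congr (`|_| <= _); ring.
Qed.

Lemma has_rderivBl {R : realType} (f : R -> R) t l c :
  has_rderiv f t l -> has_rderiv (fun x => c - f x) t (- l).
Proof.
move=> /has_rderivP H; apply/has_rderivP => e /H[d d0 Hd].
exists d => // h /Hd; rewrite -normrN; congr (`|_| <= _); ring.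
Qed.

Lemma cvg_dnbhs0P {R : realType} (f : R -> R) (l : R) :
  f h @[h --> 0^'] --> l <->
  forall e, 0 < e -> exists2 d, 0 < d &
    forall h, h != 0 -> `|h| < d -> `|f h - l| <= e.
Proof.
split=> [/cvgrPdist_le H e e0|H].
  have := H e e0; rewrite near_withinE => /nbhs_ballP[d /= d0 Hd].
  exists d => // h h0 hd; rewrite distrC; apply: Hd => //.
  by rewrite /ball /= sub0r normrN.
apply/cvgrPdist_le => e e0; have [d d0 Hd] := H e e0.
near=> h; rewrite distrC; apply: Hd; near: h.
  exact: nbhs_dnbhs_neq.
exact: dnbhs0_lt.
Unshelve. all: by end_near. Qed.

Lemma is_derive_cvg {R : realType} (f : R -> R) (t l : R) :
  is_derive t 1 f l -> (f (t + h) - f t) / h @[h --> 0^'] --> l.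
Proof.
case=> df <-; rewrite (_ : (fun h => _) =
  (fun h => h^-1 *: ((f \o shift t) (h *: 1) - f t))); first exact: df.
by apply/funext => h /=; rewrite mulrC scaler1 [h + t]addrC.
Qed.

Lemma is_derive_rderiv {R : realType} (f : R -> R) (t l : R) :
  is_derive t 1 f l -> has_rderiv f t l.
Proof.
move=> /is_derive_cvg /cvg_dnbhs0P H; apply/cvg_right0P => e e0.
have [d d0 Hd] := H e e0; exists d => // h /andP[h0 hd].
by apply: Hd; rewrite ?gt_eqF // gtr0_norm.
Qed.

Lemma continuous_ge0N {R : realType} (f : R -> R) :
  continuous_ge0 f -> continuous_ge0 (fun x => - f x).
Proof.
move=> cf t t0 e e0; have [d d0 Hd] := cf t t0 e e0.
by exists d => // t' t'0 tt; rewrite -opprD normrN; exact: Hd.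
Qed.

(** By continuous induction [f] stays above a line of small negative slope through its initial
    value. The threshold [c] serves applications where the sign of the derivative is known only for
    large enough values of [f]. *)
Lemma rderiv_ge0 {R : realType} (f : R -> R) (c t0 t1 : R) :
  continuous_ge0 f -> 0 <= t0 <= t1 -> c < f t0 ->
  (forall t, t0 <= t < t1 -> c < f t -> exists2 l, 0 <= l & has_rderiv f t l) ->
  f t0 <= f t1.
Proof.
move=> cf /andP[t00 t01] cft0 H; rewrite leNgt; apply/negP => f10.
(* The slope is so small that the line stays above both [f t1] and [c] up to [t1]; the added 1 keeps
   the denominator positive without comparing [t0] and [t1]. *)
pose e := Order.min (f t0 - f t1) (f t0 - c) / 2 / (t1 - t0 + 1).
have m0 : 0 < Order.min (f t0 - f t1) (f t0 - c) by rewrite lt_min; lra.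
have m1 : Order.min (f t0 - f t1) (f t0 - c) <= f t0 - f t1
  by rewrite ge_min lexx.
have m2 : Order.min (f t0 - f t1) (f t0 - c) <= f t0 - c
  by rewrite ge_min lexx orbT.
have e0 : 0 < e by rewrite !divr_gt0 //; lra.
have et : e * (t1 - t0) < Order.min (f t0 - f t1) (f t0 - c).
  have : e * (t1 - t0 + 1) = Order.min (f t0 - f t1) (f t0 - c) / 2.
    by rewrite divfK //; lra.
  lra.
suff P t : t0 <= t <= t1 -> f t0 - e * (t - t0) <= f t.
  by have := P t1; rewrite t01 lexx => /(_ isT); lra.
apply: (real_induction t0 t1 (fun t => f t0 - e * (t - t0) <= f t)) => {t}.
- lra.
- move=> x /andP[x0 x1] Px.
  have fx : f t0 - e * (x - t0) <= f x by apply: Px; rewrite x0 lexx.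
  have : e * (x - t0) <= e * (t1 - t0) by rewrite ler_pM2l //; lra.
  move=> ex; have cx : c < f x by lra.
  have [|l l0 /has_rderivP /(_ e e0)[d d0 Hd]] := H x _ cx; first by rewrite x0.
  exists d => // y /andP[xy yd] _.
  have := Hd (y - x); rewrite [x + _]addrC subrK => /(_ ltac:(lra)).
  have : 0 <= l * (y - x) by rewrite mulr_ge0 //; lra.
  by rewrite ler_norml => ? /andP[? ?]; lra.
- move=> x /andP[x0 x1] Px; rewrite leNgt; apply/negP => fx.
  pose g := f t0 - e * (x - t0) - f x.
  have g0 : 0 < g by rewrite /g; lra.
  have [|d d0 Hd] := cf x _ (g / 2) ltac:(lra); first by lra.
  pose h := Order.min (x - t0) (d / 2).
  have h0 : 0 < h by rewrite lt_min; lra.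
  have h1 : h <= x - t0 by rewrite ge_min lexx.
  have h2 : h <= d / 2 by rewrite ge_min lexx orbT.
  have := Px (x - h) ltac:(lra).
  have : `|f (x - h) - f x| < g / 2.
    apply: Hd; first lra.
    by rewrite addrAC subrr sub0r normrN gtr0_norm //; lra.
  rewrite ltr_norml /g => /andP[? ?] ?.
  have : 0 < e * h by rewrite mulr_gt0.
  lra.
Qed.

Lemma rderiv0_const {R : realType} (f : R -> R) (t0 t1 : R) :
  continuous_ge0 f -> 0 <= t0 <= t1 ->
  (forall t, t0 <= t < t1 -> has_rderiv f t 0) -> f t1 = f t0.
Proof.
move=> cf t01 H; apply/eqP; rewrite eq_le; apply/andP; split.
  rewrite -lerN2.
  apply: (rderiv_ge0 (fun x => - f x) (- f t0 - 1)) => //.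
  - exact: continuous_ge0N.
  - lra.
  - by move=> t tt _; exists 0 => //; rewrite -oppr0; apply: has_rderivN; apply: H.
apply: (rderiv_ge0 f (f t0 - 1)) => //; first lra.
by move=> t tt _; exists 0 => //; apply: H.
Qed.

(** * Trajectories in local coordinates *)

Lemma continuous_ge0P {R : realType} (f : R -> R) :
  continuous_ge0 f <->
  forall t : R, 0 <= t -> f x @[x --> within (fun x => 0 <= x) (nbhs t)] --> f t.
Proof.
split=> H t t0.
  apply/cvgrPdist_lt => e e0; have [d d0 Hd] := H t t0 e e0.
  rewrite near_withinE; apply/nbhs_ballP; exists d => //= x xd x0.
  by rewrite distrC; apply: Hd => //; rewrite distrC; exact: xd.
move=> e e0; have /cvgrPdist_lt /(_ e e0) := H t t0.
rewrite near_withinE => /nbhs_ballP[d /= d0 Hd]; exists d => // x x0 xd.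
by rewrite distrC; apply: Hd => //=; rewrite /ball /= distrC.
Qed.

Lemma continuous_ge0M {R : realType} (f g : R -> R) :
  continuous f -> continuous_ge0 g -> continuous_ge0 (fun x => f x * g x).
Proof.
move=> cf /continuous_ge0P cg; apply/continuous_ge0P => t t0.
apply: cvgM; last exact: cg.
by apply: cvg_trans (cf t); apply: cvg_app; exact: cvg_within.
Qed.

Lemma continuous_ge0Bl {R : realType} (f : R -> R) c :
  continuous_ge0 f -> continuous_ge0 (fun x => c - f x).
Proof.
move=> cf t t0 e e0; have [d d0 Hd] := cf t t0 e e0.
exists d => // x x0 xt; rewrite (_ : c - f x - (c - f t) = - (f x - f t)); last by ring.
by rewrite normrN; exact: Hd.
Qed.

Lemma continuous_ge0Dr {R : realType} (f : R -> R) c :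
  continuous_ge0 f -> continuous_ge0 (fun x => f x + c).
Proof.
move=> cf t t0 e e0; have [d d0 Hd] := cf t t0 e e0.
by exists d => // x x0 xt; rewrite opprD addrACA subrr addr0; exact: Hd.
Qed.

Definition has_rderiv2 {R : realType} (f : R -> R * R) (t : R) (d : R * R) :=
  has_rderiv (fun x => (f x).1) t d.1 /\ has_rderiv (fun x => (f x).2) t d.2.

Lemma eq_has_rderiv {R : realType} (f g : R -> R) t l :
  (forall x, f x = g x) -> has_rderiv f t l -> has_rderiv g t l.
Proof. by move=> /funext->. Qed.

Lemma eq_continuous_ge0 {R : realType} (f g : R -> R) :
  (forall x, f x = g x) -> continuous_ge0 f -> continuous_ge0 g.
Proof. by move=> /funext->. Qed.

Lemma local_rderiv {R : realType} (a : R) k (xi : R -> R * R) t d :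
  has_rderiv2 xi t d <->
  has_rderiv2 (fun x => local_coord a k (xi x)) t (iter (k + 3) (@rotccw R) d).
Proof.
elim: k => [|k IHk].
  have -> : iter (0 + 3) (@rotccw R) d = (d.2, - d.1).
    by rewrite /= /rotccw /= opprK.
  split=> -[h1 h2]; split.
  - apply: eq_has_rderiv (has_rderivDr _ _ _ (- (-1 + a / 2)) h2) => x.
    by rewrite local_coord0.
  - apply: eq_has_rderiv (has_rderivBl _ _ _ (1 + a / 2) h1) => x.
    by rewrite local_coord0 /= opprB.
  - have := has_rderivBl _ _ _ (1 + a / 2) h2; rewrite opprK.
    by apply: eq_has_rderiv => x; rewrite local_coord0 /=; ring.
  - apply: eq_has_rderiv (has_rderivDr _ _ _ (-1 + a / 2) h1) => x.
    by rewrite local_coord0 /=; ring.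
rewrite IHk addSn iterS; case: (iter (k + 3) _ d) => ds du.
have -> : rotccw (ds, du) = (- du, ds) by [].
split=> -[h1 h2]; split.
- apply: eq_has_rderiv (has_rderivBl _ _ _ 2 h2) => x.
  by rewrite local_coordS.
- apply: eq_has_rderiv (has_rderivDr _ _ _ a h1) => x.
  by rewrite local_coordS.
- apply: eq_has_rderiv (has_rderivDr _ _ _ (- a) h2) => x.
  by rewrite local_coordS /=; ring.
- have := has_rderivBl _ _ _ 2 h1; rewrite opprK.
  by apply: eq_has_rderiv => x; rewrite local_coordS /=; ring.
Qed.

Definition continuous_ge02 {R : realType} (f : R -> R * R) :=
  continuous_ge0 (fun x => (f x).1) /\ continuous_ge0 (fun x => (f x).2).

Lemma within_continuous_ge02 {R : realType} (xi : R -> R * R) :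
  {within `[0, +oo[, continuous xi} <-> continuous_ge02 xi.
Proof.
have e : [set` `[0, +oo[%R] = (fun x : R => 0 <= x) :> set R.
  by apply/funext => x /=; rewrite in_itv /= andbT.
split=> [/subspace_continuousP cxi|[/continuous_ge0P c1 /continuous_ge0P c2]].
  have {}cxi (t : R) : 0 <= t ->
      xi x @[x --> within (fun x => 0 <= x) (nbhs t)] --> xi t.
    by move=> t0; rewrite -e; apply: cxi; rewrite e.
  split; apply/continuous_ge0P => t t0.
    exact: (cvg_comp _ _ (cxi t t0) cvg_fst).
  exact: (cvg_comp _ _ (cxi t t0) cvg_snd).
apply/subspace_continuousP => t; rewrite e => t0.
have -> : xi = (fun x => ((xi x).1, (xi x).2)).
  by apply/funext => x; case: (xi x).
exact: (cvg_pair (c1 t t0) (c2 t t0)).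
Qed.

Lemma local_continuousP {R : realType} (a : R) k (xi : R -> R * R) :
  continuous_ge02 xi <-> continuous_ge02 (fun x => local_coord a k (xi x)).
Proof.
elim: k => [|k IHk].
  split=> -[h1 h2]; split.
  - apply: eq_continuous_ge0 (continuous_ge0Dr _ (- (-1 + a / 2)) h2) => x.
    by rewrite local_coord0.
  - apply: eq_continuous_ge0 (continuous_ge0Bl _ (1 + a / 2) h1) => x.
    by rewrite local_coord0 /= opprB.
  - apply: eq_continuous_ge0 (continuous_ge0Bl _ (1 + a / 2) h2) => x.
    by rewrite local_coord0 /=; ring.
  - apply: eq_continuous_ge0 (continuous_ge0Dr _ (-1 + a / 2) h1) => x.
    by rewrite local_coord0 /=; ring.
rewrite IHk; split=> -[h1 h2]; split.
- apply: eq_continuous_ge0 (continuous_ge0Bl _ 2 h2) => x.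
  by rewrite local_coordS.
- apply: eq_continuous_ge0 (continuous_ge0Dr _ a h1) => x.
  by rewrite local_coordS.
- apply: eq_continuous_ge0 (continuous_ge0Dr _ (- a) h2) => x.
  by rewrite local_coordS /=; ring.
- apply: eq_continuous_ge0 (continuous_ge0Bl _ 2 h1) => x.
  by rewrite local_coordS /=; ring.
Qed.

Lemma local_continuous {R : realType} (lambda a : R) k (xi : R -> R * R) :
  is_trajectory lambda a xi ->
  continuous_ge02 (fun x => local_coord a k (xi x)).
Proof. by case=> /within_continuous_ge02 /(local_continuousP a k). Qed.

Lemma local_field {R : realType} (lambda a : R) k p : 0 < a -> region a k p ->
  iter (k + 3) (@rotccw R) (iris_field lambda a p) =
  (- lambda * (local_coord a k p).1, (local_coord a k p).2).
Proof. by move=> a0 rp; rewrite (iris_field_region _ _ k) // iter_rotcwK. Qed.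

Lemma trajectory_rderiv {R : realType} (lambda a : R) k (xi : R -> R * R) t :
  0 < a -> is_trajectory lambda a xi -> 0 <= t -> region a k (xi t) ->
  has_rderiv (fun x => (local_coord a k (xi x)).1) t
    (- lambda * (local_coord a k (xi t)).1) /\
  has_rderiv (fun x => (local_coord a k (xi x)).2) t (local_coord a k (xi t)).2.
Proof.
move=> a0 [_ /(_ t) dxi] t0 rk.
have /(local_rderiv a k) : has_rderiv2 xi t (iris_field lambda a (xi t)).
  exact: dxi.
by rewrite local_field.
Qed.

Lemma is_derive_expR_lin {R : realType} (c t0 t : R) :
  is_derive t 1 (fun x => expR (c * (x - t0))) (c * expR (c * (t - t0))).
Proof.
have -> : (fun x => expR (c * (x - t0))) = expR \o (c \*: (fun x => x - t0)).
  by apply/funext.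
apply: is_derive_eq.
by rewrite /= /GRing.scale /= subr0 mulr1 mulrC.
Qed.

Lemma continuous_expR_lin {R : realType} (c t0 : R) :
  continuous (fun x => expR (c * (x - t0))).
Proof.
move=> x; apply: differentiable_continuous; apply/derivable1_diffP.
by have [] := is_derive_expR_lin c t0 x.
Qed.

(** The integrating factor: for a solution of [f' = - c f] the right derivative of the product
    vanishes. *)
Lemma has_rderiv_expRM {R : realType} (f : R -> R) c t0 t l :
  has_rderiv f t l ->
  has_rderiv (fun x => expR (c * (x - t0)) * f x) t
    (expR (c * (t - t0)) * (l + c * f t)).
Proof.
move=> df; set E := fun x => expR (c * (x - t0)).
have dE : has_rderiv E t (c * E t).
  exact/is_derive_rderiv/is_derive_expR_lin.
rewrite /has_rderiv (_ : (fun h => _) = (fun h => E (t + h) * ((f (t + h) - f t) / h)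
   + ((E (t + h) - E t) / h) * f t)); last first.
  by apply/funext => h; rewrite -/(E (t + h)) -/(E t); move: (E _) (E _) => x y; ring.
rewrite mulrDr [_ * (c * _)]mulrA [_ * c]mulrC.
apply: cvgD; last exact: cvgMl.
apply: cvgM => //; apply: cvg_at_right_filter.
apply: (@continuous_cvg _ _ _ (nbhs (0 : R)) _ (fun h => t + h) E t).
  exact: continuous_expR_lin.
have h : (fun h : R => t + h) @ (0 : R) --> t + 0.
  by apply: cvgD; [exact: cvg_cst | exact: cvg_id].
by rewrite addr0 in h.
Qed.

(** The strict bound on [u] persists by continuity. The bound on [s] is not strict on the entry edge
    and persists because [s] contracts: over a time [h] at most [1 / lambda], [|s|] becomes at most
    [1 - lambda h] plus an error [lambda h / 2]. *)
Lemma region_right_open {R : realType} (lambda a : R) k (xi : R -> R * R) t :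
  0 < lambda -> 0 < a -> is_trajectory lambda a xi -> 0 <= t ->
  region a k (xi t) ->
  exists2 d, 0 < d & forall y, t <= y < t + d -> region a k (xi y).
Proof.
move=> l0 a0 txi t0 rk.
have [/has_rderivP ds _] := trajectory_rderiv _ _ _ _ _ a0 txi t0 rk.
have [_ cu] := local_continuous _ _ k _ txi.
move: (rk) => /andP[s1 u1].
have [d1 d10 Hd1] := ds (lambda / 2) ltac:(lra).
have [d2 d20 Hd2] :=
  cu t t0 (1 - `|(local_coord a k (xi t)).2|) ltac:(by rewrite subr_gt0).
pose d := Order.min d1 (Order.min d2 (lambda^-1)).
have dd1 : d <= d1 by rewrite ge_min lexx.
have dd2 : d <= d2 by rewrite !ge_min lexx ?orbT.
have dl : d <= lambda^-1 by rewrite !ge_min lexx ?orbT.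
exists d; first by rewrite !lt_min d10 d20 invr_gt0.
move=> y; rewrite le_eqVlt => /andP[/orP[/eqP<-//|ty] yd].
apply/andP; split; last first.
  have : `|(local_coord a k (xi y)).2 - (local_coord a k (xi t)).2| <
     1 - `|(local_coord a k (xi t)).2|.
    by apply: Hd2; [lra | rewrite gtr0_norm; lra].
  have := ler_normD ((local_coord a k (xi y)).2 - (local_coord a k (xi t)).2)
    ((local_coord a k (xi t)).2).
  by rewrite subrK; lra.
pose h := y - t; have h0 : 0 < h by rewrite /h; lra.
have lh : lambda * h <= 1 by rewrite -ler_pdivlMl // mulr1 /h; lra.
have := Hd1 h; rewrite /h [t + _]addrC subrK -/h => /(_ ltac:(rewrite /h; lra)).
move: s1; set s := (_ (xi t)).1; set s' := (_ (xi y)).1 => s1 ss.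
have -> : s' = (s' - s - - lambda * s * h) + s * (1 - lambda * h) by ring.
rewrite (le_trans (ler_normD _ _)) // normrM (ger0_norm (_ : 0 <= 1 - _)); last lra.
have : `|s| * (1 - lambda * h) <= 1 * (1 - lambda * h).
  by apply: ler_wpM2r => //; lra.
have := mulr_gt0 l0 h0; lra.
Qed.

(** Uniqueness within a square, up to and including the exit time. The two products in [P] below are
    constants of motion inside the region; their values show that the point is still in the region
    before time [- ln w0], which lets the induction proceed, and continuity passes to the limit
    times. *)
Lemma local_flow {R : realType} (lambda a : R) k (xi : R -> R * R) t0 s0 w0 :
  0 < lambda -> 0 < a -> is_trajectory lambda a xi -> 0 <= t0 ->
  local_coord a k (xi t0) = (s0, w0) -> `|s0| <= 1 -> 0 < w0 < 1 ->
  forall h, 0 <= h <= - ln w0 ->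
  local_coord a k (xi (t0 + h)) = (s0 * expR (- lambda * h), w0 * expR h).
Proof.
move=> l0 a0 txi t00 e0 s01 /andP[w00 w01].
pose S y := (local_coord a k (xi y)).1; pose U y := (local_coord a k (xi y)).2.
have [cS cU] : continuous_ge0 S /\ continuous_ge0 U := local_continuous _ _ k _ txi.
pose cfun c (x : R) := expR (c * (x - t0)).
have ccfun c : continuous (cfun c) by exact: continuous_expR_lin.
pose P y := cfun lambda y * S y = s0 /\ cfun (-1) y * U y = w0.
have PE y : P y -> S y = s0 * expR (- lambda * (y - t0)) /\ U y = w0 * expR (y - t0).
  move=> [<- <-]; split; rewrite mulrAC -expRD.
    by rewrite -mulrDl subrr mul0r expR0 mul1r.
  by rewrite mulN1r addNr expR0 mul1r.
suff H y : t0 <= y <= t0 - ln w0 -> P y.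
  move=> h /andP[h0 h1]; have [] := PE _ (H (t0 + h) ltac:(lra)).
  rewrite addrAC subrr add0r => <- <-.
  exact: surjective_pairing.
apply: (real_induction t0 (t0 - ln w0) P) => {y}.
- by rewrite /P /S /U e0 /cfun subrr !mulr0 expR0 !mul1r.
- move=> x /andP[x0 x1] Px.
  have [Sx Ux] := PE x (Px x ltac:(lra)).
  have xx : 0 <= x by lra.
  have rx : region a k (xi x).
    apply/andP; split.
      rewrite -/(S x) Sx normrM (ger0_norm (expR_ge0 _)).
      rewrite -[leRHS](mulr1 1) ler_pM // ?expR_ge0 // -expR0 ler_expR.
      by rewrite mulNr oppr_le0 mulr_ge0 //; lra.
    rewrite -/(U x) Ux gtr0_norm ?mulr_gt0 ?expR_gt0 //.
    rewrite -ltr_pdivlMl // mulr1.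
    by rewrite -[ltRHS](lnK (x := w0^-1)) ?posrE ?invr_gt0 // ltr_expR lnV ?posrE //; lra.
  have [d d0 Hd] := region_right_open _ _ _ _ _ l0 a0 txi xx rx.
  exists d => // y /andP[xy yd] _.
  have [Px1 Px2] := Px x ltac:(lra).
  split; [rewrite -Px1|rewrite -Px2].
    apply: (rderiv0_const (fun z => cfun lambda z * S z)); [exact: continuous_ge0M|lra|].
    move=> t /andP[xt ty].
    have [dS _] := trajectory_rderiv _ _ k _ t a0 txi ltac:(lra) (Hd t ltac:(lra)).
    have := has_rderiv_expRM _ lambda t0 _ _ dS.
    by rewrite mulNr addNr mulr0.
  apply: (rderiv0_const (fun z => cfun (-1) z * U z)); [exact: continuous_ge0M|lra|].
  move=> t /andP[xt ty].
  have [_ dU] := trajectory_rderiv _ _ k _ t a0 txi ltac:(lra) (Hd t ltac:(lra)).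
  have := has_rderiv_expRM _ (-1) t0 _ _ dU.
  by rewrite -/(U t) [X in _ * X](_ : _ = 0) ?mulr0 //; ring.
- move=> x /andP[x0 x1] Px.
  have lim (f : R -> R) (c : R) : continuous_ge0 f ->
      (forall y, t0 <= y < x -> f y = c) -> f x = c.
    move=> cf fc; apply/eqP; rewrite -subr_eq0 -normr_eq0; apply/eqP.
    apply/eqP; rewrite eq_le normr_ge0 andbT; apply/ler_addgt0Pr => e e0'.
    have [d d0 Hd] := cf x ltac:(lra) e e0'.
    pose h := Order.min (x - t0) (d / 2).
    have h0 : 0 < h by rewrite lt_min; lra.
    have h1 : h <= x - t0 by rewrite ge_min lexx.
    have h2 : h <= d / 2 by rewrite ge_min lexx orbT.
    have := Hd (x - h) ltac:(lra).
    rewrite fc; last lra.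
    rewrite addrAC subrr sub0r normrN gtr0_norm // [`|c - _|]distrC add0r => H.
    by apply/ltW/H; lra.
  split.
    apply: (lim (fun x => cfun lambda x * S x)); first exact: continuous_ge0M.
    by move=> y yy; case: (Px y yy).
  apply: (lim (fun x => cfun (-1) x * U x)); first exact: continuous_ge0M.
  by move=> y yy; case: (Px y yy).
Qed.

(** * Itineraries *)

Definition entry_time {R : realType} (v : nat -> R) (n : nat) : R :=
  \sum_(i < n) - ln (v i).

(* [(sg n, v n)] are the local coordinates of the n-th entry point of an orbit
   through successive squares; [(sg 0, v 0)] is the starting point, which need not
   lie on an edge. *)
Definition is_coding {R : realType} (lambda a : R) (sg v : nat -> R) : Prop :=
  [/\ forall n, 0 < v n < 1, forall n, `|sg n| <= 1, forall n, sg n.+1 = 1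
    & forall n, v n.+1 = sg n * v n `^ lambda + a].

(** The time interval is closed: its right end is the exit point, which the next index describes
    again as an entry point. *)
Definition follows {R : realType} (lambda a : R) (k : nat) (sg v : nat -> R)
    (xi : R -> R * R) : Prop :=
  forall n h, 0 <= h <= - ln (v n) ->
    local_coord a (k + n) (xi (entry_time v n + h)) =
    (sg n * expR (- lambda * h), v n * expR h).

Lemma expR_Nln {R : realType} (w : R) : 0 < w -> w * expR (- ln w) = 1.
Proof. by move=> w0; rewrite expRN lnK ?posrE // divff // gt_eqF. Qed.

Lemma expR_Mln {R : realType} (c w : R) : 0 < w -> expR (c * ln w) = w `^ c.
Proof. by move=> w0; rewrite /powR gt_eqF. Qed.

Lemma powR_le1 {R : realType} (x y : R) : 0 < x <= 1 -> 0 <= y -> x `^ y <= 1.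
Proof.
move=> /andP[x0 x1] y0; rewrite -expR_Mln // -expR0 ler_expR.
by rewrite mulr_ge0_le0 // ln_le0.
Qed.

Lemma entry_timeS {R : realType} (v : nat -> R) n :
  entry_time v n.+1 = entry_time v n - ln (v n).
Proof. by rewrite /entry_time big_ord_recr. Qed.

Lemma entry_time0 {R : realType} (v : nat -> R) : entry_time v 0 = 0.
Proof. by rewrite /entry_time big_ord0. Qed.

Lemma entry_time_lt {R : realType} (v : nat -> R) n :
  (forall n, 0 < v n < 1) -> entry_time v n < entry_time v n.+1.
Proof. by move=> v01; rewrite entry_timeS ltrDl oppr_gt0 ln_lt0. Qed.

Lemma entry_time_ge0 {R : realType} (v : nat -> R) n :
  (forall n, 0 < v n < 1) -> 0 <= entry_time v n.
Proof.
move=> v01; elim: n => [|n IHn]; first by rewrite entry_time0.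
exact: le_trans IHn (ltW (entry_time_lt v n v01)).
Qed.

Lemma entry_time_le {R : realType} (v : nat -> R) m n :
  (forall n, 0 < v n < 1) -> (m <= n)%N -> entry_time v m <= entry_time v n.
Proof.
move=> v01 /subnK <-; elim: (n - m)%N => [|j IHj]; first by rewrite add0n.
exact: le_trans IHj (ltW (entry_time_lt v _ v01)).
Qed.

Lemma entry_time_cover {R : realType} (v : nat -> R) t :
  (forall n, 0 < v n < 1) -> (forall x, exists n, x < entry_time v n) ->
  0 <= t -> exists n h, t = entry_time v n + h /\ 0 <= h < - ln (v n).
Proof.
move=> v01 unb t0.
have [n tn nmin] := ex_minnP (unb t).
case: n tn nmin => [|n] tn nmin; first by move: tn; rewrite entry_time0; lra.
have : entry_time v n <= t.
  by rewrite leNgt; apply/negP => /nmin; rewrite ltnn.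
move: tn; rewrite entry_timeS => tn nt.
by exists n, (t - entry_time v n); split; lra.
Qed.

(** Each crossing from the second on lasts at least [- ln b], so entry times cannot accumulate. The
    starting value [v 0] is left unbounded since an orbit may start close to an exit edge. *)
Lemma entry_time_unbounded {R : realType} (v : nat -> R) (b : R) :
  (forall n, 0 < v n < 1) -> b < 1 -> (forall n, v n.+1 <= b) ->
  forall x, exists n, x < entry_time v n.
Proof.
move=> v01 b1 vb x.
have b0 : 0 < b by apply: lt_le_trans (vb 0%N); have /andP[] := v01 1%N.
have lb : 0 < - ln b by rewrite oppr_gt0 ln_lt0 // b0.
have step n : n%:R * - ln b <= entry_time v n.+1.
  elim: n => [|n IHn]; first by rewrite mul0r entry_time_ge0.
  rewrite entry_timeS -natr1 mulrDl mul1r lerD // lerN2 ler_ln ?posrE //.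
  by have /andP[] := v01 n.+1.
have [n hn] : exists n : nat, x / - ln b < n%:R.
  by exists (Num.truncn `|x / - ln b|).+1; apply: le_lt_trans (ler_norm _) (truncnS_gt _).
exists n.+1; apply: lt_le_trans (step n).
by rewrite -ltr_pdivrMr.
Qed.

Lemma local_coord_exit {R : realType} (lambda a : R) k p sg v :
  0 < v -> local_coord a k p = (sg * expR (- lambda * - ln v), v * expR (- ln v)) ->
  local_coord a k p = (sg * v `^ lambda, 1) /\
  local_coord a k.+1 p = (1, sg * v `^ lambda + a).
Proof.
move=> v0; rewrite mulrNN expR_Mln // expR_Nln // => e; split=> //.
by rewrite local_coordS e /=; congr pair; ring.
Qed.

Lemma follows_entry {R : realType} (lambda a : R) k sg v xi n :
  is_coding lambda a sg v -> follows lambda a k sg v xi ->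
  local_coord a (k + n) (xi (entry_time v n)) = (sg n, v n).
Proof.
move=> [v01 _ _ _] /(_ n 0); rewrite lexx oppr_ge0 ltW ?ln_lt0 // => /(_ isT).
by rewrite addr0 mulr0 expR0 !mulr1.
Qed.

Lemma trajectory_follows {R : realType} (lambda a : R) k sg v xi :
  0 < lambda -> 0 < a -> is_coding lambda a sg v -> is_trajectory lambda a xi ->
  local_coord a k (xi 0) = (sg 0%N, v 0%N) -> follows lambda a k sg v xi.
Proof.
move=> l0 a0 [v01 sg1 sgS vS] txi e0.
have flow n : local_coord a (k + n) (xi (entry_time v n)) = (sg n, v n) ->
    forall h, 0 <= h <= - ln (v n) ->
    local_coord a (k + n) (xi (entry_time v n + h)) =
    (sg n * expR (- lambda * h), v n * expR h).
  by move=> en; apply: (local_flow lambda) => //; exact: entry_time_ge0.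
move=> n; apply: (flow n); elim: n => [|n IHn]; first by rewrite addn0 entry_time0.
have /andP[v0 v1] := v01 n.
have := flow n IHn (- ln (v n)).
rewrite lexx andbT oppr_ge0 ltW ?ln_lt0 // => /(_ isT).
move=> /(local_coord_exit lambda _ _ _ _ _ v0)[_].
by rewrite addnS entry_timeS sgS vS.
Qed.

Lemma follows_unique {R : realType} (lambda a : R) k sg v xi xi' t :
  is_coding lambda a sg v -> (forall x, exists n, x < entry_time v n) ->
  follows lambda a k sg v xi -> follows lambda a k sg v xi' ->
  0 <= t -> xi t = xi' t.
Proof.
move=> [v01 _ _ _] unb fxi fxi' t0.
have [n [h [-> /andP[h0 h1]]]] := entry_time_cover v t v01 unb t0.
apply: (can_inj (local_coordK a (k + n))).
by rewrite fxi ?fxi' // h0 ltW.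
Qed.

Lemma continuous_ge0_glue {R : realType} (f : R -> R) (g : nat -> R -> R)
    (tau : nat -> R) :
  tau 0%N = 0 -> (forall n, tau n < tau n.+1) ->
  (forall t, 0 <= t -> exists n, tau n <= t < tau n.+1) ->
  (forall n, continuous_ge0 (g n)) ->
  (forall n t, tau n <= t <= tau n.+1 -> f t = g n t) -> continuous_ge0 f.
Proof.
move=> tau0 tauS cover cg fg t t0 e e0.
have [n /andP[nt tn]] := cover t t0.
have [d1 d10 Hd1] := cg n t t0 e e0.
(* Only the left side of a breakpoint needs the previous piece, which agrees with [f] up to and
   including the breakpoint; at [tau 0 = 0] there are no earlier times. *)
have [d2 d20 Hd2] : exists2 d, 0 < d & forall x, 0 <= x -> x < t -> `|x - t| < d ->
    `|f x - f t| < e.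
  have [tn0|nt'] := eqVneq (tau n) t; last first.
    exists (Order.min d1 (t - tau n)).
      by rewrite lt_min d10 subr_gt0 lt_neqAle nt'.
    move=> x x0 xt; rewrite lt_min => /andP[xd]; rewrite ltr0_norm ?subr_lt0 // => xn.
    by rewrite (fg n x) ?(fg n t); [exact: Hd1|lra|lra].
  case: n tn0 {nt tn Hd1} => [|n] tn0.
    by exists 1 => // x x0 xt; lra.
  have [d d0 Hd] := cg n t t0 e e0; have := tauS n => tn.
  exists (Order.min d (t - tau n)); first by rewrite lt_min d0; lra.
  move=> x x0 xt; rewrite lt_min => /andP[xd]; rewrite ltr0_norm ?subr_lt0 // => xn.
  by rewrite (fg n x) ?(fg n t); [exact: Hd|lra|lra].
exists (Order.min d1 (Order.min d2 (tau n.+1 - t))).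
  by rewrite !lt_min d10 d20 subr_gt0.
move=> x x0; rewrite !lt_min => /andP[xd1 /andP[xd2 xd3]].
have [xt|tx] := ltP x t; first exact: Hd2.
move: xd3; rewrite ger0_norm ?subr_ge0 // => xd3.
by rewrite (fg n x) ?(fg n t); [exact: Hd1|lra|lra].
Qed.

Lemma near_has_rderiv {R : realType} (f g : R -> R) t l e : 0 < e ->
  (forall x, t <= x < t + e -> f x = g x) -> has_rderiv f t l -> has_rderiv g t l.
Proof.
move=> e0 fg /has_rderivP H; apply/has_rderivP => c c0.
have [d d0 Hd] := H c c0.
exists (Order.min d e); first by rewrite lt_min d0.
move=> h /andP[h0]; rewrite lt_min => /andP[hd he].
by rewrite -!fg; [apply: Hd; rewrite h0|lra|lra].
Qed.

(** The explicit arcs are glued. They match because an exit point is the next entry point, and they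
    exhaust [[0, +oo[] because entry times are unbounded. At a breakpoint the right derivative is
    that of the later arc, in accordance with the value of the field on a shared edge. *)
Lemma trajectory_exists {R : realType} (lambda a : R) k sg v :
  0 < lambda -> 0 < a -> is_coding lambda a sg v ->
  (forall x, exists n, x < entry_time v n) ->
  exists xi, is_trajectory lambda a xi /\
    local_coord a k (xi 0) = (sg 0%N, v 0%N).
Proof.
move=> l0 a0 [v01 sg1 sgS vS] unb.
pose tau := entry_time v.
pose F n t := (sg n * expR (- lambda * (t - tau n)), v n * expR (1 * (t - tau n))).
pose E n t := of_local a (k + n) (F n t).
have tauS n : tau n < tau n.+1 by exact: entry_time_lt.
have unb1 t : exists n, t < tau n.+1.
  by have [n tn] := unb t; exists n; exact: lt_trans tn (tauS n).
(* The strict inequality in [unb1] selects the later arc at a breakpoint. *)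
pose N t := ex_minn (unb1 t).
pose xi t := E (N t) t.
have NE n t : tau n <= t < tau n.+1 -> N t = n.
  move=> /andP[nt tn]; rewrite /N; case: ex_minnP => m tm mmin.
  apply/eqP; rewrite eqn_leq mmin //= leqNgt; apply/negP => mn.
  have := entry_time_le v _ _ v01 mn; rewrite -/(tau _) -/(tau _) => h.
  by have := le_lt_trans (le_trans h nt) tm; rewrite ltxx.
have xiE n t : tau n <= t <= tau n.+1 -> xi t = E n t.
  move=> /andP[nt]; rewrite le_eqVlt => /orP[/eqP ->|tn]; last first.
    by rewrite /xi (NE n) // nt.
  rewrite /xi (NE n.+1); last by rewrite lexx tauS.
  apply: (can_inj (local_coordK a (k + n).+1)).
  have /andP[v0 v1] := v01 n.
  have [|_ ->] := local_coord_exit lambda a (k + n) (E n (tau n.+1)) (sg n) (v n) v0.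
    by rewrite of_localK /F /tau entry_timeS addrAC subrr sub0r mul1r.
  by rewrite /E -addnS of_localK /F subrr !mulr0 expR0 !mulr1 sgS vS.
have cover t : 0 <= t -> exists n, tau n <= t < tau n.+1.
  move=> t0; have [n [h [-> hh]]] := entry_time_cover v t v01 unb t0.
  by exists n; rewrite /tau entry_timeS; lra.
exists xi; split; last first.
  rewrite (xiE 0%N) ?/tau ?entry_time0 ?lexx; last first.
    by have := tauS 0%N; rewrite {1}/tau entry_time0 => /ltW.
  by rewrite /E addn0 of_localK /F /tau entry_time0 subrr !mulr0 expR0 !mulr1.
split.
  apply/within_continuous_ge02.
  have cE n : continuous_ge02 (E n).
    apply/(local_continuousP a (k + n)).
    have -> : (fun x => local_coord a (k + n) (E n x)) = F n.
      by apply/funext => x; rewrite /E of_localK.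
    split; rewrite /F.
      apply: (eq_continuous_ge0 (fun x => expR (- lambda * (x - tau n)) * sg n)).
        by move=> x; rewrite /= mulrC.
      apply: continuous_ge0M; first exact: continuous_expR_lin.
      by move=> x x0 e e0; exists 1 => // y _ _; rewrite subrr normr0.
    apply: (eq_continuous_ge0 (fun x => expR (1 * (x - tau n)) * v n)).
      by move=> x; rewrite /= mulrC.
    apply: continuous_ge0M; first exact: continuous_expR_lin.
    by move=> x x0 e e0; exists 1 => // y _ _; rewrite subrr normr0.
  have tau0 : tau 0%N = 0 by exact: entry_time0.
  split.
    apply: (continuous_ge0_glue _ (fun n x => (E n x).1) tau) => // [n|n t ht].
      by case: (cE n).
    by rewrite (xiE n).
  apply: (continuous_ge0_glue _ (fun n x => (E n x).2) tau) => // [n|n t ht].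
    by case: (cE n).
  by rewrite (xiE n).
move=> t t0; have [n /andP[nt tn]] := cover t t0.
suff : has_rderiv2 xi t (iris_field lambda a (xi t)) by [].
have e0 : local_coord a (k + n) (xi t) = F n t.
  by rewrite (xiE n) ?of_localK // nt ltW.
have rt : region a (k + n) (xi t).
  have /andP[v0 v1] := v01 n.
  rewrite /region e0 /F; apply/andP; split.
    rewrite normrM (ger0_norm (expR_ge0 _)) -[leRHS](mulr1 1).
    rewrite ler_pM // ?expR_ge0 // -expR0 ler_expR.
    by rewrite mulNr oppr_le0 mulr_ge0 // ?subr_ge0 // ltW.
  rewrite gtr0_norm ?mulr_gt0 ?expR_gt0 // -[ltRHS](expR_Nln (v n)) // ltr_pM2l //.
  by rewrite ltr_expR mul1r; move: tn; rewrite /tau entry_timeS; lra.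
apply/(local_rderiv a (k + n)); rewrite local_field //.
have de c x0 : has_rderiv (fun x => x0 * expR (c * (x - tau n))) t
    (c * (x0 * expR (c * (t - tau n)))).
  apply: is_derive_rderiv.
  rewrite mulrCA; have := is_derive_expR_lin c (tau n) t => dc.
  exact: is_deriveZ.
have d0 : 0 < tau n.+1 - t by rewrite subr_gt0.
have eF x : t <= x < t + (tau n.+1 - t) -> F n x = local_coord a (k + n) (xi x).
  by move=> xx; rewrite (xiE n) ?of_localK //; lra.
rewrite e0; split.
  apply: (near_has_rderiv _ _ _ _ _ d0 _ (de _ _)) => x /eF <-.
  by [].
rewrite -[(_, _).2]mul1r.
apply: (near_has_rderiv _ _ _ _ _ d0 _ (de _ _)) => x /eF <-.
by [].
Qed.

(** * Fixed points of the return map *)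

Lemma is_derive_rho {R : realType} (lambda a x : R) : 0 < x ->
  is_derive x 1 (rho lambda a) (lambda * x `^ (lambda - 1) - 1).
Proof.
move=> x0; have dx := is_derive1_powR lambda x0.
have -> : rho lambda a = ((@powR R)^~ lambda - id) + cst a by apply/funext.
by apply: is_derive_eq; rewrite addr0.
Qed.

Lemma rho_MVT {R : realType} (lambda a x y : R) : 0 < x -> x < y ->
  exists2 z, x < z < y &
    rho lambda a y - rho lambda a x = (lambda * z `^ (lambda - 1) - 1) * (y - x).
Proof.
move=> x0 xy; have [| |z] := @MVT R (rho lambda a)
  (fun z => lambda * z `^ (lambda - 1) - 1) x y xy.
- by move=> z; rewrite in_itv /= => /andP[xz _]; apply: is_derive_rho; lra.
- apply: derivable_within_continuous => z; rewrite in_itv /= => /andP[xz _].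
  by have [] := is_derive_rho lambda a z (lt_le_trans x0 xz).
by rewrite in_itv /=; exists z.
Qed.

Lemma drho_lt {R : realType} (lambda x y : R) : 1 < lambda -> 0 < x -> x < y ->
  lambda * x `^ (lambda - 1) < lambda * y `^ (lambda - 1).
Proof.
move=> l1 x0 xy; rewrite ltr_pM2l; last lra.
by rewrite gt0_ltr_powR // ?nnegrE; lra.
Qed.

(** The equation of this Rolle point mentions neither [a] nor the roots. It is the place where [rho]
    turns from decreasing to increasing, and all sign information on [rho] is drawn from it. *)
Lemma rho_critical {R : realType} (lambda a r1 r2 : R) :
  1 < lambda -> 0 < r1 -> r1 < r2 -> rho lambda a r1 = 0 ->
  rho lambda a r2 = 0 ->
  exists2 c, r1 < c < r2 & lambda * c `^ (lambda - 1) = 1.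
Proof.
move=> l1 r10 r12 h1 h2; have [z zz] := rho_MVT lambda a _ _ r10 r12.
rewrite h1 h2 subrr => /esym/eqP; rewrite mulf_eq0 !subr_eq0 => /orP[/eqP e|/eqP e].
  by exists z.
by move: r12; rewrite e ltxx.
Qed.

Lemma rho_decr {R : realType} (lambda a c x y : R) : 1 < lambda ->
  lambda * c `^ (lambda - 1) = 1 -> 0 < x -> x < y -> y <= c ->
  rho lambda a y < rho lambda a x.
Proof.
move=> l1 hc x0 xy yc; have [z /andP[xz zy] e] := rho_MVT lambda a _ _ x0 xy.
rewrite -subr_lt0 e pmulr_llt0 ?subr_gt0 // subr_lt0 -[ltRHS]hc.
by apply: drho_lt => //; lra.
Qed.

Lemma rho_incr {R : realType} (lambda a c x y : R) : 1 < lambda -> 0 < c ->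
  lambda * c `^ (lambda - 1) = 1 -> c <= x -> x < y ->
  rho lambda a x < rho lambda a y.
Proof.
move=> l1 c0 hc cx xy; have x0 : 0 < x by lra.
have [z /andP[xz zy] e] := rho_MVT lambda a _ _ x0 xy.
rewrite -subr_gt0 e pmulr_lgt0 ?subr_gt0 // -[ltLHS]hc.
by apply: drho_lt => //; lra.
Qed.

Lemma rho1 {R : realType} (lambda a : R) : rho lambda a 1 = a.
Proof. by rewrite /rho powR1 subrr add0r. Qed.

Lemma rho_eq0 {R : realType} (lambda a u : R) :
  rho lambda a u = 0 <-> u `^ lambda + a = u.
Proof. by rewrite /rho; split; lra. Qed.

Lemma root_lt1 {R : realType} (lambda a u : R) : 1 < lambda -> 0 < a -> 0 < u ->
  rho lambda a u = 0 -> u < 1.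
Proof.
move=> l1 a0 u0 /rho_eq0 e; rewrite ltNge; apply/negP => u1.
have : u `^ 1 <= u `^ lambda by apply: ler_powR => //; lra.
by rewrite powRr1; lra.
Qed.

Lemma rho_neg_between {R : realType} (lambda a r1 r2 v : R) :
  1 < lambda -> 0 < r1 -> rho lambda a r1 = 0 -> rho lambda a r2 = 0 ->
  r1 < v < r2 -> rho lambda a v < 0.
Proof.
move=> l1 r10 h1 h2 /andP[v1 v2].
have [c /andP[c1 c2] hc] := rho_critical _ _ _ _ l1 r10 (lt_trans v1 v2) h1 h2.
have [vc|cv] := leP v c; first by rewrite -h1; apply: (rho_decr _ _ c).
by rewrite -h2; apply: (rho_incr _ _ c) => //; lra.
Qed.

Lemma smallest_root_exists {R : realType} (lambda a r1 r2 : R) :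
  1 < lambda -> 0 < r1 -> r1 < r2 -> rho lambda a r1 = 0 ->
  rho lambda a r2 = 0 -> is_smallest_root lambda a r1.
Proof.
move=> l1 r10 r12 h1 h2; split=> // v v0 hv; rewrite leNgt; apply/negP => vr.
have [c /andP[c1 c2] hc] := rho_critical _ _ _ _ l1 r10 r12 h1 h2.
have := rho_decr lambda a c v r1 l1 hc v0 vr (ltW c1).
by rewrite h1 hv ltxx.
Qed.

Lemma smallest_root_unique {R : realType} (lambda a u v : R) :
  is_smallest_root lambda a u -> is_smallest_root lambda a v -> u = v.
Proof.
move=> [u0 hu mu] [v0 hv mv]; apply/eqP; rewrite eq_le.
by rewrite mu // mv.
Qed.

(** The return map has increasing derivative, so on []0, b]] its slope is at most the slope at [b],
    which is less than 1 as soon as [b] precedes the critical point. The interval is preserved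
    because [rho] is negative at [b]; the midpoint of [r1] and [c] is one possible [b]. *)
Lemma root_map_contraction {R : realType} (lambda a r1 r2 : R) :
  1 < lambda -> 0 < r1 -> r1 < r2 -> rho lambda a r1 = 0 ->
  rho lambda a r2 = 0 ->
  exists b q, [/\ r1 < b < r2, 0 < q < 1,
    forall v, 0 < v <= b -> `|v `^ lambda + a - r1| <= q * `|v - r1| &
    forall v, 0 < v <= b -> v `^ lambda + a <= b].
Proof.
move=> l1 r10 r12 h1 h2.
have [c /andP[c1 c2] hc] := rho_critical _ _ _ _ l1 r10 r12 h1 h2.
pose b := (r1 + c) / 2; have b1 : r1 < b by rewrite /b; lra.
have bc : b < c by rewrite /b; lra.
have b0 : 0 < b by lra.
exists b, (lambda * b `^ (lambda - 1)); split.
- by rewrite b1 (lt_trans bc c2).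
- by rewrite mulr_gt0 ?powR_gt0 /= -?[ltRHS]hc ?drho_lt //; lra.
- have step x y : 0 < x -> x < y -> y <= b ->
      `|(y `^ lambda + a) - (x `^ lambda + a)| <= lambda * b `^ (lambda - 1) * (y - x).
    move=> x0 xy yb; have [z /andP[xz zy]] := rho_MVT lambda a _ _ x0 xy.
    rewrite /rho => e.
    have -> : y `^ lambda + a - (x `^ lambda + a) = lambda * z `^ (lambda - 1) * (y - x).
      by lra.
    rewrite ger0_norm; last by rewrite !mulr_ge0 ?powR_ge0 //; lra.
    rewrite ler_pM2r ?subr_gt0 // ltW // drho_lt //; lra.
  have e1 := (rho_eq0 _ _ _).1 h1.
  move=> v /andP[v0 vb]; case: (ltrgtP v r1) => [vr|vr|->].
  + by have := step v r1 v0 vr (ltW b1); rewrite e1 distrC.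
  + by have := step r1 v r10 vr vb; rewrite e1.
  + by rewrite e1 subrr normr0 mulr0.
- move=> v /andP[v0 vb].
  have : v `^ lambda <= b `^ lambda by rewrite ge0_ler_powR ?nnegrE; lra.
  have : rho lambda a b < 0.
    by apply: (rho_neg_between _ _ r1 r2) => //; rewrite b1; lra.
  by rewrite /rho; lra.
Qed.

Lemma drho_smallest {R : realType} (lambda a r1 r2 : R) :
  1 < lambda -> 0 < r1 -> r1 < r2 -> rho lambda a r1 = 0 ->
  rho lambda a r2 = 0 -> lambda * r1 `^ (lambda - 1) < 1.
Proof.
move=> l1 r10 r12 h1 h2.
have [c /andP[c1 c2] hc] := rho_critical _ _ _ _ l1 r10 r12 h1 h2.
by rewrite -[ltRHS]hc drho_lt.
Qed.

(** * Sums along the orbits of a contraction *)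

Lemma cvg_is_derive {R : realType} (f : R -> R) (t l : R) :
  (f (t + h) - f t) / h @[h --> 0^'] --> l -> is_derive t 1 f l.
Proof.
move=> H; have H' : (fun h => h^-1 *: ((f \o shift t) (h *: 1) - f t)) @ 0^' --> l.
  rewrite (_ : (fun h => _) = (fun h => (f (t + h) - f t) / h)); first exact: H.
  by apply/funext => h /=; rewrite mulrC scaler1 [h + t]addrC.
split; first by apply/cvg_ex; exists l.
exact: (cvg_lim _ H').
Qed.

Lemma is_deriveP {R : realType} (f : R -> R) (t l : R) :
  is_derive t 1 f l <-> forall e, 0 < e -> exists2 d, 0 < d &
    forall x, `|x - t| < d -> `|f x - f t - l * (x - t)| <= e * `|x - t|.
Proof.
have E (h x e : R) : h != 0 -> (`|x / h - l| <= e) = (`|x - l * h| <= e * `|h|).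
  move=> h0; rewrite -(ler_pM2r (_ : 0 < `|h|)) ?normr_gt0 // -normrM.
  by rewrite mulrBl divfK.
split=> [/is_derive_cvg/cvg_dnbhs0P H e e0|H].
  have [d d0 Hd] := H e e0; exists d => // x xt.
  have [xt0|xt0] := eqVneq (x - t) 0.
    by rewrite xt0 mulr0 normr0 mulr0 subr0 (subr0_eq xt0) subrr normr0.
  by have := Hd _ xt0 xt; rewrite E // [t + _]addrC subrK.
apply: cvg_is_derive; apply/cvg_dnbhs0P => e e0.
have [d d0 Hd] := H e e0; exists d => // h h0 hd.
by rewrite E //; have := Hd (t + h); rewrite [t + _ - t]addrAC subrr add0r; exact.
Qed.

Lemma iter_contraction {R : realType} (f : R -> R) (u q : R) (J : set R) :
  0 < q -> (forall v, J v -> J (f v) /\ `|f v - u| <= q * `|v - u|) ->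
  forall v n, J v -> J (iter n f v) /\ `|iter n f v - u| <= `|v - u| * q ^+ n.
Proof.
move=> q0 fJ v n Jv; elim: n => [|n [Jn IHn]]; first by rewrite expr0 mulr1.
have [Jf fn] := fJ _ Jn; rewrite iterS; split=> //.
by rewrite (le_trans fn) // exprS mulrCA ler_pM2l.
Qed.

Lemma iter_contraction_cvg {R : realType} (f : R -> R) (u q : R) (J : set R) :
  0 < q < 1 -> (forall v, J v -> J (f v) /\ `|f v - u| <= q * `|v - u|) ->
  forall v, J v -> iter n f v @[n --> \oo] --> u.
Proof.
move=> /andP[q0 q1] fJ v Jv.
apply/cvgrPdist_le => e e0.
have := cvg_geometric `|v - u| (z := q).
rewrite gtr0_norm // => /(_ q1) /cvgrPdist_le /(_ e e0).
apply: filterS => n /=; rewrite sub0r normrN => h; rewrite distrC.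
apply: le_trans h; apply: le_trans (ler_norm _).
by have [] := iter_contraction f u q J q0 fJ v n Jv.
Qed.

(* The sum [Phi] of [Lf] along the orbit of [v] solves [Phi = Lf + Phi \o f],
   so its derivative at the fixed point must be [m / (1 - c)]; subtracting the
   corresponding linear coboundary leaves a sum of terms [o (f^n v - u)]. *)
Lemma cocycle_sum {R : realType} (f Lf : R -> R) (u c m q K : R) (J : set R) :
  f u = u -> Lf u = 0 -> is_derive u 1 f c -> is_derive u 1 Lf m -> c != 1 ->
  0 < q < 1 -> J u -> (exists2 d, 0 < d & forall v, `|v - u| < d -> J v) ->
  (forall v, J v -> J (f v) /\ `|f v - u| <= q * `|v - u|) ->
  (forall v, J v -> `|Lf v| <= K * `|v - u|) ->
  exists Phi : R -> R,
    [/\ forall v, J v -> series (fun n => Lf (iter n f v)) n @[n --> \oo] --> Phi v,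
        Phi u = 0 & is_derive u 1 Phi (m / (1 - c))].
Proof.
move=> fu Lu df dL c1 /andP[q0 q1] Ju [d0 d00 Jd] fJ LJ.
have qn : `|q| < 1 by rewrite gtr0_norm.
have fJn v n := iter_contraction f u q J q0 fJ v n.
pose Phi v := limn (series (fun n => Lf (iter n f v))).
have cP v : J v -> series (fun n => Lf (iter n f v)) n @[n --> \oo] --> Phi v.
  move=> Jv; apply: normed_cvg.
  apply: (@series_le_cvg _ _ (geometric (K * `|v - u|) q)) => [n|n|n|].
  - exact: normr_ge0.
  - rewrite /= mulr_ge0 ?exprn_ge0 ?(ltW q0) //.
    by rewrite (le_trans (normr_ge0 _) (LJ v Jv)).
  - have [Jn fn] := fJn v n Jv.
    (* For [v = u] nothing is known about the sign of [K], but all terms vanish; otherwise the bound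
       on [Lf v] forces [K] to be nonnegative. *)
    have [vu|vu] := eqVneq v u.
      rewrite /= vu (_ : iter n f u = u) ?Lu ?normr0 ?subrr ?normr0 ?mulr0 ?mul0r //.
      by elim: n {Jn fn} => // n IHn; rewrite iterS IHn.
    have K0 : 0 <= K.
      rewrite -(pmulr_lge0 _ (_ : 0 < `|v - u|)) ?normr_gt0 ?subr_eq0 //.
      by rewrite (le_trans (normr_ge0 _) (LJ v Jv)).
    by rewrite (le_trans (LJ _ Jn)) //= -mulrA ler_wpM2l.
  - exact: is_cvg_geometric_series.
have Phiu : Phi u = 0.
  rewrite /Phi (_ : series _ = fun=> 0) ?lim_cst //.
  apply/funext => n; rewrite /series /= big1 // => i _.
  rewrite (_ : iter i f u = u) //; elim: i => // i IHi; by rewrite iterS IHi.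
exists Phi; split=> //; set M := m / (1 - c).
have c10 : 1 - c != 0 by rewrite subr_eq0 eq_sym.
(* At [u] the derivative of [r] is [m - M + M * c = 0]: this equation determines [M]. *)
pose r v := Lf v - M * (v - u) + M * (f v - u).
have rP e : 0 < e -> exists2 d, 0 < d & forall v, `|v - u| < d -> `|r v| <= e * `|v - u|.
  move=> e0.
  have e10 : 0 < e / 2 by lra.
  have M1 : 0 < `|M| + 1 by apply: ltr_wpDl.
  have e20 : 0 < e / 2 / (`|M| + 1) by rewrite divr_gt0.
  have [d1 d10 H1] := (is_deriveP _ _ _).1 dL _ e10.
  have [d2 d20 H2] := (is_deriveP _ _ _).1 df _ e20.
  exists (Order.min d1 d2); first by rewrite lt_min d10.
  move=> v; rewrite lt_min => /andP[/H1 + /H2]; rewrite Lu fu subr0 => h1 h2.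
  have -> : r v = (Lf v - m * (v - u)) + M * (f v - u - c * (v - u)).
    by rewrite /r /M; field.
  rewrite (le_trans (ler_normD _ _)) // normrM.
  have : `|M| * `|f v - u - c * (v - u)| <= (`|M| + 1) * (e / 2 / (`|M| + 1) * `|v - u|).
    by apply: ler_pM => //; rewrite lerDl.
  rewrite mulrA [(`|M| + 1) * _]mulrC divfK ?gt_eqF // => h3.
  by rewrite (le_trans (lerD h1 h3)) // -mulrDl -splitr.
apply/is_deriveP => e e0.
(* The factor [1 - q] will cancel the sum of the geometric series. *)
have e10 : 0 < e * (1 - q) by rewrite mulr_gt0 ?subr_gt0.
have [d d1 Hd] := rP _ e10.
exists (Order.min d d0); first by rewrite lt_min d1.
move=> v; rewrite lt_min => /andP[vd /Jd Jv].
rewrite Phiu subr0 -/M.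
have tele n : series (fun n => Lf (iter n f v)) n =
    \sum_(0 <= i < n) r (iter i f v) + M * (v - u) - M * (iter n f v - u).
  rewrite /series /=; elim: n => [|n IHn]; first by rewrite !big_geq //=; ring.
  by rewrite !big_nat_recr //= IHn /r; ring.
have itu := iter_contraction_cvg f u q J _ fJ v Jv.
have {}itu : M * (iter n f v - u) @[n --> \oo] --> (0 : R).
  rewrite -[X in _ --> X](mulr0 M) -(subrr u).
  apply: cvgM; first exact: cvg_cst.
  by apply: cvgB; [apply: itu; rewrite q0|exact: cvg_cst].
have cS : `|series (fun n => Lf (iter n f v)) n + M * (iter n f v - u) - M * (v - u)|
    @[n --> \oo] --> `|Phi v - M * (v - u)|.
  apply: cvg_norm; apply: cvgB; last exact: cvg_cst.
  by rewrite -[X in _ --> X]addr0; apply: cvgD; [exact: cP|].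
apply: (ler_cvg_to cS (cvg_cst _)); apply: nearW => n.
rewrite tele subrK addrK (le_trans (ler_norm_sum _ _ _)) //.
apply: le_trans (_ : \sum_(0 <= i < n) (e * (1 - q) * `|v - u|) * q ^+ i <= _).
  apply: ler_sum => i _; have [Ji fi] := fJn v i Jv.
  apply: le_trans (Hd _ _) _.
    apply: le_lt_trans vd; apply: le_trans fi _.
    by rewrite ler_piMr // exprn_ile1 // ltW.
  by rewrite -[leRHS]mulrA ler_pM2l.
have := geometric_le_lim (R := R) n (a := e * (1 - q) * `|v - u|) (x := q).
rewrite /series /= qn q0 => /(_ _ isT isT).
rewrite (_ : _ / (1 - q) = e * `|v - u|); first by apply; rewrite mulr_ge0 // ltW.
by field; rewrite subr_eq0 eq_sym lt_eqF.
Qed.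

(** * Convergence to the cycle *)

Lemma norm1D {R : realType} (p q : R * R) : norm1 (p + q) <= norm1 p + norm1 q.
Proof.
by rewrite /norm1 /= addrACA lerD ?ler_normD.
Qed.

Lemma norm1_ge0 {R : realType} (p : R * R) : 0 <= norm1 p.
Proof. by rewrite addr_ge0. Qed.

Lemma norm1N {R : realType} (p : R * R) : norm1 (- p) = norm1 p.
Proof. by rewrite /norm1 /= !normrN. Qed.

Lemma norm1B {R : realType} (p q : R * R) : norm1 (p - q) = norm1 (q - p).
Proof. by rewrite -norm1N opprB. Qed.

Lemma norm1_triangle {R : realType} (q p r : R * R) :
  norm1 (p - r) <= norm1 (p - q) + norm1 (q - r).
Proof. by rewrite (le_trans _ (norm1D _ _)) // addrA subrK. Qed.

Lemma norm1_fst {R : realType} (p : R * R) : `|p.1| <= norm1 p.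
Proof. by rewrite lerDl. Qed.

Lemma norm1_snd {R : realType} (p : R * R) : `|p.2| <= norm1 p.
Proof. by rewrite lerDr. Qed.

Lemma iris_field_bound {R : realType} (lambda a : R) p : 0 < lambda -> 0 < a ->
  norm1 (iris_field lambda a p) <= lambda + 1.
Proof.
move=> l0 a0; have [[k rk]|nr] := pselect (exists k, region a k p).
  rewrite -(norm1_rotccw (k + 3)) local_field // /norm1 /=.
  have /andP[s1 u1] := rk.
  apply: lerD; last exact: ltW.
  by rewrite normrM normrN (gtr0_norm l0) ler_piMr // ltW.
rewrite iris_field_out; first by rewrite /norm1 /= normr0; lra.
by move=> k; apply/negP => rk; apply: nr; exists k.
Qed.

Lemma rderiv_lipschitz {R : realType} (f : R -> R) (M t0 t1 : R) :
  continuous_ge0 f ->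
  (forall t, 0 <= t -> exists2 l, `|l| <= M & has_rderiv f t l) ->
  0 <= t0 <= t1 -> `|f t1 - f t0| <= M * (t1 - t0).
Proof.
move=> cf H t01.
have mono (g : R -> R) : continuous_ge0 g ->
    (forall t, 0 <= t -> exists2 l, `|l| <= M & has_rderiv g t l) ->
    g t0 - g t1 <= M * (t1 - t0).
  move=> cg Hg; pose G x := g x + M * x.
  suff : G t0 <= G t1 by rewrite /G; lra.
  apply: (rderiv_ge0 G (G t0 - 1)) => //; last 2 first.
  - lra.
  - move=> t tt _; have [l lM /has_rderivP dg] := Hg t ltac:(lra).
    exists (l + M); first by move: lM; rewrite ler_norml => /andP[? _]; lra.
    apply/has_rderivP => e /dg[d d0 Hd]; exists d => // h /Hd.
    by rewrite /G; congr (`|_| <= _); ring.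
  apply/continuous_ge0P => t t0'; rewrite /G; apply: cvgD.
    by move/continuous_ge0P: cg; apply.
  apply: cvgM; first exact: cvg_cst.
  by apply: cvg_within.
have h1 := mono f cf H.
have h2 : - f t0 - - f t1 <= M * (t1 - t0).
  apply: (mono (fun x => - f x)); first exact: continuous_ge0N.
  move=> t t0'; have [l lM df] := H t t0'.
  by exists (- l); [rewrite normrN|exact: has_rderivN].
by rewrite ler_norml; lra.
Qed.

(** This bound ignores the edges. It controls the short time intervals in which two nearby orbits
    are in different squares and their local coordinates cannot be compared. *)
Lemma trajectory_lipschitz {R : realType} (lambda a : R) xi t0 t1 :
  0 < lambda -> 0 < a -> is_trajectory lambda a xi -> 0 <= t0 -> 0 <= t1 ->
  norm1 (xi t1 - xi t0) <= 2 * (lambda + 1) * `|t1 - t0|.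
Proof.
move=> l0 a0 txi; wlog t01 : t0 t1 / t0 <= t1.
  move=> hw t00 t10; have [t01|t10'] := leP t0 t1; first exact: hw.
  by rewrite norm1B distrC; apply: hw => //; exact: ltW.
move=> t00 _; rewrite ger0_norm ?subr_ge0 //.
have t001 : 0 <= t0 <= t1 by rewrite t00.
have [/within_continuous_ge02[c1 c2] dxi] := txi.
rewrite -mulrA mulr_natl mulr2n /norm1 /=.
apply: lerD.
  apply: (rderiv_lipschitz (fun x => (xi x).1)) => // t /dxi[d1 d2].
  exists (iris_field lambda a (xi t)).1; last exact: d1.
  exact: le_trans (norm1_fst _) (iris_field_bound _ _ _ l0 a0).
apply: (rderiv_lipschitz (fun x => (xi x).2)) => // t /dxi[d1 d2].
exists (iris_field lambda a (xi t)).2; last exact: d2.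
exact: le_trans (norm1_snd _) (iris_field_bound _ _ _ l0 a0).
Qed.

Definition follows_cycle {R : realType} (lambda a u : R) (gamma : R -> R * R) :=
  follows lambda a 1 (fun=> 1) (fun=> u) gamma.

Lemma entry_time_cst {R : realType} (u : R) n :
  entry_time (fun=> u) n = n%:R * - ln u.
Proof. by rewrite /entry_time sumr_const card_ord mulr_natl. Qed.

Lemma cycle_local {R : realType} (lambda a u : R) gamma n h :
  follows_cycle lambda a u gamma -> 0 <= h <= - ln u ->
  local_coord a n.+1 (gamma (n%:R * - ln u + h)) =
  (expR (- lambda * h), u * expR h).
Proof. by move=> /(_ n h) H /H; rewrite entry_time_cst add1n mul1r. Qed.

Lemma cycle_coding {R : realType} (lambda a u : R) :
  0 < u < 1 -> u `^ lambda + a = u -> is_coding lambda a (fun=> 1) (fun=> u).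
Proof. by move=> u01 uu; split=> // n; rewrite ?normr1 // mul1r. Qed.

Lemma cycle_unbounded {R : realType} (u : R) : 0 < u < 1 ->
  forall x, exists n, x < entry_time (fun=> u) n.
Proof. by move=> u01; apply: (entry_time_unbounded _ u) => //; case/andP: u01. Qed.

(** The cycle enters [S_(k+n+1)] at time [(k + n) * - ln u], while [xi] enters it at
    [entry_time v n], so [c] is the limit of the lag. The two orbits are compared crossing by
    crossing. *)
Lemma convergence_to_cycle {R : realType} (lambda a u c : R) k sg v xi gamma :
  0 < lambda -> 0 < a -> 0 < u < 1 -> is_coding lambda a sg v ->
  is_trajectory lambda a xi -> is_trajectory lambda a gamma ->
  follows lambda a k.+1 sg v xi -> follows_cycle lambda a u gamma ->
  (forall x, exists n, x < entry_time v n) -> 0 <= c ->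
  v n @[n --> \oo] --> u ->
  (k + n)%:R * - ln u - entry_time v n @[n --> \oo] --> c ->
  norm1 (xi t - gamma (t + c)) @[t --> +oo] --> (0 : R).
Proof.
move=> l0 a0 u01 cod txi tgam fxi fgam unb c0 vu tc.
have [v01 _ sgS _] := cod; have /andP[u0 u1] := u01.
pose L := - ln u; have L0 : 0 < L by rewrite oppr_gt0 ln_lt0.
(* The terms of [err] account for the difference of crossing durations, the difference of entry
   coordinates, amplified by at most [1 / u] during a crossing, and the lag not yet settled. *)
pose M := 2 * (lambda + 1); have M0 : 0 < M by rewrite /M; lra.
pose err n := 2 * M * `|ln (v n) - ln u| + `|v n - u| / u +
  M * `|(k + n)%:R * L - entry_time v n - c|.
have err0 : err n @[n --> \oo] --> (0 : R).
  have -> : (0 : R) = 2 * M * `|ln u - ln u| + `|u - u| / u + M * `|c - c|.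
    by rewrite !subrr normr0 !mulr0 mul0r !addr0.
  apply: cvgD; [apply: cvgD|]; apply: cvgM; try exact: cvg_cst.
  - apply: cvg_norm; apply: cvgB; last exact: cvg_cst.
    exact: (continuous_cvg _ (continuous_ln u0)).
  - by apply: cvg_norm; apply: cvgB => //; exact: cvg_cst.
  - by apply: cvg_norm; apply: cvgB => //; exact: cvg_cst.
(* Index 0 is excluded because the stable coordinate of the starting point need not be 1. *)
have bound n h : (0 < n)%N -> 0 <= h < - ln (v n) ->
    norm1 (xi (entry_time v n + h) - gamma (entry_time v n + h + c)) <= err n.
  move=> n0 /andP[h0 hv]; set tau := entry_time v n.
  have tau0 : 0 <= tau by exact: entry_time_ge0.
  (* If [xi] is the slower one, the cycle has left the square after time [L]; the comparison is then
     made at the exit time of the cycle. *)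
  pose h' := Order.min h L.
  have h'0 : 0 <= h' by rewrite le_min h0 ltW.
  have h'h : h' <= h by rewrite ge_min lexx.
  have h'L : h' <= L by rewrite ge_min lexx orbT.
  have hh' : h - h' <= `|ln (v n) - ln u|.
    have := ler_norm (- (ln (v n) - ln u)); rewrite normrN.
    rewrite /h' minEle; case: ifP => _; first by rewrite subrr.
    by rewrite /L; lra.
  have kn0 : 0 <= (k + n)%:R * L by rewrite mulr_ge0 // ltW.
  have b1 : norm1 (xi (tau + h) - xi (tau + h')) <= M * `|ln (v n) - ln u|.
    apply: le_trans (trajectory_lipschitz _ _ _ _ _ l0 a0 txi _ _) _; try lra.
    by rewrite ler_pM2l // ger0_norm; lra.
  have b2 : norm1 (xi (tau + h') - gamma ((k + n)%:R * L + h')) <= `|v n - u| / u.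
    rewrite -(norm1_local a (k.+1 + n)) fxi; last by rewrite h'0 /=; lra.
    rewrite addSn (cycle_local _ _ _ _ _ _ fgam); last by rewrite h'0.
    have -> : sg n = 1 by case: (n) n0 => // m _; exact: sgS.
    rewrite /norm1 /= mul1r subrr normr0 add0r -mulrBl normrM ler_wpM2l //.
    rewrite ger0_norm ?expR_ge0 // -[leRHS]lnK ?posrE ?invr_gt0 // ler_expR.
    by rewrite lnV ?posrE.
  have b3 : norm1 (gamma ((k + n)%:R * L + h') - gamma (tau + h + c)) <=
      M * `|ln (v n) - ln u| + M * `|(k + n)%:R * L - tau - c|.
    apply: le_trans (trajectory_lipschitz _ _ _ _ _ l0 a0 tgam _ _) _; try lra.
    rewrite -mulrDr ler_pM2l //.
    have -> : (k + n)%:R * L + h' - (tau + h + c) =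
       - (h - h') + ((k + n)%:R * L - tau - c) by ring.
    by rewrite (le_trans (ler_normD _ _)) // lerD // normrN ger0_norm; lra.
  have := norm1_triangle (xi (tau + h')) (xi (tau + h)) (gamma (tau + h + c)).
  have := norm1_triangle (gamma ((k + n)%:R * L + h')) (xi (tau + h'))
    (gamma (tau + h + c)).
  by rewrite /err -/tau; lra.
apply/cvgrPdist_le => e e0.
have /cvgrPdist_le /(_ e e0) [N _ HN] := err0.
exists (entry_time v N.+1); split; first exact: num_real.
move=> t tN; rewrite sub0r normrN ger0_norm ?norm1_ge0 //.
have t0 : 0 <= t by apply: le_trans (ltW tN); exact: entry_time_ge0.
have [n [h [th hh]]] := entry_time_cover v t v01 unb t0.
have nN : (N < n)%N.
  rewrite ltnNge; apply/negP => nN.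
  have := entry_time_le v n.+1 N.+1 v01 nN.
  by rewrite entry_timeS; move: tN; rewrite th; lra.
rewrite th; apply: le_trans (bound n h (leq_ltn_trans (leq0n _) nN) hh) _.
have := HN n (ltnW nN); rewrite /= sub0r normrN; apply: le_trans.
exact: ler_norm.
Qed.

(** * Accumulated time advance and the basin on which it is defined *)

Lemma ln_lipschitz {R : realType} (a v u : R) : 0 < a -> a <= v -> a <= u ->
  `|ln v - ln u| <= a^-1 * `|v - u|.
Proof.
move=> a0; wlog vu : v u / v <= u.
  move=> hw av au; have [vu|uv] := leP v u; first exact: hw.
  by rewrite distrC [`|v - u|]distrC; apply: hw => //; exact: ltW.
move=> av au; have v0 : 0 < v by lra.
have u0 : 0 < u by lra.
rewrite distrC [`|v - u|]distrC !ger0_norm ?subr_ge0 ?ler_ln ?posrE //.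
have -> : ln u - ln v = ln (1 + (u - v) / v).
  rewrite -[in RHS](_ : u / v = 1 + (u - v) / v); last by field; rewrite gt_eqF.
  by rewrite lnM ?posrE ?invr_gt0 // lnV ?posrE.
apply: le_trans (le_ln1Dx _) _.
  by apply: lt_le_trans (_ : 0 <= _); [lra|rewrite divr_ge0 ?subr_ge0 // ltW].
by rewrite mulrC ler_wpM2r ?subr_ge0 // lef_pV2 ?posrE.
Qed.

Definition return_map {R : realType} (lambda a v : R) : R := v `^ lambda + a.

(* [Phi v] is the total time advance, relative to the cycle, that an orbit
   entering a square at [(1, v)] gains over all its later crossings. *)
Definition is_phase_sum {R : realType} (lambda a u b : R) (Phi : R -> R) : Prop :=
  [/\ a < u < b /\ b < 1,
      forall v, a <= v <= b -> a <= return_map lambda a v <= b,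
      forall v, a <= v <= b -> iter n (return_map lambda a) v @[n --> \oo] --> u,
      forall v, a <= v <= b ->
        series (fun n => ln (iter n (return_map lambda a) v) - ln u) n
          @[n --> \oo] --> Phi v
    & Phi u = 0 /\ is_derive u 1 Phi (1 / (u - lambda * u `^ lambda))].

Lemma powR_pred {R : realType} (u lambda : R) : 0 < u ->
  u `^ (lambda - 1) * u = u `^ lambda.
Proof.
move=> u0; rewrite -[X in _ * X](powRr1 (ltW u0)) -powRD ?subrK //.
by rewrite (gt_eqF u0) implybT.
Qed.

(** The interval [[a, b]] is invariant since the return map never goes below [a], and on it [ln] is
    Lipschitz with constant [1 / a]. With [m = 1 / r1] and [c = lambda * r1 ^ (lambda - 1)], the
    quotient [m / (1 - c)] is the stated derivative. *)
Lemma phase_sum_exists {R : realType} (lambda a r1 r2 : R) :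
  1 < lambda -> 0 < a -> 0 < r1 -> r1 < r2 -> rho lambda a r1 = 0 ->
  rho lambda a r2 = 0 -> exists b Phi, is_phase_sum lambda a r1 b Phi.
Proof.
move=> l1 a0 r10 r12 h1 h2.
have [b [q [/andP[rb br] q01 fq fb]]] :=
  root_map_contraction _ _ _ _ l1 r10 r12 h1 h2.
have b1 : b < 1 by apply: lt_trans br (root_lt1 _ _ _ l1 a0 (lt_trans r10 r12) h2).
have e1 := (rho_eq0 _ _ _).1 h1.
have ar : a < r1 by rewrite -e1 ltrDr powR_gt0.
pose J : set R := [set v | a <= v <= b].
have fJ v : J v -> J (return_map lambda a v) /\
    `|return_map lambda a v - r1| <= q * `|v - r1|.
  move=> /andP[av vb]; have v0 : 0 < v <= b by rewrite vb (lt_le_trans a0 av).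
  by split; [rewrite /J /= fb // lerDr powR_ge0|exact: fq].
pose c := lambda * r1 `^ (lambda - 1).
have c1 : c < 1 by exact: drho_smallest l1 r10 r12 h1 h2.
have df : is_derive r1 1 (return_map lambda a) c.
  have d1 := is_derive1_powR lambda r10.
  have -> : return_map lambda a = (@powR R)^~ lambda + cst a by apply/funext.
  by apply: is_derive_eq; rewrite addr0.
have dL : is_derive r1 1 (fun v => ln v - ln r1) r1^-1.
  have d1 := is_derive1_ln r10.
  have -> : (fun v => ln v - ln r1) = @ln R - cst (ln r1) by apply/funext.
  by apply: is_derive_eq; rewrite subr0.
have [||||Phi [cPhi Phi0 dPhi]] := cocycle_sum (return_map lambda a)
  (fun v => ln v - ln r1) r1 c r1^-1 q a^-1 J e1 (subrr _) df dL _ q01 _ _ fJ.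
- by rewrite lt_eqF.
- by rewrite /J /= !ltW.
- exists (Order.min (r1 - a) (b - r1)); first by rewrite lt_min !subr_gt0 ar.
  move=> v; rewrite lt_min !ltr_norml /J /= => /andP[/andP[? ?] /andP[? ?]].
  by lra.
- by move=> v /andP[av vb]; apply: ln_lipschitz => //; exact: ltW.
exists b, Phi; split=> //.
- by rewrite ar rb.
- by move=> v /fJ[].
- by move=> v Jv; apply: (iter_contraction_cvg _ _ q J q01 fJ).
- split=> //; suff -> : 1 / (r1 - lambda * r1 `^ lambda) = r1^-1 / (1 - c) by [].
  rewrite -powR_pred // mulrA -/c -[X in X - _]mul1r -mulrBl.
  by rewrite div1r invfM mulrC.
Qed.

Definition start_sg {R : realType} (s0 : R) (n : nat) : R :=
  if n is _.+1 then 1 else s0.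

Definition start_v {R : realType} (lambda a s0 w0 : R) (n : nat) : R :=
  if n is m.+1 then iter m (return_map lambda a) (s0 * w0 `^ lambda + a) else w0.

Section Basin.
Context {R : realType} (lambda a u b : R) (Phi : R -> R).
Hypotheses (l0 : 0 < lambda) (a0 : 0 < a).
Hypothesis hPhi : is_phase_sum lambda a u b Phi.

(** The starting point is constrained through its next entry, which has to fall into the domain
    [[a, b]] of [Phi]. *)
Definition in_basin (s0 w0 : R) : Prop :=
  [/\ `|s0| <= 1, 0 < w0 < 1 & a <= s0 * w0 `^ lambda + a <= b].

Lemma start_v_itv s0 w0 n : in_basin s0 w0 -> a <= start_v lambda a s0 w0 n.+1 <= b.
Proof.
move=> [_ _ vb]; have [_ fJ _ _ _] := hPhi.
by elim: n => [|n IHn] //; rewrite [start_v _ _ _ _ _]iterS; exact: fJ.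
Qed.

Lemma start_coding s0 w0 : in_basin s0 w0 ->
  is_coding lambda a (start_sg s0) (start_v lambda a s0 w0).
Proof.
move=> B; have [s01 w01 vb] := B; have [[_ b1] _ _ _ _] := hPhi.
split=> //.
- case=> // n; have /andP[h1 h2] := start_v_itv _ _ n B.
  by rewrite (lt_le_trans a0 h1) (le_lt_trans h2 b1).
- by case=> //= _; rewrite normr1.
- by case=> //= n; rewrite mul1r.
Qed.

Lemma start_unbounded s0 w0 : in_basin s0 w0 ->
  forall x, exists n, x < entry_time (start_v lambda a s0 w0) n.
Proof.
move=> B; have [[_ b1] _ _ _ _] := hPhi; have [v01 _ _ _] := start_coding _ _ B.
apply: (entry_time_unbounded _ b) => // n.
by have /andP[] := start_v_itv _ _ n B.
Qed.

Lemma basin_trajectory k p s0 w0 : in_basin s0 w0 ->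
  local_coord a k p = (s0, w0) ->
  exists2 xi, is_trajectory lambda a xi & xi 0 = p.
Proof.
move=> B e; have [xi [txi e0]] :=
  trajectory_exists _ _ k _ _ l0 a0 (start_coding _ _ B) (start_unbounded _ _ B).
by exists xi => //; apply: (can_inj (local_coordK a k)); rewrite e0 e.
Qed.

Lemma basin_unique k xi xi' t s0 w0 : in_basin s0 w0 ->
  local_coord a k (xi 0) = (s0, w0) ->
  is_trajectory lambda a xi -> is_trajectory lambda a xi' -> xi 0 = xi' 0 ->
  0 <= t -> xi t = xi' t.
Proof.
move=> B e txi txi' xx t0; have cod := start_coding _ _ B.
apply: (follows_unique lambda a k _ _ _ _ _ cod (start_unbounded _ _ B)) => //.
  exact: trajectory_follows.
by apply: trajectory_follows => //; rewrite -xx.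
Qed.

(** The asymptotic lag of a point of [S_(k+1)] with unstable coordinate [w0]: [k] crossings of the
    cycle, the time it then takes to reach the same unstable coordinate, and the gain over all later
    crossings. *)
Definition phase_time (k : nat) (w0 v1 : R) : R :=
  k%:R * - ln u + (ln w0 - ln u) + Phi v1.

Lemma basin_convergence gamma k xi s0 w0 : in_basin s0 w0 ->
  is_trajectory lambda a gamma -> follows_cycle lambda a u gamma ->
  is_trajectory lambda a xi -> local_coord a k.+1 (xi 0) = (s0, w0) ->
  0 <= phase_time k w0 (s0 * w0 `^ lambda + a) ->
  norm1 (xi t - gamma (t + phase_time k w0 (s0 * w0 `^ lambda + a)))
    @[t --> +oo] --> (0 : R).
Proof.
move=> B tg fg txi e; have cod := start_coding _ _ B.
have [s01 w01 vb] := B; have [[/andP[au ub] b1] _ fu fPhi _] := hPhi.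
set v1 := s0 * _ + a in vb *; move=> c0; have u0 : 0 < u by exact: lt_trans a0 au.
apply: (convergence_to_cycle lambda a u _ k (start_sg s0) (start_v lambda a s0 w0)) => //.
- by rewrite u0; lra.
- exact: trajectory_follows.
- exact: start_unbounded.
- rewrite -(cvg_shiftS (start_v lambda a s0 w0)) /=; exact: fu.
rewrite -(cvg_shiftS (fun n => _ - _)) /=.
(* The index is shifted by one: up to the [(n+1)]-st entry, the crossing from the starting point
   contributes [ln w0 - ln u] and the remaining [n] form a partial sum of the series of [Phi]. *)
rewrite (_ : (fun n => _) = (fun n => k%:R * - ln u + (ln w0 - ln u) +
   series (fun n => ln (iter n (return_map lambda a) v1) - ln u) n)).
  by apply: cvgD; [exact: cvg_cst|exact: fPhi].
apply/funext; elim=> [|n IHn].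
  by rewrite entry_timeS entry_time0 /series /= big_geq // addn1 -natr1; ring.
rewrite addnS -natr1 entry_timeS.
transitivity ((k + n.+1)%:R * - ln u - entry_time (start_v lambda a s0 w0) n.+1 +
  (ln (start_v lambda a s0 w0 n.+1) - ln u)); first by ring.
rewrite IHn /series /= big_nat_recr //= -/v1.
ring.
Qed.

End Basin.

(** * Coordinates, period and itinerary of the cycle *)

Lemma cycle_time {R : realType} (u t : R) : 0 < u < 1 -> 0 <= t ->
  exists n h, t = n%:R * - ln u + h /\ 0 <= h < - ln u.
Proof.
move=> u01 t0; have [n [h [-> hh]]] :=
  entry_time_cover (fun=> u) t (fun=> u01) (cycle_unbounded _ u01) t0.
by exists n, h; rewrite entry_time_cst.
Qed.

Section Cycle.
Context {R : realType} (lambda a u : R) (gamma : R -> R * R).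
Hypotheses (l0 : 0 < lambda) (a0 : 0 < a).
Hypotheses (u01 : 0 < u < 1) (uu : u `^ lambda + a = u).
Hypotheses (tg : is_trajectory lambda a gamma) (fg : follows_cycle lambda a u gamma).
Let L := - ln u.

Let L0 : 0 < L. Proof. by rewrite oppr_gt0 ln_lt0. Qed.
Let u0 : 0 < u. Proof. by case/andP: u01. Qed.
Let u1 : u < 1. Proof. by case/andP: u01. Qed.

Lemma cycle_coord n h : 0 <= h <= L ->
  local_coord a n.+1 (gamma (n%:R * L + h)) =
  (expR (- lambda * h), u * expR h).
Proof. exact: cycle_local. Qed.

(** The last identity expresses that [s * u ^ lambda] is a first integral of the flow in a
    square. *)
Lemma cycle_coord_bounds h : 0 <= h <= L ->
  [/\ u `^ lambda <= expR (- lambda * h) <= 1, u <= u * expR h <= 1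
    & expR (- lambda * h) * (u * expR h) `^ lambda = u `^ lambda].
Proof.
move=> /andP[h0 hL]; split.
- apply/andP; split.
    rewrite -expR_Mln // ler_expR mulNr lerNr -mulrN ler_pM2l //.
  by rewrite -expR0 ler_expR mulNr oppr_le0 mulr_ge0 // ltW.
- apply/andP; split.
    by rewrite ler_peMr // ?(ltW u0) // -expR0 ler_expR.
  by rewrite -[leRHS](expR_Nln u) // ler_pM2l // ler_expR.
- rewrite powRM ?expR_ge0 ?(ltW u0) // -expRM mulrCA -expRD mulNr.
  by rewrite [h * _]mulrC addNr expR0 mulr1.
Qed.

Lemma cycle_region n h : 0 <= h < L -> region a n.+1 (gamma (n%:R * L + h)).
Proof.
move=> /andP[h0 hL]; rewrite /region cycle_coord ?h0 ?(ltW hL) //=.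
have [/andP[_ s1] _ _] := cycle_coord_bounds h ltac:(by rewrite h0 ltW).
rewrite ger0_norm ?expR_ge0 // s1 /= ger0_norm ?mulr_ge0 ?expR_ge0 ?(ltW u0) //.
by rewrite -[ltRHS](expR_Nln u) // ltr_pM2l // ltr_expR.
Qed.

(** Disjointness of the regions recovers the square modulo 4, and the unstable coordinate recovers
    the time since entry. Both the least period and the uniqueness of the asymptotic phase rest on
    this. *)
Lemma cycle_inj n h n' h' : 0 <= h < L -> 0 <= h' < L ->
  gamma (n%:R * L + h) = gamma (n'%:R * L + h') -> n = n' %[mod 4] /\ h = h'.
Proof.
move=> hh hh' e; have r := cycle_region n h hh.
have r' := cycle_region n' h' hh'; rewrite -e in r'.
have nn : n = n' %[mod 4].
  have /eqP := region_inj a _ _ _ a0 r r'.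
  by rewrite -(addn1 n) -(addn1 n') eqn_modDr => /eqP.
split=> //; have /andP[h0 hL] := hh; have /andP[h0' hL'] := hh'.
have := cycle_coord n h ltac:(by rewrite h0 ltW).
rewrite e -local_coord_mod4 -(addn1 n) -modnDml nn modnDml addn1 local_coord_mod4.
rewrite cycle_coord ?h0' ?(ltW hL') // => -[_ /(mulfI (lt0r_neq0 u0)) /expR_inj].
by [].
Qed.

Lemma cycle_periodic : is_period gamma (4 * L).
Proof.
split; first by rewrite mulr_gt0.
move=> t t0; have [n [h [-> /andP[h0 hL]]]] := cycle_time _ _ u01 t0.
have -> : n%:R * - ln u + h + 4 * L = n.+4%:R * L + h.
  by rewrite -addn4 natrD /L; ring.
apply: (can_inj (local_coordK a n.+1)).
have hh : 0 <= h <= L by rewrite h0 ltW.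
by rewrite -[LHS]local_coord4 !cycle_coord.
Qed.

Lemma cycle_least_period T' : is_period gamma T' -> 4 * L <= T'.
Proof.
move=> [T'0 /(_ 0 (lexx _))]; rewrite add0r.
have [n [h [T'E hh]]] := cycle_time _ _ u01 (ltW T'0).
move: T'0; rewrite T'E => T'0.
have -> : 0 = 0%:R * L + 0 by rewrite mul0r addr0.
move=> /(cycle_inj _ _ _ _ hh) []; first by rewrite lexx.
rewrite mod0n => /eqP n4 h0; move: T'0.
have [n0|n0] := posnP n; first by rewrite n0 h0 !mul0r addr0 ltxx.
move=> _; rewrite h0 addr0 -/L ler_pM2r // ler_nat.
by apply: dvdn_leq.
Qed.

Lemma cycle_periodic_mul m t : 0 <= t -> gamma (t + m%:R * (4 * L)) = gamma t.
Proof.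
have [p0 per] := cycle_periodic; move=> t0; elim: m => [|m IHm].
  by rewrite mul0r addr0.
rewrite -natr1 mulrDl mul1r addrA per ?IHm // addr_ge0 // mulr_ge0 //.
exact: ltW.
Qed.

Lemma cycle_itinerary : is_itinerary a gamma (fun n => n%:R * L).
Proof.
split.
- by rewrite mul0r.
- by move=> n; rewrite ltr_pM2r // ltr_nat.
- apply/cvgryPge => A; have [N hN] : exists N : nat, A / L < N%:R.
    by exists (Num.truncn `|A / L|).+1;
      apply: le_lt_trans (ler_norm _) (truncnS_gt _).
  exists N => // n /= Nn; rewrite -ler_pdivrMr //.
  by rewrite (le_trans (ltW hN)) // ler_nat.
- move=> n; exists u => //.
  have := cycle_coord n 0 ltac:(by rewrite lexx ltW).
  by rewrite addr0 mulr0 expR0 mulr1.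
- move=> n t /andP[t1 t2]; apply/squareE.
  have hh : 0 <= t - n%:R * L <= L.
    by move: t2; rewrite -natr1; lra.
  have := cycle_coord n _ hh; rewrite [_ + (t - _)]addrC subrK => ->.
  have [/andP[_ s1] /andP[u2 u3] _] := cycle_coord_bounds _ hh.
  rewrite /= ger0_norm ?expR_ge0 // s1 ger0_norm //.
  exact: le_trans (ltW u0) u2.
Qed.

(** The cycle is seen here from an arbitrary square. With [(x, y)] its coordinates in the square
    that it is crossing, the second coordinate in that square and the following three is [y],
    [x + a], [2 - y + a] and [2 - x]. This separates the cycle from orbits that enter below it. *)
Lemma cycle_unstable_coord_ge j t : 0 <= t -> u <= (local_coord a j (gamma t)).2.
Proof.
move=> t0; have [n [h [-> /andP[h0 hL]]]] := cycle_time _ _ u01 t0.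
have hh : 0 <= h <= L by rewrite h0 ltW.
have [/andP[s1 s2] /andP[u2 u3] _] := cycle_coord_bounds _ hh.
have [i [i4 e]] : exists i, (i < 4)%N /\
    forall p, local_coord a j p = local_coord a (i + n.+1) p.
  (* Modulo 4, the term [3 * n.+1] stands for [- n.+1]. *)
  exists ((j + 3 * n.+1) %% 4)%N; split; first by rewrite ltn_pmod.
  move=> p; rewrite -[RHS]local_coord_mod4 modnDml -addnA.
  rewrite (_ : 3 * n.+1 + n.+1 = n.+1 * 4)%N; last by rewrite -mulSnr mulnC.
  by rewrite local_coord_mod4 local_coordM4.
rewrite e; case: i i4 {e} => [|[|[|[|//]]]] _;
  rewrite -/L ?addSn add0n ?(local_coordS _ n.+3) ?(local_coordS _ n.+2)
    ?(local_coordS _ n.+1) cycle_coord //=.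
- by rewrite -uu lerD2r.
- by move: (ltW u1) a0; lra.
- by move: (ltW u1) a0; lra.
Qed.

End Cycle.

(** * Stability of the cycle *)

Lemma pos_below {R : realType} (s : seq R) : all (fun x => 0 < x) s ->
  exists2 d, 0 < d & all (fun x => d < x) s.
Proof.
elim: s => [|x s IHs] /=; first by exists 1.
move=> /andP[x0 /IHs[d d0 ds]].
exists (Order.min d (x / 2)); first by rewrite lt_min d0 divr_gt0.
apply/andP; split; first by rewrite gt_min; apply/orP; right; lra.
by apply: sub_all ds => y dy; rewrite gt_min dy.
Qed.

(** Here [(sg, w)] is a point of the cycle. The perturbation multiplies [sg] by at most
    [expR (lambda * e)] and [w] by at most [expR e], so [x * y ^ lambda] is at most
    [s * expR (2 * lambda * e)]. *)
Lemma in_basin_inside {R : realType} (lambda a b u s e d sg w x y : R) :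
  0 < lambda -> 0 < u -> 0 < e -> s <= sg -> u <= w -> sg * w `^ lambda = s ->
  d < s -> d < u -> d < s * (expR (lambda * e) - 1) -> d < u * (expR e - 1) ->
  s * expR (2 * lambda * e) < b - a -> `|x - sg| < d -> `|y - w| < d ->
  x <= 1 -> y < 1 -> in_basin lambda a b x y.
Proof.
move=> l0 u0 e0 s1 u2 su d7 d8 d5 d6 se.
rewrite !ltr_norml => /andP[x1 x2] /andP[y1 y2] x1' y1'.
have x0 : 0 < x by lra.
have y0 : 0 < y by lra.
have w0 : 0 <= w by lra.
split; [by rewrite ger0_norm // ltW|by rewrite y0|].
rewrite lerDr mulr_ge0 ?powR_ge0 ?(ltW x0) //=.
have E1 : 1 < expR e by rewrite -expR0 ltr_expR.
have E2 : 1 < expR (lambda * e) by rewrite -expR0 ltr_expR mulr_gt0.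
have xs : x <= sg * expR (lambda * e).
  have : s * (expR (lambda * e) - 1) <= sg * (expR (lambda * e) - 1).
    by rewrite ler_pM2r ?subr_gt0.
  by clear - x2 d5; lra.
have yw : y <= w * expR e.
  have : u * (expR e - 1) <= w * (expR e - 1) by rewrite ler_pM2r ?subr_gt0.
  by clear - y2 d6; lra.
have yl : y `^ lambda <= w `^ lambda * expR (lambda * e).
  rewrite [lambda * e]mulrC expRM -powRM ?expR_ge0 //.
  by rewrite ge0_ler_powR ?nnegrE ?(ltW l0) ?(ltW y0) // mulr_ge0 ?expR_ge0.
have : x * y `^ lambda <= (sg * expR (lambda * e)) * (w `^ lambda * expR (lambda * e)).
  by apply: ler_pM; rewrite ?powR_ge0 // ltW.
rewrite mulrACA su -expRD (_ : lambda * e + lambda * e = 2 * lambda * e); last by ring.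
by clear - se; lra.
Qed.

(** A point with [x > 1] has not reached the entry edge yet; its coordinates in the preceding square
    are [(y - a, 2 - x)], and its next entry is at most [y]. *)
Lemma in_basin_early {R : realType} (lambda a b x y : R) :
  0 < lambda -> 0 < a -> b < 1 -> 1 < x < 2 -> a < y <= b ->
  in_basin lambda a b (y - a) (2 - x).
Proof.
move=> l0 a0 b1 /andP[x1 x2] /andP[y1 y2].
have y0 : 0 < y - a by lra.
split; [by rewrite ger0_norm; lra|by lra|].
rewrite lerDr mulr_ge0 ?powR_ge0 ?(ltW y0) //= -lerBrDr.
apply: le_trans (_ : (y - a) * 1 <= _); last by lra.
by rewrite ler_pM2l // powR_le1 ?(ltW l0) //; lra.
Qed.

(** A point with [y >= 1] is at or past the exit edge; its coordinates in the following square are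
    [(2 - y, x + a)], and its next entry is at most the image of [b]. *)
Lemma in_basin_late {R : realType} (lambda a b x y : R) :
  0 < lambda -> 0 < a -> b < 1 -> return_map lambda a b <= b ->
  0 < x -> x + a <= b -> 1 <= y < 2 -> in_basin lambda a b (2 - y) (x + a).
Proof.
move=> l0 a0 b1 fb x0 xb /andP[y1 y2].
split; [by rewrite ger0_norm; lra|by lra|].
rewrite lerDr mulr_ge0 ?powR_ge0 //=; last by lra.
apply: le_trans fb; rewrite lerD2r.
apply: le_trans (_ : 1 * (x + a) `^ lambda <= _).
  by rewrite ler_wpM2r ?powR_ge0 //; lra.
by rewrite mul1r ge0_ler_powR ?nnegrE ?(ltW l0) //; lra.
Qed.

Section Stability.
Context {R : realType} (lambda a u b : R) (Phi : R -> R) (gamma : R -> R * R).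
Hypotheses (l0 : 0 < lambda) (a0 : 0 < a).
Hypothesis uu : u `^ lambda + a = u.
Hypothesis hPhi : is_phase_sum lambda a u b Phi.
Hypotheses (tg : is_trajectory lambda a gamma) (fg : follows_cycle lambda a u gamma).
Let L := - ln u.

Let u01 : 0 < u < 1.
Proof.
have [[/andP[au ub] b1] _ _ _ _] := hPhi.
by rewrite (lt_trans a0 au) (lt_trans ub b1).
Qed.
Let u0 : 0 < u. Proof. by case/andP: u01. Qed.
Let u1 : u < 1. Proof. by case/andP: u01. Qed.
Let L0 : 0 < L. Proof. by rewrite oppr_gt0 ln_lt0. Qed.

Lemma phase_time_shift k m w0 v1 :
  phase_time u Phi (k + m * 4) w0 v1 = phase_time u Phi k w0 v1 + m%:R * (4 * L).
Proof. by rewrite /phase_time natrD natrM /L; ring. Qed.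

Lemma basin_attracted k xi s0 w0 : in_basin lambda a b s0 w0 ->
  is_trajectory lambda a xi -> local_coord a k.+1 (xi 0) = (s0, w0) ->
  exists2 c, 0 <= c & norm1 (xi t - gamma (t + c)) @[t --> +oo] --> (0 : R).
Proof.
move=> B txi e; pose c := phase_time u Phi k w0 (s0 * w0 `^ lambda + a).
(* Whole turns are added to make the lag nonnegative, since [gamma] is meaningful at nonnegative
   times only. *)
have [m hm] : exists m : nat, - c / (4 * L) < m%:R.
  exists (Num.truncn `|- c / (4 * L)|).+1.
  exact: le_lt_trans (ler_norm _) (truncnS_gt _).
have cm : 0 <= phase_time u Phi (k + m * 4) w0 (s0 * w0 `^ lambda + a).
  rewrite phase_time_shift -/c; move: hm.
  by rewrite ltr_pdivrMr ?mulr_gt0 //; lra.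
exists (phase_time u Phi (k + m * 4) w0 (s0 * w0 `^ lambda + a)) => //.
apply: (basin_convergence _ _ _ _ _ l0 a0 hPhi) => //.
by rewrite -addSn local_coordM4.
Qed.

(* With [e] the time for which the continued cycle may overshoot an edge, [d] is
   chosen so that a [d]-perturbation changes each coordinate by at most the flow
   over a time [e]. *)
Lemma near_cycle_basin : exists2 d, 0 < d &
  forall t p, 0 <= t -> norm1 (p - gamma t) < d ->
  exists k s0 w0, local_coord a k.+1 p = (s0, w0) /\ in_basin lambda a b s0 w0.
Proof.
have [[/andP[au ub] b1] fJ _ _ _] := hPhi.
have [a0' l0' u0' u1'] : [/\ 0 < a, 0 < lambda, 0 < u & u < 1] by [].
have [s sdef] : {s | s = u `^ lambda} by exists (u `^ lambda).
have s0 : 0 < s by rewrite sdef powR_gt0.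
have sE : s = u - a by rewrite sdef -[X in X - a]uu addrK.
have b0 : 0 < b by lra.
have ba : 0 < (b - a) / s by rewrite divr_gt0 //; lra.
(* These bounds say that [u * expR e < b] and [s * expR (2 * lambda * e) < b - a]. *)
have [e e0 /and3P[e1 e2 _]] : exists2 e, 0 < e &
    all (fun x => e < x) [:: ln (b / u); ln ((b - a) / s) / (2 * lambda)].
  apply: pos_below; rewrite /= andbT; apply/andP; split.
    by rewrite ln_gt0 // ltr_pdivlMr // mul1r.
  by rewrite divr_gt0 ?mulr_gt0 // ln_gt0 // ltr_pdivlMr // mul1r; lra.
have ue : u * expR e < b.
  by rewrite -ltr_pdivlMl // mulrC -[ltRHS]lnK ?posrE ?divr_gt0 // ltr_expR.
have se : s * expR (2 * lambda * e) < b - a.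
  rewrite -ltr_pdivlMl // [ltRHS]mulrC -[ltRHS]lnK ?posrE // ltr_expR.
  rewrite [ltLHS]mulrC -ltr_pdivlMr; first exact: e2.
  by rewrite mulr_gt0.
have le0 : 0 < lambda * e by rewrite mulr_gt0.
have E1 : 1 < expR e by rewrite -expR0 ltr_expR.
have E2 : 1 < expR (lambda * e) by rewrite -expR0 ltr_expR.
have E3 : expR (- e) < 1 by rewrite -expR0 ltr_expR; lra.
have E4 : expR (- lambda * e) < 1 by rewrite -expR0 ltr_expR; lra.
have E5 : expR (2 * lambda * e) = expR (lambda * e) * expR (lambda * e).
  by rewrite -expRD; congr expR; ring.
(* The first two bounds show that an edge can be crossed only within time [e] of the entry or exit
   of the cycle; the next two keep the entry coordinate below [b] in the early and late cases; the
   last four serve points inside the square, and [d < s = u - a] also keeps early points above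
   [a]. *)
have [d d0 dall] : exists2 d, 0 < d & all (fun x => d < x)
    [:: 1 - expR (- lambda * e); 1 - expR (- e); b - u * expR e;
        b - a - s * expR (2 * lambda * e); s * (expR (lambda * e) - 1);
        u * (expR e - 1); s; u].
  apply: pos_below; rewrite /= s0 u0 !subr_gt0 E3 E4 ue se /=.
  by rewrite !mulr_gt0 ?subr_gt0.
case/and5P: dall => d1 d2 d3 d4 /and5P[d5 d6 d7 d8 _].
clear E1 E2 E3 E4 E5 e1 e2 ba ue.
exists d => // t p t0; have [n [h [-> /andP[h0 hL]]]] := cycle_time _ _ u01 t0.
have hh : 0 <= h <= L by rewrite h0 ltW.
rewrite -/L -(norm1_local a n.+1) (cycle_coord lambda a u gamma fg) //.
have [/andP[s1 s2] /andP[u2 u3] su] := cycle_coord_bounds lambda u l0 u01 _ hh.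
rewrite -sdef in s1 su.
case e': (local_coord a n.+1 p) => [x y]; rewrite /norm1 /=.
have [sg sgE] : {sg | sg = expR (- lambda * h)} by exists (expR (- lambda * h)).
have [w wE] : {w | w = u * expR h} by exists (u * expR h).
rewrite -sgE -?wE in s1 s2 su u2 u3 *; move=> hd.
have : `|x - sg| < d by apply: le_lt_trans hd; rewrite lerDl.
have : `|y - w| < d by apply: le_lt_trans hd; rewrite lerDr.
rewrite !ltr_norml => /andP[y1 y2] /andP[x1 x2].
have [x1'|x1'] := ltP 1 x.
- have eh : h < e.
    have : expR (- lambda * e) < expR (- lambda * h) by rewrite -sgE; lra.
    by rewrite ltr_expR !mulNr ltrN2 ltr_pM2l.
  have wh : w <= u * expR e by rewrite wE ler_pM2l // ler_expR ltW.
  exists (n + 3)%N, (y - a), (2 - x).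
  have e'' : local_coord a (n + 4) p = (y - a, 2 - x).
    have := local_coord4 a n.+1 p.
    rewrite e' (_ : n.+1.+4 = (n + 4).+1)%N; last by rewrite addn4.
    rewrite local_coordS.
    by case: (local_coord a (n + 4) p) => x' y' [<- <-] /=; congr pair; ring.
  split; first by rewrite -addnS.
  apply: in_basin_early => //.
  + by lra.
  + by lra.
- have [y1'|y1'] := ltP y 1.
    exists n, x, y; split=> //.
    by apply: (in_basin_inside _ _ _ u s e d sg w) => //; rewrite ltr_norml; apply/andP.
  have eh : L - h < e.
    have : expR (- e) < expR (h - L).
      rewrite expRD opprK lnK ?posrE // mulrC -wE; lra.
    by rewrite ltr_expR; lra.
  have sh : sg <= s * expR (lambda * e).
    rewrite sgE sdef -expR_Mln // -expRD ler_expR.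
    have : lambda * (L - h) <= lambda * e by rewrite ler_pM2l // ltW.
    by rewrite /L; lra.
  have sE6 : s * expR (lambda * e) <= s * expR (2 * lambda * e).
    by rewrite ler_pM2l // ler_expR; lra.
  exists n.+1, (2 - y), (x + a); rewrite local_coordS e'; split=> //.
  apply: in_basin_late => //.
  + by have /andP[] := fJ b ltac:(by rewrite lexx andbT ltW ?(lt_trans au ub)).
  + by lra.
  + by lra.
  + by lra.
Qed.

Lemma cycle_stable : is_stable lambda a gamma.
Proof.
have [d d0 Hd] := near_cycle_basin; exists d => // xi txi [t t0 ht] e e0.
have [k [s0 [w0 [e1 B]]]] := Hd t _ t0 ht.
have [c c0 /cvgrPdist_lt /(_ e e0) H] := basin_attracted _ _ _ _ B txi e1.
near=> t'; exists (t' + c).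
  by rewrite addr_ge0 //; near: t'; exact: nbhs_pinfty_ge.
have : `|0 - norm1 (xi t' - gamma (t' + c))| < e by near: t'.
by rewrite sub0r normrN ger0_norm ?norm1_ge0.
Unshelve. all: by end_near. Qed.

(** Isolation follows from stability: a periodic orbit that stays near is attracted, but its
    distance to the cycle from a given point recurs every period, hence is 0. The distance is
    attained because one period of the cycle is compact. *)
Lemma cycle_isolated : is_isolated lambda a gamma.
Proof.
have [d d0 Hd] := cycle_stable; exists d => // xi T' txi [T'0 per] near t t0.
pose g x := norm1 (xi t - gamma x).
have cg : continuous_ge0 g.
  have [/within_continuous_ge02[c1 c2] _] := tg.
  apply/continuous_ge0P => x x0; rewrite /g /norm1 /=.
  apply: cvgD; apply: cvg_norm; apply: cvgB; try exact: cvg_cst.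
    by move/continuous_ge0P: c1; apply.
  by move/continuous_ge0P: c2; apply.
have wg : {within `[0, 4 * L], continuous g}.
  apply/subspace_continuousP => x; rewrite /= in_itv /= => /andP[x0 _].
  move/continuous_ge0P: cg => /(_ x x0); apply: cvg_trans; apply: cvg_app.
  by apply: within_subset; move=> y; rewrite /= in_itv /= => /andP[].
have [x xI xmin] := EVT_min (mulr_ge0 (ler0n _ 4) (ltW L0)) wg.
move: xI; rewrite in_itv /= => /andP[x0 _]; exists x => //.
have xmin' y : 0 <= y -> g x <= g y.
  move=> y0; have [n [h [yE /andP[h0 hL]]]] := cycle_time _ _ u01 y0.
  have -> : g y = g ((n %% 4)%:R * L + h).
    rewrite /g yE {1}(divn_eq n 4) natrD natrM.
    rewrite (_ : _ + h = (n %% 4)%:R * L + h + (n %/ 4)%:R * (4 * L)); last first.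
      by rewrite /L; ring.
    by rewrite (cycle_periodic_mul _ _ _ _ u01 fg) // addr_ge0 // mulr_ge0 // ltW.
  apply: xmin; rewrite in_itv /=; apply/andP; split.
    by rewrite addr_ge0 // mulr_ge0 // ltW.
  have : (n %% 4)%:R * L <= 3 * L.
    by rewrite ler_pM2r // (ler_nat _ _ 3) -ltnS ltn_pmod.
  by rewrite -/L in hL; lra.
have g0 : norm1 (xi t - gamma x) <= 0.
  apply/ler_addgt0Pr => e e0; rewrite add0r.
  have [A [_ HA]] := Hd xi txi (near 0 (lexx _)) e e0.
  have [n hn] : exists n : nat, (A - t) / T' < n%:R.
    exists (Num.truncn `|(A - t) / T'|).+1.
    exact: le_lt_trans (ler_norm _) (truncnS_gt _).
  have pern m : xi (t + m%:R * T') = xi t.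
    elim: m => [|m IHm]; first by rewrite mul0r addr0.
    by rewrite -natr1 mulrDl mul1r addrA per // addr_ge0 // mulr_ge0 // ltW.
  have [y y0 hy] := HA (t + n%:R * T') ltac:(by move: hn; rewrite ltr_pdivrMr //; lra).
  by rewrite (le_trans (xmin' y y0)) // ltW // /g -(pern n).
have := norm1_fst (xi t - gamma x); have := norm1_snd (xi t - gamma x).
move=> h2 h1; have := le_trans h2 g0; have := le_trans h1 g0.
rewrite !normr_le0 !subr_eq0 => /eqP e1 /eqP e2.
by rewrite [LHS]surjective_pairing [RHS]surjective_pairing e1 e2.
Qed.

Lemma cycle_is_stable_limit_cycle : is_stable_limit_cycle lambda a gamma (4 * L).
Proof.
split; last exact: cycle_stable.
split=> //.
- exact: (cycle_periodic lambda a).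
- by move=> T'; apply: (cycle_least_period lambda a).
- by exists (fun n => n%:R * L); apply: (cycle_itinerary lambda a).
- exact: cycle_isolated.
Qed.

End Stability.

(** * Structure of limit cycles *)

Lemma iris_field_exit_edge {R : realType} (lambda a : R) k p s : 0 < a ->
  local_coord a k p = (s, 1) -> `|s| <= 1 -> ~~ region a k.+1 p ->
  iris_field lambda a p = (0, 0).
Proof.
move=> a0 e s1 r1; apply: iris_field_out => j; apply/negP => rj.
have [i [i4 E]] : exists i, (i < 4)%N /\
    forall p, local_coord a j p = local_coord a (i + k) p.
  exists ((j + 3 * k) %% 4)%N; split; first by rewrite ltn_pmod.
  move=> q; rewrite -[RHS]local_coord_mod4 modnDml -addnA.
  rewrite (_ : 3 * k + k = k * 4)%N; last by rewrite -mulSnr mulnC.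
  by rewrite local_coord_mod4 local_coordM4.
move: s1 rj r1; rewrite /region E ler_norml => /andP[s1 s2].
case: i i4 {E} => [|[|[|[|//]]]] _; rewrite ?addSn add0n ?local_coordS e /=.
- by rewrite normr1 ltxx andbF.
- by move=> ->.
- by move=> /andP[_]; rewrite ltr_norml => /andP[? ?]; lra.
- by move=> /andP[_]; rewrite ltr_norml => /andP[? ?]; lra.
Qed.

(** The flow determines the orbit up to the exit edge, reached at [t1]; the point is to exclude
    [t1 < t2]. In that case the orbit, confined to the closed square, would stay on the exit edge.
    It could not be in the next region, whose field leaves the edge, so the field would vanish and
    the orbit would rest; but its position at [t2] is in the next region. *)
Lemma itinerary_step {R : realType} (lambda a : R) k xi t0 t2 w w' :
  0 < lambda -> 0 < a -> is_trajectory lambda a xi -> 0 <= t0 < t2 ->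
  local_coord a k (xi t0) = (1, w) -> 0 < w < 1 ->
  local_coord a k.+1 (xi t2) = (1, w') -> 0 < w' < 1 ->
  (forall t, t0 <= t <= t2 -> square a k (xi t)) ->
  t2 = t0 - ln w /\ w' = w `^ lambda + a.
Proof.
move=> l0 a0 txi /andP[t00 t02] e0 w01 e2 /andP[w'0 w'1] sq.
have /andP[w0 w1] := w01; have lw := ln_lt0 w01.
have flow h := local_flow lambda a k xi t0 1 w l0 a0 txi t00 e0
  ltac:(by rewrite normr1) w01 h.
set t1 := t0 - ln w.
have e1 : local_coord a k (xi t1) = (w `^ lambda, 1).
  have := flow (- ln w) ltac:(by rewrite lexx andbT; lra).
  by move=> /(local_coord_exit lambda _ _ _ _ _ w0)[]; rewrite mul1r.
have e2' : local_coord a k (xi t2) = (w' - a, 1).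
  move: e2; rewrite local_coordS; case: (local_coord a k (xi t2)) => x y [] /= h1 h2.
  by congr pair; lra.
have t12 : t1 <= t2.
  rewrite leNgt; apply/negP => t21.
  have := flow (t2 - t0); rewrite [t0 + _]addrC subrK.
  move=> /(_ ltac:(rewrite /t1 in t21; lra)).
  rewrite e2' => -[_ /esym /eqP]; rewrite lt_eqF //.
  by rewrite -[ltRHS](expR_Nln w) // ltr_pM2l // ltr_expR; move: t21; rewrite /t1; lra.
have t10 : 0 <= t1 by rewrite /t1; lra.
have wl := powR_gt0 lambda w0.
suff t21 : t1 = t2.
  by split=> //; move: e2'; rewrite -t21 e1 => -[]; lra.
apply/eqP; rewrite eq_le t12 leNgt; apply/negP => {}t12.
pose S t := (local_coord a k (xi t)).1; pose U t := (local_coord a k (xi t)).2.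
have [cS cU] : continuous_ge0 S /\ continuous_ge0 U := local_continuous _ _ k _ txi.
have bd t : t1 <= t <= t2 -> `|S t| <= 1 /\ `|U t| <= 1.
  by move=> tt; apply/squareE/sq; rewrite /t1 in tt; lra.
have dnext t : t1 <= t <= t2 -> region a k.+1 (xi t) ->
    has_rderiv U t (lambda * (2 - U t)).
  move=> tt rt; have [dn _] := trajectory_rderiv _ _ _ _ t a0 txi ltac:(lra) rt.
  have := has_rderivBl _ _ _ 2 dn; rewrite local_coordS mulNr opprK.
  by apply: eq_has_rderiv => x; rewrite local_coordS /U /=; ring.
have dout t : t1 <= t <= t2 -> U t = 1 -> ~~ region a k.+1 (xi t) ->
    has_rderiv S t 0 /\ has_rderiv U t 0.
  move=> tt Ut rt; have tt0 : 0 <= t by lra.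
  have f0 : iris_field lambda a (xi t) = (0, 0).
    apply: (iris_field_exit_edge _ _ k _ (S t)) => //; last by case: (bd t tt).
    by rewrite [LHS]surjective_pairing -/(U t) Ut.
  have [_ /(_ t tt0)] := txi; rewrite f0 => d0.
  have /(local_rderiv a k) : has_rderiv2 xi t (0, 0) by [].
  rewrite (_ : iter _ _ _ = (0, 0)) //.
  by elim: (k + 3)%N => // m IHm; rewrite iterS IHm /rotccw /= oppr0.
(* The right derivative of [U] is [lambda * (2 - U)] in the next region, 0 where the orbit is
   absorbed and [U] before the edge. The last is nonnegative only for positive [U], whence the
   threshold 0. *)
have U1 t : t1 <= t <= t2 -> U t = 1.
  move=> /andP[tt1 tt2]; have U10 : U t1 = 1 by rewrite /U e1.
  apply/eqP; rewrite eq_le; apply/andP; split.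
    by have [_] := bd t ltac:(lra); rewrite ler_norml => /andP[].
  rewrite -U10; apply: (rderiv_ge0 U 0) => //; [lra|by rewrite U10|].
  move=> x /andP[x1 x2] Ux; have xx : t1 <= x <= t2 by lra.
  have [bS] := bd x xx; rewrite ler_norml => /andP[_ Ux1].
  have [rn|rn] := boolP (region a k.+1 (xi x)).
    exists (lambda * (2 - U x)); last exact: dnext.
    by rewrite mulr_ge0 //; lra.
  have [Ux1'|Ux1'] := eqVneq (U x) 1.
    by exists 0 => //; case: (dout x xx Ux1' rn).
  exists (U x); first exact: ltW.
  have rx : region a k (xi x).
    by rewrite /region bS /= -/(U x) gtr0_norm // lt_neqAle Ux1'.
  by have [] := trajectory_rderiv _ _ _ _ x a0 txi ltac:(lra) rx.
(* On the edge the next region would give [U] the right derivative [lambda], against its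
   constancy. *)
have nr t : t1 <= t < t2 -> ~~ region a k.+1 (xi t).
  move=> /andP[tt1 tt2]; apply/negP => rt.
  have := dnext t ltac:(lra) rt; rewrite U1; last by lra.
  have l20 : 0 < lambda / 2 by lra.
  move=> /has_rderivP /(_ _ l20)[d d0 Hd].
  pose h := Order.min (d / 2) (t2 - t).
  have h0 : 0 < h by rewrite lt_min; lra.
  have hd : h <= d / 2 by rewrite ge_min lexx.
  have ht : h <= t2 - t by rewrite ge_min lexx orbT.
  have := Hd h ltac:(lra); rewrite !U1; [|lra|lra].
  rewrite subrr sub0r normrN gtr0_norm; last by rewrite !mulr_gt0 //; lra.
  by have := mulr_gt0 l0 h0; lra.
have := nr t1 ltac:(lra); rewrite /region local_coordS e1 /=.
have : S t2 = S t1.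
  apply: rderiv0_const => //; first by lra.
  move=> t tt; have [] := dout t ltac:(lra) (U1 t ltac:(lra)) (nr t tt).
  by [].
rewrite /S e1 e2' /= => e3.
have -> : (2 - 1 : R) = 1 by lra.
by rewrite normr1 lexx /= -e3 subrK gtr0_norm // w'1.
Qed.

Lemma itinerary_coding {R : realType} (lambda a : R) gamma tau :
  0 < lambda -> 0 < a -> is_trajectory lambda a gamma ->
  is_itinerary a gamma tau ->
  exists v, [/\ is_coding lambda a (fun=> 1) v, tau =1 entry_time v,
    follows lambda a 1 (fun=> 1) v gamma,
    forall x, exists n, x < entry_time v n &
    forall n, local_coord a n.+1 (gamma (tau n)) = (1, v n)].
Proof.
move=> l0 a0 tg [tau0 tauS tauoo entry sq].
pose v n := (local_coord a n.+1 (gamma (tau n))).2.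
have vP n : 0 < v n < 1 /\ local_coord a n.+1 (gamma (tau n)) = (1, v n).
  by have [w w01 e] := entry n; rewrite /v e.
have tau_ge0 n : 0 <= tau n.
  elim: n => [|n IHn]; first by rewrite tau0.
  exact: le_trans IHn (ltW (tauS n)).
have step n : tau n.+1 = tau n - ln (v n) /\ v n.+1 = v n `^ lambda + a.
  have [v01 e1] := vP n; have [v01' e2] := vP n.+1.
  apply: (itinerary_step _ _ _ _ _ _ _ _ l0 a0 tg _ e1 v01 e2 v01').
    by rewrite tau_ge0 tauS.
  exact: sq.
have cod : is_coding lambda a (fun=> 1) v.
  split=> // n; [by case: (vP n)|by rewrite normr1|].
  by rewrite mul1r; case: (step n).
have tauE : tau =1 entry_time v.
  elim=> [|n IHn]; first by rewrite tau0 entry_time0.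
  by rewrite entry_timeS -IHn; case: (step n).
exists v; split=> //.
- apply: trajectory_follows => //.
  by rewrite -tau0; case: (vP 0%N).
- move=> x; have /cvgryPgt /(_ x) [N _ HN] := tauoo.
  by exists N; rewrite -tauE; apply: HN => /=.
- by move=> n; case: (vP n).
Qed.

Lemma follows_region {R : realType} (lambda a : R) k sg v xi n h :
  0 < lambda -> is_coding lambda a sg v -> follows lambda a k sg v xi ->
  0 <= h < - ln (v n) -> region a (k + n) (xi (entry_time v n + h)).
Proof.
move=> l0 [v01 sg1 _ _] fxi /andP[h0 hv].
have /andP[v0 v1] := v01 n.
rewrite /region fxi; last by rewrite h0 ltW.
apply/andP; split.
  rewrite normrM (ger0_norm (expR_ge0 _)) -[leRHS](mulr1 1).
  rewrite ler_pM // ?expR_ge0 // -expR0 ler_expR.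
  by rewrite mulNr oppr_le0 mulr_ge0 // ltW.
rewrite gtr0_norm ?mulr_gt0 ?expR_gt0 // -[ltRHS](expR_Nln (v n)) //.
by rewrite ltr_pM2l // ltr_expR.
Qed.

(* The return map is increasing, so its orbits are monotone and a periodic one is
   constant: a periodic orbit of the flow closes up after one turn. *)
Lemma limit_cycle_structure {R : realType} (lambda a : R) gamma T :
  0 < lambda -> 0 < a -> is_limit_cycle lambda a gamma T ->
  exists w, [/\ 0 < w < 1, w `^ lambda + a = w,
    follows_cycle lambda a w gamma & T = 4 * - ln w].
Proof.
move=> l0 a0 [tg [T0 per] least [tau itin] _].
have [v [cod tauE fv unb _]] := itinerary_coding _ _ _ _ l0 a0 tg itin.
have [v01 _ _ vS] := cod.
have [n [h [TE hh]]] := entry_time_cover v T v01 unb (ltW T0).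
have gT := per 0 (lexx _); rewrite add0r in gT.
have r := follows_region _ _ _ _ _ _ n h l0 cod fv hh; rewrite -TE gT in r.
have e0 : local_coord a 1 (gamma 0) = (1, v 0%N).
  by have := follows_entry _ _ _ _ _ _ 0%N cod fv; rewrite entry_time0.
have r0 : region a 1 (gamma 0).
  rewrite /region e0 normr1 lexx /=; have /andP[v0 v1] := v01 0%N.
  by rewrite gtr0_norm.
have n4 := region_inj a _ _ _ a0 r r0.
(* The stable coordinate of the starting point is 1, and [expR (- lambda * h) = 1] forces [h = 0]:
   the period ends at an entry. *)
have := fv n h; rewrite -TE gT -local_coord_mod4 n4 local_coord_mod4 e0.
have /andP[h0 hL] := hh; rewrite h0 ltW // => /(_ isT)[].
rewrite mul1r => /esym; rewrite -[X in _ = X -> _](@expR0 R) => /expR_inj /eqP.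
rewrite mulf_eq0 oppr_eq0 gt_eqF //= => /eqP hE.
rewrite hE expR0 mulr1 => v0n.
have n0 : (0 < n)%N.
  by rewrite lt0n; apply/eqP => nE; move: T0; rewrite TE nE entry_time0 hE addr0 ltxx.
have vpos j : v j \in Num.nneg.
  by have /andP[vj _] := v01 j; rewrite nnegrE ltW.
have v10 : v 1%N = v 0%N.
  apply/eqP; rewrite eq_le; apply/andP; split; rewrite leNgt; apply/negP => lt01.
    have mono j : v j < v j.+1.
      elim: j => // j IHj; rewrite (vS j) (vS j.+1) !mul1r ltrD2r.
      by rewrite gt0_ltr_powR.
    have : v 0%N < v n.
      case: n n0 {TE hh r n4 hL v0n} => // j _; elim: j => // j IHj.
      exact: lt_trans IHj (mono _).
    by rewrite -v0n ltxx.
  have mono j : v j.+1 < v j.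
    elim: j => // j IHj; rewrite (vS j) (vS j.+1) !mul1r ltrD2r.
    by rewrite gt0_ltr_powR.
  have : v n < v 0%N.
    case: n n0 {TE hh r n4 hL v0n} => // j _; elim: j => // j IHj.
    exact: lt_trans (mono _) IHj.
  by rewrite -v0n ltxx.
have w01 := v01 0%N.
have ww : v 0%N `^ lambda + a = v 0%N by rewrite -{2}v10 vS mul1r.
have fw : follows_cycle lambda a (v 0%N) gamma.
  apply: trajectory_follows => //; exact: cycle_coding.
exists (v 0%N); split=> //; apply/eqP; rewrite eq_le least /=.
  by apply: (cycle_least_period lambda a _ gamma).
exact: (cycle_periodic lambda a).
Qed.

(** Between the roots the return map lies below the diagonal, so an orbit that enters at [w - e]
    enters at or below [w - e] forever. The cycle through [w] has unstable coordinate at least [w]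
    in every square, so at each entry the distance is at least [e]. *)
Lemma larger_root_unstable {R : realType} (lambda a u w : R) gamma :
  1 < lambda -> 0 < a -> 0 < u -> u < w -> rho lambda a u = 0 ->
  rho lambda a w = 0 -> is_trajectory lambda a gamma ->
  follows_cycle lambda a w gamma -> ~ is_stable lambda a gamma.
Proof.
move=> l1 a0 u0 uw hu hw tg fg [d d0 Hd].
have l0 : 0 < lambda by lra.
have w1 := root_lt1 _ _ _ l1 a0 (lt_trans u0 uw) hw.
have w01 : 0 < w < 1 by lra.
have uu := (rho_eq0 _ _ _).1 hu; have ww := (rho_eq0 _ _ _).1 hw.
pose e := Order.min d (w - u) / 2.
have m0 : 0 < Order.min d (w - u) by rewrite lt_min d0; lra.
have m1 : Order.min d (w - u) <= d by rewrite ge_min lexx.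
have m2 : Order.min d (w - u) <= w - u by rewrite ge_min lexx orbT.
have mlt v : u <= v <= w - e -> u <= return_map lambda a v <= w - e.
  move=> /andP[h1 h2]; apply/andP; split.
    by rewrite -[leLHS]uu lerD2r ge0_ler_powR ?nnegrE; lra.
  apply: le_trans (h2); move: h1; rewrite le_eqVlt => /orP[/eqP <-|h1].
    by rewrite /return_map uu.
  have vw : v < w by rewrite /e in h2; lra.
  have : rho lambda a v < 0.
    by apply: (rho_neg_between _ _ u w) => //; rewrite h1.
  by rewrite /rho /return_map; lra.
pose v n := iter n (return_map lambda a) (w - e).
have vb n : u <= v n <= w - e.
  elim: n => [|n IHn]; first by rewrite /v /= /e lexx andbT; lra.
  by rewrite /v iterS; exact: mlt.
have e0 : 0 < e by rewrite /e; lra.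
have cod : is_coding lambda a (fun=> 1) v.
  split=> // n; [by have := vb n; lra|by rewrite normr1|].
  by rewrite mul1r /v iterS.
have [v01 _ _ _] := cod.
have unb := entry_time_unbounded v w v01 w1 ltac:(by move=> n; have := vb n.+1; lra).
have [xi [txi e1]] := trajectory_exists _ _ 1 _ _ l0 a0 cod unb.
have fxi := trajectory_follows _ _ _ _ _ _ l0 a0 cod txi e1.
have near0 : near_orbit gamma d (xi 0).
  exists 0 => //; rewrite -(norm1_local a 1) e1.
  have := follows_entry _ _ _ _ _ _ 0%N (cycle_coding _ _ _ w01 ww) fg.
  rewrite entry_time0 => ->; rewrite /norm1 /= subrr normr0 add0r.
  by rewrite addrAC subrr sub0r normrN gtr0_norm // /e; lra.
have [A [_ HA]] := Hd xi txi near0 e e0.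
have [n An] := unb A; have [t t0] := HA _ An.
rewrite -(norm1_local a n.+1).
have := follows_entry _ _ _ _ _ _ n cod fxi; rewrite add1n => -> h.
have := le_lt_trans (norm1_snd _) h.
have := cycle_unstable_coord_ge lambda a w gamma l0 a0 w01 ww fg n.+1 t t0.
have := vb n; rewrite ltr_norml /=.
by case: (local_coord a n.+1 (gamma t)) => x y /=; lra.
Qed.

(** * Phase response *)

Section Phase.
Context {R : realType} (lambda a u b : R) (Phi : R -> R) (gamma : R -> R * R).
Hypotheses (l0 : 0 < lambda) (a0 : 0 < a).
Hypothesis uu : u `^ lambda + a = u.
Hypothesis ul : 0 < u - lambda * u `^ lambda.
Hypothesis hPhi : is_phase_sum lambda a u b Phi.
Hypotheses (tg : is_trajectory lambda a gamma) (fg : follows_cycle lambda a u gamma).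
Let L := - ln u.

Let u01 : 0 < u < 1.
Proof.
have [[/andP[au ub] b1] _ _ _ _] := hPhi.
by rewrite (lt_trans a0 au) (lt_trans ub b1).
Qed.
Let u0 : 0 < u. Proof. by case/andP: u01. Qed.
Let L0 : 0 < L. Proof. by rewrite oppr_gt0 ln_lt0. Qed.

(** At multiples of the period the distance takes its initial value, which must therefore be the
    limit 0. *)
Lemma cycle_asymptotic_eq c1 c2 : 0 <= c1 -> 0 <= c2 ->
  norm1 (gamma (t + c1) - gamma (t + c2)) @[t --> +oo] --> (0 : R) ->
  gamma c1 = gamma c2.
Proof.
move=> c10 c20 H.
have g0 : norm1 (gamma c1 - gamma c2) <= 0.
  apply/ler_addgt0Pr => e e0; rewrite add0r.
  have /cvgrPdist_le /(_ e e0) [A [_ HA]] := H.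
  have [n hn] : exists n : nat, A / (4 * L) < n%:R.
    exists (Num.truncn `|A / (4 * L)|).+1.
    exact: le_lt_trans (ler_norm _) (truncnS_gt _).
  have := HA (n%:R * (4 * L)) ltac:(by rewrite -ltr_pdivrMr ?mulr_gt0).
  rewrite /= sub0r normrN ![n%:R * _ + _]addrC.
  rewrite !(cycle_periodic_mul _ _ _ _ u01 fg) //.
  by rewrite ger0_norm ?norm1_ge0.
have := norm1_fst (gamma c1 - gamma c2); have := norm1_snd (gamma c1 - gamma c2).
move=> h2 h1; have := le_trans h2 g0; have := le_trans h1 g0.
rewrite !normr_le0 !subr_eq0 => /eqP e1 /eqP e2.
by rewrite [LHS]surjective_pairing [RHS]surjective_pairing e1 e2.
Qed.

(** Forward uniqueness from [p] makes both trajectories coincide, and [gamma] is injective on one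
    period. This is what gives the choice in [asymptotic_phase] a definite value. *)
Lemma asymptotic_phase_unique k p s0 w0 phi1 phi2 :
  local_coord a k p = (s0, w0) -> in_basin lambda a b s0 w0 ->
  is_asymptotic_phase lambda a gamma (4 * L) p phi1 ->
  is_asymptotic_phase lambda a gamma (4 * L) p phi2 -> phi1 = phi2.
Proof.
move=> e B [/andP[p10 p14] [xi1 [t1 x1 c1]]] [/andP[p20 p24] [xi2 [t2 x2 c2]]].
have E phi : phi * (4 * L) / 4 = phi * L by field.
rewrite !E in c1 c2.
have : gamma (phi1 * L) = gamma (phi2 * L).
  have q1 : 0 <= phi1 * L by rewrite mulr_ge0 // ltW.
  have q2 : 0 <= phi2 * L by rewrite mulr_ge0 // ltW.
  apply: cycle_asymptotic_eq => //.
  have cD := cvgD c1 c2; rewrite addr0 in cD.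
  have {}cD := cD _.
  apply: (@squeeze_cvgr _ _ _ R (fun=> 0) (fun t => norm1 (xi1 t - gamma (t + phi1 * L))
    + norm1 (xi2 t - gamma (t + phi2 * L))) _ _ 0); last 2 first.
  - exact: cvg_cst.
  - exact: cD.
  near=> t; have t0 : 0 <= t by near: t; exact: nbhs_pinfty_ge.
  rewrite norm1_ge0 /=.
  apply: le_trans (norm1_triangle (xi1 t) _ _) _.
  rewrite norm1B {2}(basin_unique lambda a u b Phi l0 a0 hPhi k xi1 xi2 t s0 w0) //.
    by rewrite x1.
  by rewrite x1 x2.
have [n1 [h1 [e1 hh1]]] := cycle_time u (phi1 * L) u01 (mulr_ge0 p10 (ltW L0)).
have [n2 [h2 [e2 hh2]]] := cycle_time u (phi2 * L) u01 (mulr_ge0 p20 (ltW L0)).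
have small n h phi : phi < 4 -> phi * L = n%:R * - ln u + h -> 0 <= h < - ln u ->
    (n < 4)%N.
  move=> p4 eh /andP[h0 _]; rewrite -(ltr_nat R) -(ltr_pM2r L0).
  have : phi * L < 4 * L by rewrite ltr_pM2r.
  by rewrite eh -/L; lra.
rewrite e1 e2 => /(cycle_inj lambda a u gamma l0 a0 u01 fg n1 h1 n2 h2 hh1 hh2)[].
rewrite !modn_small; [|exact: small p24 e2 hh2|exact: small p14 e1 hh1].
by move=> nn hh; apply: (mulIf (lt0r_neq0 L0)); rewrite e1 e2 nn hh.
Unshelve. all: by end_near. Qed.

Lemma asymptotic_phaseE k p s0 w0 :
  local_coord a k.+1 p = (s0, w0) -> in_basin lambda a b s0 w0 ->
  let phi := phase_time u Phi k w0 (s0 * w0 `^ lambda + a) / L in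
  0 <= phi < 4 -> is_asymptotic_phase lambda a gamma (4 * L) p phi /\
  asymptotic_phase lambda a gamma (4 * L) p = phi.
Proof.
move=> e B phi p4.
have phiP : is_asymptotic_phase lambda a gamma (4 * L) p phi.
  split=> //; have [xi txi x0] := basin_trajectory _ _ _ _ _ l0 a0 hPhi _ _ _ _ B e.
  exists xi; split=> //.
  have -> : phi * (4 * L) / 4 = phase_time u Phi k w0 (s0 * w0 `^ lambda + a).
    by rewrite /phi; field; rewrite gt_eqF.
  apply: (basin_convergence _ _ _ _ _ l0 a0 hPhi) => //; first by rewrite x0.
  by case/andP: p4 => + _; rewrite ler_pdivlMr // mul0r.
split=> //; apply: (asymptotic_phase_unique _ _ _ _ _ _ e B) => //.
by rewrite /asymptotic_phase; apply: (xgetPex 0); exists phi.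
Qed.

Lemma wrap4_small (x : R) : -2 <= x < 2 -> wrap4 x = x.
Proof.
move=> xx; rewrite /wrap4 (_ : Num.floor _ = 0) ?mulr0 ?subr0 //.
by apply: floor_def; rewrite add0r; lra.
Qed.

Lemma rotccw_scale k e (q : R * R) :
  iter k (@rotccw R) (e * q.1, e * q.2) =
  (e * (iter k (@rotccw R) q).1, e * (iter k (@rotccw R) q).2).
Proof. by elim: k => // k IHk; rewrite !iterS IHk /rotccw /= mulrN. Qed.

(** [G] is the phase within the square of the perturbed point. As [w = u ^ (1 - phi)] and
    [sg * w ^ lambda = s], the unstable part of the derivative is [1 / w + lambda * s / (w * (u -
    lambda * s))], which collapses to [(u / w) / (u - lambda * s)]. *)
Lemma Zresp_derive phi (et : R * R) : 0 < phi < 1 ->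
  let sg := expR (- lambda * (phi * L)) in let w := u * expR (phi * L) in
  let G e := (ln (w + e * et.2) - ln u +
    Phi ((sg + e * et.1) * (w + e * et.2) `^ lambda + a)) / L in
  G 0 = phi /\ is_derive (0 : R) 1 G (Zresp lambda u et phi).
Proof.
move=> /andP[phi0 phi1] sg w G.
have w0 : 0 < w by rewrite mulr_gt0 ?expR_gt0.
have sw : sg * w `^ lambda + a = u.
  have hh : 0 <= phi * L <= L.
    by rewrite mulr_ge0 ?(ltW L0) ?(ltW phi0) //= ger_pMl // ltW.
  by have [_ _ ->] := cycle_coord_bounds lambda u l0 u01 _ hh.
have [_ _ _ _ [Phi0 dPhi]] := hPhi.
have lnw : ln w - ln u = phi * L.
  by rewrite lnM ?posrE ?expR_gt0 // expRK addrAC subrr add0r.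
split.
  rewrite /G !mul0r !addr0 sw Phi0 addr0 lnw mulfK // gt_eqF //.
pose S (e : R) := sg + e * et.1; pose W (e : R) := w + e * et.2.
have dlin (c d : R) : is_derive (0 : R) 1 (fun e => c + e * d) d.
  have -> : (fun e => c + e * d) = cst c + d \*: id.
    by apply/funext => e; rewrite /= /GRing.scale /= mulrC.
  by apply: is_derive_eq; rewrite add0r /GRing.scale /= mulr1.
have dS : is_derive (0 : R) 1 S et.1 by exact: dlin.
have dW : is_derive (0 : R) 1 W et.2 by exact: dlin.
have W0 : W 0 = w by rewrite /W mul0r addr0.
have S0 : S 0 = sg by rewrite /S mul0r addr0.
have dlnW : is_derive (0 : R) 1 (@ln R \o W) (w^-1 * et.2).
  by apply: is_derive1_comp; rewrite W0; exact: is_derive1_ln.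
have dpW : is_derive (0 : R) 1 ((@powR R)^~ lambda \o W)
    (lambda * w `^ (lambda - 1) * et.2).
  by apply: is_derive1_comp; rewrite W0; exact: is_derive1_powR.
pose V (e : R) := S e * W e `^ lambda + a.
have V0 : V 0 = u by rewrite /V S0 W0.
have dV : is_derive (0 : R) 1 V
    (sg * (lambda * w `^ (lambda - 1) * et.2) + w `^ lambda * et.1).
  have -> : V = S * ((@powR R)^~ lambda \o W) + cst a by apply/funext.
  by apply: is_derive_eq; rewrite addr0 S0 /= W0.
have dPV : is_derive (0 : R) 1 (Phi \o V) (1 / (u - lambda * u `^ lambda) *
    (sg * (lambda * w `^ (lambda - 1) * et.2) + w `^ lambda * et.1)).
  by apply: is_derive1_comp; rewrite V0.
have -> : G = L^-1 \*: ((@ln R \o W - cst (ln u)) + (Phi \o V)).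
  by apply/funext => e; rewrite /= /GRing.scale /= mulrC.
apply: is_derive_eq; rewrite /GRing.scale /= subr0.
set s := u `^ lambda.
have e1 : s `^ (1 - phi) = w `^ lambda.
  rewrite /s -powRrM /w powRM ?expR_ge0 ?(ltW u0) // -expRM -!expR_Mln // -expRD.
  by congr expR; rewrite /L; ring.
have e2 : u `^ phi = u / w.
  rewrite /w invfM mulrA divff ?gt_eqF // mul1r -expRN -expR_Mln // /L.
  by congr expR; ring.
have e3 : w `^ (lambda - 1) = w `^ lambda / w.
  by rewrite -[in RHS](powR_pred w lambda) // mulfK // gt_eqF.
have e4 : sg * w `^ lambda = s by rewrite /s -[RHS](addrK a) uu -sw addrK.
rewrite /Zresp -/s e1 e2 !div1r lnV ?posrE // -/L e3.
have -> : sg * (lambda * (w `^ lambda / w) * et.2) = lambda * s * et.2 / w.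
  by rewrite -e4; ring.
field; rewrite !gt_eqF //.
Qed.

(** An interior phase leaves room for the perturbation on all sides, so the point stays in its
    square and its phase [k + G e] stays between [k] and [k + 1]; the reduction modulo 4 then has no
    effect. *)
Lemma phase_response_interior (eta : R * R) k phi : (k < 4)%N -> 0 < phi < 1 ->
  response_limit lambda a gamma (4 * L) (k%:R + phi) eta
    (Zresp lambda u (iter k (@rotccw R) eta) phi).
Proof.
move=> k4 pp; have /andP[phi0 phi1] := pp.
set et := iter k _ eta.
have [G0 dG] := Zresp_derive phi et pp.
set sg := expR (- lambda * (phi * L)) in G0 dG.
set w := u * expR (phi * L) in G0 dG; set G := fun e => _ in G0 dG.
have {}G0 : G 0 = phi by exact: G0.
have hh : 0 <= phi * L < L.
  by rewrite mulr_ge0 ?(ltW L0) ?(ltW phi0) //= gtr_pMl.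
have coord e : local_coord a k.+1 (perturbed gamma (4 * L) (k%:R + phi) eta e) =
    (sg + e * et.1, w + e * et.2).
  rewrite /perturbed local_coordD.
  have -> : (k%:R + phi) * (4 * L) / 4 = k%:R * L + phi * L by field.
  rewrite (cycle_coord lambda a u gamma fg); last by case/andP: hh => -> /ltW.
  rewrite -/sg -/w rotccw_scale addSnnS.
  (* The local coordinates of [S_(k+1)] involve [k + 4] quarter turns, of which four cancel. *)
  have -> : iter (k + 4) (@rotccw R) eta = et.
    by rewrite (_ : k + 4 = k + 1 * 4)%N // iter4 //; exact: rotccw4.
  by [].
have [[/andP[au ub] b1] _ _ _ _] := hPhi.
have w01 : u < w < 1.
  rewrite /w; apply/andP; split.
    by rewrite ltr_pMr // -expR0 ltr_expR mulr_gt0.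
  by rewrite -[ltRHS](expR_Nln u) // ltr_pM2l // ltr_expR; case/andP: hh.
have sg01 : 0 < sg < 1.
  by rewrite expR_gt0 /= -expR0 ltr_expR mulNr oppr_lt0 !mulr_gt0.
have w0 : 0 < w by rewrite mulr_gt0 ?expR_gt0.
pose V (e : R) := (sg + e * et.1) * (w + e * et.2) `^ lambda + a.
have sw : sg * w `^ lambda + a = u.
  by have [_ _ ->] := cycle_coord_bounds lambda u l0 u01 _
    (ltac:(case/andP: hh => -> /ltW -> //) : 0 <= phi * L <= L).
have clin (c d : R) : (fun e => c + e * d) e @[e --> 0^'] --> c.
  have : (fun e => c + e * d) e @[e --> 0] --> c + 0 * d.
    by apply: cvgD; [exact: cvg_cst|apply: cvgM; [exact: cvg_id|exact: cvg_cst]].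
  by rewrite mul0r addr0; apply: cvg_trans; apply: cvg_app; exact: cvg_within.
have cV : V e @[e --> 0^'] --> u.
  rewrite -[X in _ --> X]sw; apply: cvgD; last exact: cvg_cst.
  apply: cvgM; first exact: clin.
  apply: (@continuous_cvg _ _ _ (0 : R)^' _ (fun e => w + e * et.2)
    ((@powR R)^~ lambda) w); last exact: clin.
  apply: differentiable_continuous; apply/derivable1_diffP.
  by have [] := is_derive1_powR lambda w0.
have cG : G e @[e --> 0^'] --> phi.
  rewrite -G0; have : {for 0, continuous G}.
    apply: differentiable_continuous; apply/derivable1_diffP.
    by case: dG.
  by apply: cvg_trans; apply: cvg_app; exact: cvg_within.
have good : \forall e \near (0 : R)^',
    is_asymptotic_phase lambda a gamma (4 * L)
      (perturbed gamma (4 * L) (k%:R + phi) eta e) (k%:R + G e) /\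
    wrap4 (asymptotic_phase lambda a gamma (4 * L)
      (perturbed gamma (4 * L) (k%:R + phi) eta e) - (k%:R + phi)) = G e - phi.
  near=> e.
  have s1 : sg + e * et.1 < 1.
    by near: e; apply: (cvgr_lt sg (clin _ _)); case/andP: sg01.
  have s2 : 0 < sg + e * et.1.
    by near: e; apply: (cvgr_gt sg (clin _ _)); case/andP: sg01.
  have w1 : w + e * et.2 < 1.
    by near: e; apply: (cvgr_lt w (clin _ _)); case/andP: w01.
  have w2 : 0 < w + e * et.2.
    by near: e; apply: (cvgr_gt w (clin _ _)).
  have v1 : a < V e by near: e; exact: (cvgr_gt u cV).
  have v2 : V e < b by near: e; exact: (cvgr_lt u cV).
  have g1 : 0 < G e by near: e; exact: (cvgr_gt phi cG).
  have g2 : G e < 1 by near: e; exact: (cvgr_lt phi cG).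
  have B : in_basin lambda a b (sg + e * et.1) (w + e * et.2).
    split; [by rewrite gtr0_norm // ltW|by rewrite w2|].
    by rewrite (ltW v1) (ltW v2).
  have E : phase_time u Phi k (w + e * et.2) (V e) / L = k%:R + G e.
    by rewrite /phase_time /G -/(V e) -/L; field; rewrite gt_eqF.
  have k3 : k%:R <= 3 :> R by rewrite (ler_nat _ k 3) -ltnS.
  have k0 : 0 <= k%:R :> R by [].
  have [|h1 h2] := asymptotic_phaseE _ _ _ _ (coord e) B.
    by rewrite -/(V e) E; lra.
  rewrite -/(V e) E in h1 h2; split=> //.
  by rewrite h2 wrap4_small; lra.
split.
  by apply: filterS good => e [h _]; exists (k%:R + G e).
have cdG := is_derive_cvg _ _ _ dG; rewrite G0 in cdG.
apply: cvg_trans cdG; apply: near_eq_cvg.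
by apply: filterS good => e [_ ->]; rewrite add0r.
Unshelve. all: by end_near. Qed.

Lemma Zresp_continuous (et : R * R) :
  Zresp lambda u et phi @[phi --> (0 : R)] --> Zresp lambda u et 0.
Proof.
have cexp (x : R) (f : R -> R) : 0 < x -> {for 0, continuous f} ->
    x `^ f t @[t --> (0 : R)] --> x `^ f 0.
  move=> x0 cf; have -> : (fun t => x `^ f t) = (fun t => expR (f t * ln x)).
    by apply/funext => t; rewrite expR_Mln.
  rewrite -expR_Mln //; apply: continuous_cvg; first exact: continuous_expR.
  by apply: cvgM; [exact: cf|exact: cvg_cst].
rewrite /Zresp; apply: cvgM; last exact: cvg_cst.
apply: cvgD; apply: cvgM; try exact: cvg_cst.
  apply: (cexp _ (fun t => 1 - t)); first by rewrite powR_gt0.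
  by apply: cvgB; [exact: cvg_cst|exact: cvg_id].
by apply: (cexp _ id) => //; exact: cvg_id.
Qed.

Lemma phase_response (eta : R * R) k phi : (k < 4)%N -> 0 <= phi < 1 ->
  is_phase_response lambda a gamma (4 * L) (k%:R + phi) eta
    (Zresp lambda u (iter k (@rotccw R) eta) phi).
Proof.
move=> k4 /andP[phi0 phi1]; rewrite /is_phase_response.
have [->|pn] := eqVneq phi 0.
  rewrite addr0 natr_int.
  (* Phases slightly above the integer are interior, where the formula is already known. *)
  exists (fun t => Zresp lambda u (iter k (@rotccw R) eta) (t - k%:R)).
    near=> t; have t1 : k%:R < t by near: t; exact: nbhs_right_gt.
    have t2 : t < k%:R + 1 by near: t; apply: nbhs_right_lt; rewrite ltrDl.
    have := phase_response_interior eta k (t - k%:R) k4 ltac:(lra).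
    by rewrite addrC subrK.
  apply: cvg_at_right_filter.
  have := Zresp_continuous (iter k (@rotccw R) eta) => H.
  have s : (fun t : R => t - k%:R) @ (k%:R : R) --> (0 : R).
    by rewrite -(subrr (k%:R : R)); apply: cvgB; [exact: cvg_id|exact: cvg_cst].
  exact: (cvg_comp _ _ s H).
have pp : 0 < phi < 1 by rewrite phi1 andbT lt_neqAle eq_sym pn.
rewrite ifF; first exact: phase_response_interior.
apply/negP => ki; have : phi \is a Num.int.
  by rewrite -(addKr k%:R phi) rpredD // rpredN natr_int.
move=> /intrP[m mE]; move: pp; rewrite mE ltr0z -[1]/(1%:~R) ltr_int.
by case: m {mE} => [[|m]|m].
Unshelve. all: by end_near. Qed.

End Phase.

(** * Small gap *)

(** Only the numerators depend on [phi], and they are powers of numbers in []0, 1[]: [s ^ (1 - phi)]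
    peaks at [phi = 1], [u ^ phi] at [phi = 0]. *)
Lemma Zresp_max {R : realType} (lambda u : R) (eta : R * R) :
  0 < lambda -> 0 < u < 1 -> eta = (1, 0) \/ eta = (0, 1) ->
  exists2 e : R, e = 0 \/ e = 1 &
    forall phi : R, 0 <= phi <= 1 ->
      `|Zresp lambda u eta phi| <= `|Zresp lambda u eta e|.
Proof.
move=> l0 /andP[u0 u1] [->|->]; [exists 1; first by right|exists 0; first by left];
  move=> phi /andP[p0 p1]; rewrite /Zresp /= !mul1r !mul0r ?addr0 ?add0r;
  rewrite !normrM ler_wpM2r // !ger0_norm ?powR_ge0 //.
  rewrite subrr powRr0 powR_le1 ?subr_ge0 //.
  by rewrite powR_gt0 //= powR_le1 ?u0 ?(ltW u1) ?(ltW l0).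
by rewrite powRr0 powR_le1 // u0 ltW.
Qed.

Lemma near_right_lt {R : realType} (f : R -> R) (c : R) : 0 < c ->
  f x @[x --> 0^'+] --> (0 : R) -> \forall x \near 0^'+, f x < c.
Proof. by move=> c0 cf; exact: (cvgr_lt (0 : R) cf). Qed.

(** For small [a], [rho] is positive at [a], negative at [2 * a] and positive at 1, which gives two
    roots, the smaller one in between [a] and [2 * a]. Negativity at [2 * a] amounts to
    [2 ^ lambda * a ^ (lambda - 1) < 1], which holds eventually since [lambda > 1]. *)
Lemma entry_coord_near0 {R : realType} (lambda : R) : 1 < lambda ->
  \forall a \near 0^'+, is_smallest_root lambda a (entry_coord lambda a) /\
    a < entry_coord lambda a < 2 * a.
Proof.
move=> l1; have l10 : 0 < lambda - 1 by lra.
have c0 : 0 < (2 `^ lambda)^-1 :> R by rewrite invr_gt0 powR_gt0.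
near=> a.
have a0 : 0 < a by near: a; exact: nbhs_right_gt.
have a1 : a < 1 / 4 by near: a; apply: nbhs_right_lt; lra.
have pa : a `^ (lambda - 1) < (2 `^ lambda)^-1.
  near: a; apply: near_right_lt => //; exact: powR_cvg0.
have h2a : (2 * a) `^ lambda < a.
  rewrite powRM ?(ltW a0) // -(powR_pred a lambda) // mulrA gtr_pMl //.
  by rewrite -ltr_pdivlMl ?powR_gt0 // mulr1.
have ra : 0 < rho lambda a a by rewrite /rho subrK powR_gt0.
have r2a : rho lambda a (2 * a) < 0 by rewrite /rho; lra.
have cr (x y : R) : 0 < x -> {within `[x, y], continuous (rho lambda a)}.
  move=> x0; apply: derivable_within_continuous => z.
  rewrite in_itv /= => /andP[xz _].
  by have [] := is_derive_rho lambda a z (lt_le_trans x0 xz).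
have [|x xI hx] := @IVT R (rho lambda a) a (2 * a) 0 ltac:(lra) (cr _ _ a0).
  by rewrite ge_min le_max (ltW ra) (ltW r2a) orbT.
have [|||y yI hy] := @IVT R (rho lambda a) (2 * a) 1 0 _ (cr _ _ _).
- by lra.
- by lra.
- by rewrite ge_min le_max rho1 (ltW a0) (ltW r2a) orbT.
move: xI yI; rewrite !in_itv /= => /andP[ax xa] /andP[ay ya].
have x0 : 0 < x by lra.
have xa' : x < 2 * a.
  by rewrite lt_neqAle xa andbT; apply/eqP => e; move: r2a; rewrite -e hx ltxx.
have sr : is_smallest_root lambda a x.
  by apply: (smallest_root_exists _ _ x y) => //; lra.
have se : is_smallest_root lambda a (entry_coord lambda a).
  by rewrite /entry_coord; apply: (xgetPex 0); exists x.
rewrite {2 3}(smallest_root_unique _ _ _ _ se sr); split=> //.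
rewrite xa' andbT; have := (rho_eq0 _ _ _).1 hx.
by have := powR_gt0 lambda x0; lra.
Unshelve. all: by end_near. Qed.

(** The difference [u - a] is [u ^ lambda], at most [(2 * a) ^ lambda], which is [a] times a
    multiple of [a ^ (lambda - 1)]. *)
Lemma entry_coord_littleo {R : realType} (lambda : R) : 1 < lambda ->
  (fun a : R => entry_coord lambda a - a) =o_ (0^'+) (fun a : R => a).
Proof.
move=> l1; have l10 : 0 < lambda - 1 by lra.
apply/eqoP => e e0.
have c0 : 0 < e / 2 `^ lambda by rewrite divr_gt0 // powR_gt0.
near=> a.
have a0 : 0 < a by near: a; exact: nbhs_right_gt.
have [[u0 hu _] /andP[au ua]] : is_smallest_root lambda a (entry_coord lambda a) /\
    a < entry_coord lambda a < 2 * a.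
  by near: a; exact: entry_coord_near0.
have pa : a `^ (lambda - 1) < e / 2 `^ lambda.
  near: a; apply: near_right_lt => //; exact: powR_cvg0.
rewrite !gtr0_norm ?subr_gt0 //.
have := (rho_eq0 _ _ _).1 hu; set u := entry_coord lambda a in u0 au ua *.
move=> uu; have -> : u - a = u `^ lambda by rewrite -{1}uu addrK.
apply: (@le_trans _ _ ((2 * a) `^ lambda)).
  by rewrite ge0_ler_powR ?nnegrE; lra.
rewrite powRM ?(ltW a0) // -(powR_pred a lambda) // mulrA ler_pM2r //.
by rewrite -ler_pdivlMl ?powR_gt0 // mulrC ltW.
Unshelve. all: by end_near. Qed.

Lemma entry_coord_cvg {R : realType} (lambda : R) : 1 < lambda ->
  entry_coord lambda a @[a --> (0 : R)^'+] --> (0 : R)^'+.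
Proof.
move=> l1 P HP; have : \forall x \near (0 : R)^'+, P x by exact: HP.
rewrite near_withinE => /nbhs_ballP[d /= d0 Hd].
change (\forall a \near (0 : R)^'+, P (entry_coord lambda a)).
near=> a.
have [[u0 _ _] /andP[_ ua]] : is_smallest_root lambda a (entry_coord lambda a) /\
    a < entry_coord lambda a < 2 * a.
  by near: a; exact: entry_coord_near0.
apply: Hd => //; rewrite /ball /= sub0r normrN gtr0_norm //.
apply: lt_trans ua _; rewrite mulrC -ltr_pdivlMr //.
by near: a; apply: nbhs_right_lt; rewrite divr_gt0.
Unshelve. all: by end_near. Qed.

(** Both responses take this form once [u] is cancelled from numerator and denominator. The last
    factor tends to 1, so the sign of the exponent [p] decides the limit. *)
Definition gain {R : realType} (lambda p u : R) : R :=
  u `^ p / (- ln u) / (1 - lambda * u `^ (lambda - 1)).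

Lemma Zresp_unstableE {R : realType} (lambda u phi : R) : 0 < u ->
  Zresp lambda u (0, 1) phi = gain lambda (phi - 1) u.
Proof.
move=> u0; rewrite /Zresp /gain /= mul0r mul1r add0r div1r lnV ?posrE //.
rewrite -(powR_pred u phi) // -(powR_pred u lambda) //.
rewrite (_ : u - _ = u * (1 - lambda * u `^ (lambda - 1))); last by ring.
by rewrite !invfM !mulrA; congr (_ / _); rewrite mulrAC mulfK // gt_eqF.
Qed.

Lemma Zresp_stableE {R : realType} (lambda u phi : R) : 0 < u ->
  Zresp lambda u (1, 0) phi = gain lambda (lambda * (1 - phi) - 1) u.
Proof.
move=> u0; rewrite /Zresp /gain /= mul0r mul1r addr0 div1r lnV ?posrE //.
rewrite -powRrM -(powR_pred u (lambda * (1 - phi))) // -(powR_pred u lambda) //.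
rewrite (_ : u - _ = u * (1 - lambda * u `^ (lambda - 1))); last by ring.
by rewrite !invfM !mulrA; congr (_ / _); rewrite mulrAC mulfK // gt_eqF.
Qed.

Lemma near_gain_factor {R : realType} (lambda c : R) : 1 < lambda -> 0 < c ->
  \forall u \near 0^'+, lambda * u `^ (lambda - 1) < c.
Proof.
move=> l1 c0; near=> u; rewrite mulrC -ltr_pdivlMr; last lra.
near: u; apply: near_right_lt; first by rewrite divr_gt0 //; lra.
by apply: powR_cvg0; lra.
Unshelve. all: by end_near. Qed.

(** The power [u ^ p] is split into two equal factors: one absorbs the logarithm, the other exceeds
    any bound. *)
Lemma gain_diverges {R : realType} (lambda p : R) : 1 < lambda -> p < 0 ->
  `|gain lambda p u| @[u --> (0 : R)^'+] --> +oo.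
Proof.
move=> l1 p0; apply/cvgryPge => A.
have A1 : 0 < `|A| + 1 by apply: ltr_wpDl.
have c0 : 0 < - p / 2 / (`|A| + 1) by rewrite !divr_gt0 //; lra.
near=> u.
have u0 : 0 < u by near: u; exact: nbhs_right_gt.
have u1 : u < 1 by near: u; apply: nbhs_right_lt.
have lu : 0 < - ln u by rewrite oppr_gt0 ln_lt0 // u0.
have f1 : lambda * u `^ (lambda - 1) < 1 by near: u; exact: near_gain_factor.
have f0 : 0 <= lambda * u `^ (lambda - 1) by rewrite mulr_ge0 ?powR_ge0 //; lra.
have pu : u `^ (- p / 2) < - p / 2 / (`|A| + 1).
  near: u; apply: near_right_lt => //; apply: powR_cvg0; lra.
have inv : u `^ (p / 2) = (u `^ (- p / 2))^-1 by rewrite -powRN; congr powR; field.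
have up : 0 < u `^ (p / 2) by rewrite powR_gt0.
(* [- ln u] is dominated by the power [u ^ (p / 2)], because [ln x <= x] *)
have lnu : - p / 2 * - ln u <= u `^ (p / 2).
  have := le_ln1Dx (x := u `^ (p / 2) - 1) ltac:(lra).
  by rewrite addrC subrK ln_powR; lra.
rewrite ger0_norm; last first.
  by rewrite /gain !divr_ge0 ?powR_ge0 ?(ltW lu) //; lra.
apply: (@le_trans _ _ (u `^ p / - ln u)); last first.
  by rewrite /gain ler_pdivlMr; [rewrite ler_piMr ?divr_ge0 ?powR_ge0 ?(ltW lu)|]; lra.
rewrite ler_pdivlMr //.
have -> : u `^ p = u `^ (p / 2) * u `^ (p / 2).
  by rewrite -powRD ?(gt_eqF u0) ?implybT //; congr powR; field.
have big : `|A| + 1 <= - p / 2 * u `^ (p / 2).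
  rewrite inv ler_pdivlMr ?powR_gt0 // mulrC -ler_pdivlMr //.
  by rewrite ltW.
have p20 : 0 < - p / 2 by lra.
rewrite -(ler_pM2l p20); apply: (@le_trans _ _ ((`|A| + 1) * (- p / 2 * - ln u))).
  rewrite mulrCA ler_wpM2r ?mulr_ge0 ?(ltW lu) //; first lra.
  by rewrite (le_trans (ler_norm A)) // lerDl.
rewrite [leRHS]mulrA; apply: ler_pM => //.
by rewrite mulr_ge0 ?(ltW lu) ?(ltW p20).
Unshelve. all: by end_near. Qed.

(** The decay comes from the logarithm, the power being merely bounded by 1. This covers [p = 0],
    the borderline phase [1 - 1 / lambda]. *)
Lemma gain_vanishes {R : realType} (lambda p : R) : 1 < lambda -> 0 <= p ->
  gain lambda p u @[u --> (0 : R)^'+] --> (0 : R).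
Proof.
move=> l1 p0; apply/cvgrPdist_le => e e0; near=> u.
have u0 : 0 < u by near: u; exact: nbhs_right_gt.
have u1 : u < 1 by near: u; apply: nbhs_right_lt.
have f1 : lambda * u `^ (lambda - 1) < 1 / 2.
  by near: u; apply: near_gain_factor => //; lra.
(* The 2 compensates for the last factor of [gain], which is only known to exceed [1 / 2]. *)
have ue : u < expR (- (2 / e)) by near: u; apply: nbhs_right_lt; exact: expR_gt0.
have lu : 2 / e <= - ln u.
  by rewrite lerNr -[leRHS]expRK ler_ln ?posrE ?expR_gt0 // ltW.
have e2 : 0 < 2 / e by rewrite divr_gt0.
rewrite sub0r normrN ger0_norm; last first.
  by rewrite /gain !divr_ge0 ?powR_ge0 //; lra.
rewrite /gain ler_pdivrMr; last lra.
rewrite ler_pdivrMr; last lra.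
apply: (@le_trans _ _ (e * (1 / 2) * (2 / e))).
  have -> : e * (1 / 2) * (2 / e) = 1 by field; rewrite gt_eqF.
  by rewrite powR_le1 // u0 ltW.
apply: ler_pM; [by rewrite mulr_ge0 //; lra|exact: ltW| |exact: lu].
by rewrite ler_pM2l //; lra.
Unshelve. all: by end_near. Qed.

Theorem theorem1 (R : realType) (lambda : R) (hlambda : 1 < lambda) :
  (forall a : R, 0 < a < 1 ->
   (exists r1 r2 : R,
      [/\ 0 < r1, r1 < r2, rho lambda a r1 = 0 & rho lambda a r2 = 0]) ->
   (* (1) *)
   (exists (gamma : R -> R * R) (T : R),
      is_stable_limit_cycle lambda a gamma T) /\
   (exists u : R, is_smallest_root lambda a u) /\
   forall u : R, is_smallest_root lambda a u ->
     (forall (gamma : R -> R * R) (T : R),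
        is_stable_limit_cycle lambda a gamma T ->
        [/\ forall tau : nat -> R, is_itinerary a gamma tau ->
              forall n : nat,
                local_coord a n.+1 (gamma (tau n)) = (1, u) /\
                local_coord a n.+1 (gamma (tau n.+1)) = (u `^ lambda, 1),
            T = 4 * ln (1 / u)
   (* (2) *)
          & forall (eta : R * R) (k : nat) (phi : R),
              norm1 eta = 1 -> (k < 4)%N -> 0 <= phi < 1 ->
              is_phase_response lambda a gamma T (k%:R + phi) eta
                (Zresp lambda u (iter k (@rotccw R) eta) phi)]) /\
     (forall eta : R * R, eta = (1, 0) \/ eta = (0, 1) ->
        exists2 e : R, e = 0 \/ e = 1 &
          forall phi : R, 0 <= phi <= 1 ->
            `|Zresp lambda u eta phi| <= `|Zresp lambda u eta e|)) /\
  (* (3) *)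
  [/\ (fun a : R => entry_coord lambda a - a) =o_ (0^'+) (fun a : R => a),
      forall phi : R, 0 <= phi < 1 ->
        `|Zresp lambda (entry_coord lambda a) (0, 1) phi| @[a --> 0^'+] --> +oo,
      forall phi : R, 1 - 1 / lambda < phi < 1 ->
        `|Zresp lambda (entry_coord lambda a) (1, 0) phi| @[a --> 0^'+] --> +oo
    & forall phi : R, 0 <= phi <= 1 - 1 / lambda ->
        Zresp lambda (entry_coord lambda a) (1, 0) phi @[a --> 0^'+] --> (0 : R)].
Proof.
have l0 : 0 < lambda by lra.
split.
  move=> a /andP[a0 a1] [u [r2 [u0 ur hu hr]]].
  have su := smallest_root_exists _ _ _ _ hlambda u0 ur hu hr.
  have uu := (rho_eq0 _ _ _).1 hu.
  have u1 := root_lt1 _ _ _ hlambda a0 u0 hu.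
  have u01 : 0 < u < 1 by rewrite u0.
  have [b [Phi hPhi]] := phase_sum_exists _ _ _ _ hlambda a0 u0 ur hu hr.
  split; [|split; first by exists u].
    have [gamma [tg e0]] := trajectory_exists _ _ 1 _ _ l0 a0
      (cycle_coding _ _ _ u01 uu) (cycle_unbounded _ u01).
    have fg : follows_cycle lambda a u gamma.
      by apply: trajectory_follows => //; exact: cycle_coding.
    exists gamma, (4 * - ln u).
    exact: (cycle_is_stable_limit_cycle _ _ _ _ _ _ l0 a0 uu hPhi tg fg).
  move=> _ /(smallest_root_unique _ _ _ _ su) <-.
  split; last by move=> eta; exact: Zresp_max.
  move=> gamma T [lc st].
  have [w [w01 ww fg TE]] := limit_cycle_structure _ _ _ _ l0 a0 lc.
  have [tg _ _ _ _] := lc; have hw := (rho_eq0 _ _ _).2 ww.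
  (* Every limit cycle passes through some root of [rho]; stability leaves only the smallest. *)
  have uw : u = w.
    have [_ _ /(_ w)] := su; have /andP[w0 _] := w01; move=> /(_ w0 hw).
    rewrite le_eqVlt => /orP[/eqP //|lt_uw].
    by have := larger_root_unstable _ _ _ _ _ hlambda a0 u0 lt_uw hu hw tg fg st.
  rewrite -uw in fg TE.
  split.
  - move=> tau itin n.
    have [v [cod tauE fv _ entry]] := itinerary_coding _ _ _ _ l0 a0 tg itin.
    have [_ _ _ vS] := cod.
    have vu m : v m = u.
      elim: m => [|m IHm]; last by rewrite vS mul1r IHm.
      have := entry 0%N; have [-> _ _ _ _] := itin.
      have := follows_entry _ _ _ _ _ _ 0%N (cycle_coding _ _ _ u01 uu) fg.
      by rewrite entry_time0 => -> [].
    split; first by rewrite entry vu.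
    (* The exit from a square is the entry into the next, read back in the coordinates of the
       former. *)
    have := entry n.+1; rewrite vu local_coordS.
    case: (local_coord a n.+1 _) => x y /= [hx hy].
    by congr pair; lra.
  - by rewrite TE div1r lnV ?posrE.
  - move=> eta k phi _ k4 phi01; rewrite TE.
    apply: (phase_response _ _ _ _ _ _ l0 a0 uu _ hPhi tg fg) => //.
    rewrite -(powR_pred u lambda) // mulrA -[X in X - _]mul1r -mulrBl.
    by rewrite mulr_gt0 // subr_gt0 (drho_smallest _ _ _ _ hlambda u0 ur hu hr).
have entry_pos : \forall a \near (0 : R)^'+, 0 < entry_coord lambda a.
  by apply: filterS (entry_coord_near0 _ hlambda) => a [[]].
split.
- exact: entry_coord_littleo.
- move=> phi /andP[_ phi1].
  have H := cvg_comp _ _ (entry_coord_cvg _ hlambda)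
    (gain_diverges lambda (phi - 1) hlambda ltac:(lra)).
  apply: cvg_trans H; apply: near_eq_cvg; apply: filterS entry_pos => a ua /=.
  by rewrite Zresp_unstableE.
- move=> phi /andP[phi0 phi1].
  (* The exponent changes sign at [phi = 1 - 1 / lambda]. *)
  have p0 : lambda * (1 - phi) - 1 < 0.
    have : lambda * (1 - phi) < lambda * (1 / lambda) by rewrite ltr_pM2l //; lra.
    by rewrite div1r divff ?gt_eqF //; lra.
  have H := cvg_comp _ _ (entry_coord_cvg _ hlambda)
    (gain_diverges lambda _ hlambda p0).
  apply: cvg_trans H; apply: near_eq_cvg; apply: filterS entry_pos => a ua /=.
  by rewrite Zresp_stableE.
- move=> phi /andP[phi0 phi1].
  have p0 : 0 <= lambda * (1 - phi) - 1.
    have : lambda * (1 / lambda) <= lambda * (1 - phi) by rewrite ler_pM2l //; lra.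
    by rewrite div1r divff ?gt_eqF //; lra.
  have H := cvg_comp _ _ (entry_coord_cvg _ hlambda)
    (gain_vanishes lambda _ hlambda p0).
  apply: cvg_trans H; apply: near_eq_cvg; apply: filterS entry_pos => a ua /=.
  by rewrite Zresp_stableE.
Qed.
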